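(* Let $\alpha \in (0,2)$, $x_0 \in \mathbb{R}$, $r > 0$ and $D = (x_0-r,x_0+r)$. Then there is a constant $\lambda_{\alpha,D} > 0$ such that the interior Bernoulli problem for $(-\Delta)^{\alpha/2}$ on $D$ with parameter $\lambda>0$ has (1) at least two solutions for $\lambda > \lambda_{\alpha,D}$, (2) at least one solution for $\lambda = \lambda_{\alpha,D}$, (3) no solution for $\lambda < \lambda_{\alpha,D}$. Moreover, if $(u,K)$ is any solution of the interior Bernoulli problem on $D$ (for some $\lambda>0$), then $K$ is symmetric with respect to $x_0$. We also have $\lambda_{\alpha,D} = \lambda_{\alpha,(x_0-r,x_0+r)} = r^{-\alpha/2}\lambda_{\alpha,(-1,1)}$.
   Context: For $\alpha\in(0,2)$ the fractional Laplacian on $\mathbb{R}$ is $$(-\Delta)^{\alpha/2}f(x) = \lim_{\varepsilon \to 0^+} \frac{\alpha 2^{\alpha-1}\Gamma\left(\frac{1+\alpha}{2}\right)}{\pi^{1/2}\Gamma(1-\alpha/2)}\int_{\{z\in\mathbb{R}:\,|z|>\varepsilon\}}\frac{f(x+z)-f(x)}{|z|^{1+\alpha}}\,dz .$$ A domain is a nonempty connected open set; $D^c=\mathbb{R}\setminus D$. For a domain $K$ and $x\in\partial K$ the generalized normal derivative is $D_n^{\alpha/2}u(x)=\lim_{t\to0^+}\frac{u(x+t\,n(x))-u(x)}{t^{\alpha/2}}$, where $n(x)$ is the outward unit normal vector to $K$ at $x$ (in dimension one, $n=+1$ at the right endpoint of an interval $K$ and $n=-1$ at the left endpoint). Interior Bernoulli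 problem (dimension one): given $\alpha\in(0,2)$, a bounded open interval $D\subset\mathbb{R}$ and a constant $\lambda>0$, a solution is a pair $(u,K)$ where $u:\mathbb{R}\to[0,1]$ is continuous and $K\subset D$ is a domain of class $C^1$ (in dimension one: an open interval) such that $(-\Delta)^{\alpha/2}u(x)=0$ for $x\in D\setminus\overline{K}$; $u(x)=1$ for $x\in\overline{K}$; $u(x)=0$ for $x\in D^c$; $D_n^{\alpha/2}u(x)=-\lambda$ for $x\in\partial K$. *)

(* Defs.v *)
From mathcomp Require Export all_boot all_order all_algebra.
From mathcomp Require Export all_classical all_reals all_analysis.
Export Order.TTheory GRing.Theory Num.Theory numFieldNormedType.Exports.
Set Implicit Arguments.
Unset Strict Implicit.
Unset Printing Implicit Defensive.
Local Open Scope classical_set_scope.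
Local Open Scope ring_scope.

Definition Gamma (R : realType) (s : R) : R :=
  \int[lebesgue_measure]_(t in `]0, +oo[) (t `^ (s - 1) * expR (- t)).

Definition frac_laplacian_cst (R : realType) (alpha : R) : R :=
  alpha * 2 `^ (alpha - 1) * Gamma ((1 + alpha) / 2) /
  (pi `^ (1 / 2) * Gamma (1 - alpha / 2)).

(* The limit defining the fractional Laplacian of [f] at [x] exists and equals
   [l]. [Rintegral] is total; here it is only applied to bounded continuous
   [f], for which the truncated integrals converge absolutely. *)
Definition is_frac_laplacian (R : realType) (alpha : R) (f : R -> R)
    (x l : R) : Prop :=
  frac_laplacian_cst alpha *
    (\int[lebesgue_measure]_(z in [set z : R | eps < `|z|])
        ((f (x + z) - f x) / `|z| `^ (1 + alpha)))
  @[eps --> 0^'+] --> l.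

Definition domain (R : realType) (K : set R) : Prop :=
  [/\ K !=set0, open K & connected K].

Definition boundary (R : realType) (K : set R) : set R :=
  closure K `\` interior K.

(* Meaningful when [K] is a bounded domain, i.e. a bounded open interval, and
   [x] is one of its two endpoints [inf K] and [sup K]. *)
Definition outward_normal (R : realType) (K : set R) (x : R) : R :=
  if x == sup K then 1 else - 1.

Definition is_normal_derivative (R : realType) (alpha : R) (K : set R)
    (u : R -> R) (x l : R) : Prop :=
  (u (x + t * outward_normal K x) - u x) / t `^ (alpha / 2)
  @[t --> 0^'+] --> l.

(* No C^1 condition on [K] appears: the boundary of a bounded domain of the
   real line is a pair of points, so the condition is void. *)
Record bernoulli_solution (R : realType) (alpha : R) (D : set R) (lam : R)
    (u : R -> R) (K : set R) : Prop := BernoulliSolution {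
  bernoulli_range : forall x, 0 <= u x <= 1;
  bernoulli_continuous : continuous u;
  bernoulli_domain : domain K;
  bernoulli_sub : K `<=` D;
  bernoulli_harmonic :
    forall x, (D `\` closure K) x -> is_frac_laplacian alpha u x 0;
  bernoulli_inner : forall x, closure K x -> u x = 1;
  bernoulli_outer : forall x, (~` D) x -> u x = 0;
  bernoulli_normal :
    forall x, boundary K x -> is_normal_derivative alpha K u x (- lam)
}.

Definition symmetric_about (R : realType) (x0 : R) (K : set R) : Prop :=
  forall x, K x <-> K (2 * x0 - x).

(* Main.v *)
Require Import Defs.
From mathcomp Require Import ring lra measurable_realfun.

(** Put be = alpha / 2, K = ]a, b[ and D = ]p, q[. In dimension one the whole
problem can be reduced to the Poisson kernel of an interval ]a, b[,
  c (((x - a)(b - x)) / ((y - a)(y - b)))^be / |y - x|   for y outside [a, b],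
which has mass one ([pkernel_mass]) and whose integrals against functions with
values in [0, 1] are harmonic ([pvharm_pext]). Harmonicity rests on an explicit
identity, [kernel_balance]: jumping from x out of a small window inside ]a, b[
and leaving the interval at y from there, or jumping from x to y directly, has,
up to a small error, a total weight proportional to the kernel at (x, y) with a
factor independent of y. The fractional Laplacian has a minimum principle, in a plain form
([min_principle]) and in one for functions that are antisymmetric about a point
([antisym_min_principle]). Hence harmonic functions are represented by the
kernel ([poisson_representation]), solutions of the Dirichlet problem are unique
and monotone in D and K ([dirichlet_compare]), and the normal derivative at an
end of K is minus an explicit integral, the [flux] of 1 - u ([dirichlet_flux]).

For K = ]-1, 1[ and D = ]-l, l[ with l > 1, alternating Poisson integrals produce
the solution [potential l] of the Dirichlet problem; its normal derivative is
the constant - [speed l], by evenness. Dilations turn it into a solution on an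
interval of half-width r, with lam = r^(- be) (scaled_speed l), where
[scaled_speed l] is l^be (speed l). This function of l is continuous. It tends
to infinity at 1, because the exterior of D comes close to K, and at infinity,
because on the far side of K the function 1 - u is at least of order
((|x| - 1) / l)^be up to |x| = (l + 1) / 2, which makes its flux at least of
order l^(- be) ln l. So it attains a positive minimum, and every larger value
is taken on both sides of the minimum.

There are no other solutions. If the centre m of K were on the right of that of
D, then w = u(2m - .) - u would be nonnegative on the right of m by the
antisymmetric minimum principle, and positive at q. The normal derivatives of u
at the two ends of K agree, so w has zero flux into ]b, b + s[ for each small s.
Folding that integral at m gives a positive part bounded below independently of
s and a negative part of order s ([hopf_balance]), which is absurd for small s.
So K is concentric with D and u is a rescaled potential by uniqueness. The
critical constant is the infimum of the admissible lam, that is r^(- be) times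
the minimum of scaled_speed, whence also its scaling. *)

Local Open Scope classical_set_scope.
Local Open Scope ring_scope.

Set Implicit Arguments.
Unset Strict Implicit.
Unset Printing Implicit Defensive.

(** * Change of variables *)

Section change_of_variables.
Variable R : realType.
Notation mu := (@lebesgue_measure R).
Implicit Types (D : set R) (f : R -> \bar R) (s t : R).
Lemma affine_measurable s t : measurable_fun [set: R] (fun x : R => s * x + t).
Proof. by apply: continuous_measurable_fun => x; apply: cvgD; [exact: mulrl_continuous|exact: cvg_cst]. Qed.

Lemma lebesgue_measure_affine s t D : s != 0 -> measurable D ->
  (mu D = `|s|%:E * mu ((fun x => s * x + t)%R @^-1` D))%E.
Proof.
move=> s0 mD.
pose phi := (fun x : measurableTypeR R => (s * x + t : measurableTypeR R)).
have mphi : measurable_fun setT phi by exact: affine_measurable.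
pose pf : {measure set (measurableTypeR R) -> \bar R} := (@measure_function_pushforward__canonical__measure_function_Measure _ _ _ _ _ mu phi mphi).
pose nu : {measure set (measurableTypeR R) -> \bar R} := mscale (NngNum (normr_ge0 s)) pf.
rewrite (@lebesgue_measure_unique _ nu _ _ mD)//.
move=> X [[a b] _ <-]; rewrite /nu/= /mscale/= /pushforward/=.
have [sgt|slt] := ltP 0 s.
  have -> : phi @^-1` `]a, b] = `](a - t) / s, (b - t) / s]%classic.
    apply/seteqP; split => x /=; rewrite !in_itv/= /phi ltr_pdivrMr// ler_pdivlMr// (mulrC x); lra.
  rewrite !lebesgue_measure_itv/= !lte_fin ltr_pM2r ?invr_gt0// ltrD2r.
  case: ifPn => _; last by rewrite mule0.
  rewrite -!EFinD -EFinM gtr0_norm//; congr EFin; field; lra.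
have {}slt : s < 0 by lra.
have -> : phi @^-1` `]a, b] = `[(b - t) / s, (a - t) / s[%classic.
  apply/seteqP; split => x /=; rewrite !in_itv/= /phi ltr_ndivlMr// ler_ndivrMr// (mulrC x); lra.
rewrite !lebesgue_measure_itv/= !lte_fin ltr_nM2r ?invr_lt0// ltrD2r.
case: ifPn => _; last by rewrite mule0.
by rewrite -!EFinD -EFinM ltr0_norm//; congr EFin; field; lra.
Qed.

Lemma ge0_integral_affine s t D f : s != 0 -> measurable D ->
  measurable_fun D f -> (forall x, D x -> (0 <= f x)%E) ->
  (\int[mu]_(y in D) f y =
   `|s|%:E * \int[mu]_(x in (fun x => s * x + t)%R @^-1` D) f (s * x + t)%R)%E.
Proof.
move=> s0 mD mf f0.
pose phi := (fun x : measurableTypeR R => (s * x + t : measurableTypeR R)).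
have mphi : measurable_fun setT phi by exact: affine_measurable.
pose pf : {measure set (measurableTypeR R) -> \bar R} := (@measure_function_pushforward__canonical__measure_function_Measure _ _ _ _ _ mu phi mphi).
rewrite (@eq_measure_integral _ _ _ _ (mscale (NngNum (normr_ge0 s)) pf)); last first.
  by move=> A mA _; rewrite /mscale/= /pushforward; exact: lebesgue_measure_affine.
rewrite ge0_integral_mscale//=; congr (_ * _)%E.
by rewrite ge0_integral_pushforward// => y /set_mem; exact: f0.
Qed.

Lemma integral_affine s t D (f : R -> R) : s != 0 -> measurable D ->
  measurable_fun D f ->
  (\int[mu]_(y in D) (f y)%:E =
   `|s|%:E * \int[mu]_(x in (fun x => s * x + t)%R @^-1` D) (f (s * x + t)%R)%:E)%E.
Proof.
move=> s0 mD /measurable_EFinP mf.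
have P := ge0_integral_affine t s0 mD (measurable_funepos mf) (fun x _ => funepos_ge0 _ x).
have N := ge0_integral_affine t s0 mD (measurable_funeneg mf) (fun x _ => funeneg_ge0 _ x).
rewrite integralE P N.
have sp : (0 < `|s|%:E)%E by rewrite lte_fin normr_gt0.
have yE : (`|s|%:E * +oo = +oo)%E by rewrite gt0_muley.
have NyE : (`|s|%:E * -oo = -oo)%E by rewrite gt0_muleNy.
have -> (I J : \bar R) : (`|s|%:E * I - `|s|%:E * J = `|s|%:E * (I - J))%E.
  by case: I J => [u| |] [v| |]; rewrite ?yE ?NyE -?EFinM -?EFinB -?EFinM ?mulrBr//= ?yE ?NyE.
congr (_ * _)%E; apply/esym.
rewrite [LHS]integralE; congr (_ - _)%E; apply: eq_integral => x _;
  by rewrite ?funeposE ?funenegE.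
Qed.

(** An infinite integral is read as 0 on both sides, so that the identity holds
for every measurable f. *)
Lemma Rintegral_affine s t D (f : R -> R) : s != 0 -> measurable D ->
  measurable_fun D f ->
  \int[mu]_(y in D) f y =
   `|s| * \int[mu]_(x in (fun x => s * x + t) @^-1` D) f (s * x + t).
Proof.
move=> s0 mD mf; rewrite /Rintegral (integral_affine t s0)//.
have sp : (0 < `|s|%:E)%E by rewrite lte_fin normr_gt0.
case: (integral _ _ _) => [r| |] //=; first by rewrite gt0_muley//= mulr0.
by rewrite gt0_muleNy//= mulr0.
Qed.

Lemma ge0_cvg_integral_bigcup (F : (set R)^nat) (f : R -> R) :
  {homo F : n m / (n <= m)%N >-> n `<=` m} -> (forall n, measurable (F n)) ->
  (forall n, measurable_fun (F n) f) -> (forall n x, F n x -> 0 <= f x) ->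
  (\int[mu]_(x in F n) (f x)%:E)%E @[n --> \oo] --> (\int[mu]_(x in \bigcup_n F n) (f x)%:E)%E.
Proof.
move=> ndF mF mf f0; apply: ge0_nondecreasing_set_cvg_integral => //.
- by move=> n m nm; rewrite subsetEset; exact: ndF.
- by move=> n; move/measurable_EFinP : (mf n).
Qed.

(** Substitution holds on the compact intervals [p + 1/(n + 1), p + 1 + n],
which exhaust the half-line, and passes to the limit by monotone convergence.
The hypotheses make J the range of F, bounded or not. *)
Lemma ge0_integral_subst (F F' G : R -> R) (p : R) (J : set R) :
  is_interval J ->
  (forall x, p < x -> is_derive x 1 F (F' x)) ->
  (forall x, p < x -> 0 < F' x) ->
  (forall x, p < x -> {for x, continuous F'}) ->
  (forall x, p < x -> J (F x)) ->
  (forall y, J y -> exists x1 x2, [/\ p < x1, p < x2 & F x1 <= y <= F x2]) ->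
  (forall y, J y -> {for y, continuous G}) ->
  (forall y, J y -> 0 <= G y) ->
  (\int[mu]_(y in J) (G y)%:E = \int[mu]_(x in `]p, +oo[) (G (F x) * F' x)%:E)%E.
Proof.
move=> itvJ dF F'0 cF' FJ JF cG G0.
have cF x : p < x -> {for x, continuous F}.
  by move=> px; apply/differentiable_continuous/derivable1_diffP; case: (dF x px).
have dE x : p < x -> (F^`())%classic x = F' x.
  by move=> px; rewrite derive1E; case: (dF x px).
have cdF x : p < x -> {for x, continuous (F^`())%classic}.
  move=> px; rewrite /prop_for /continuous_at dE//.
  apply: cvg_trans (cF' x px); apply: near_eq_cvg; near=> z; apply/esym/dE.
  by near: z; exact: lt_nbhsr.
have incr x y : p < x -> x < y -> F x < F y.
  move=> px xy.
  have [|z|z zxy Ez] := @MVT _ F F' x y xy.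
  - by move=> z; rewrite in_itv/= => /andP[xz _]; apply: dF; lra.
  - apply: derivable_within_continuous => z'; rewrite in_itv/= => /andP[xz _].
    by case: (dF z'); first lra.
  - rewrite -subr_gt0 Ez mulr_gt0 ?subr_gt0//; apply: F'0.
    by move: zxy; rewrite in_itv/= => /andP[]; lra.
pose a n : R := p + n.+1%:R^-1.
pose b n : R := p + 1 + n%:R.
have pa n : p < a n by rewrite /a ltrDl.
have ab n : a n <= b n.
  rewrite /a /b -addrA lerD2l (@le_trans _ _ 1)//.
    by rewrite invf_le1// ler1n.
  by rewrite lerDl.
have IVTF n y : F (a n) <= y <= F (b n) -> exists2 x, a n <= x <= b n & F x = y.
  move=> yab; have [] := @IVT _ F (a n) (b n) y (ab n).
  - apply: derivable_within_continuous => z'; rewrite in_itv/= => /andP[xz _].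
    by case: (dF z'); first by have := pa n; lra.
  - have Fab : F (a n) <= F (b n).
      by have := ab n; rewrite le_eqVlt => /predU1P[->//|/(incr _ _ (pa n))/ltW].
    by rewrite (min_idPl Fab) (max_idPr Fab).
  - by move=> c; rewrite in_itv/= => ? ?; exists c.
have FabJ n y : F (a n) <= y <= F (b n) -> J y.
  by move=> /IVTF[x /andP[ax _] <-]; apply: FJ; have := pa n; lra.
have bigI : \bigcup_n `[a n, b n]%classic = `]p, +oo[%classic.
  apply/seteqP; split=> [x [n _]|x]/=; rewrite !in_itv/= ?andbT.
    by move=> /andP[]; have := pa n; lra.
  move=> px.
  have xp : 0 < x - p by lra.
  exists (maxn (Num.truncn (x - p)^-1) (Num.truncn (x - p))) => //=; rewrite in_itv/=; apply/andP; split.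
    rewrite /a -lerBrDl invf_ple ?posrE//.
    apply: (@le_trans _ _ (Num.truncn (x - p)^-1).+1%:R).
      by apply/ltW; rewrite truncnS_gt.
    by rewrite ler_nat ltnS leq_maxl.
  have : x - p < (Num.truncn (x - p)).+1%:R by rewrite truncnS_gt.
  have : (Num.truncn (x - p))%:R <= (maxn (Num.truncn (x - p)^-1) (Num.truncn (x - p)))%:R :> R.
    by rewrite ler_nat leq_maxr.
  by rewrite /b -natr1; lra.
have am : {homo a : n m / (n <= m)%N >-> m <= n}.
  by move=> n m nm; rewrite /a lerD2l lef_pV2 ?posrE// ler_nat.
have bm : {homo b : n m / (n <= m)%N >-> n <= m}.
  by move=> n m nm; rewrite /b lerD2l ler_nat.
have incrle x y : p < x -> x <= y -> F x <= F y.
  by move=> px; rewrite le_eqVlt => /predU1P[->//|/(incr _ _ px)/ltW].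
have bigJ : \bigcup_n `[F (a n), F (b n)]%classic = J.
  apply/seteqP; split=> [y [n _]|y /JF [x1 [x2 [px1 px2 /andP[y1 y2]]]]]/=.
    by rewrite in_itv/=; exact: FabJ.
  have : (\bigcup_n `[a n, b n]%classic) x1 by rewrite bigI/= in_itv/= px1.
  have : (\bigcup_n `[a n, b n]%classic) x2 by rewrite bigI/= in_itv/= px2.
  move=> [n2 _ /=] /[!in_itv]/= /andP[_ xb] [n1 _ /=] /[!in_itv]/= /andP[ax _].
  exists (maxn n1 n2) => //=; rewrite in_itv/=; apply/andP; split.
    apply: le_trans y1; apply: incrle; first exact: pa.
    by apply: le_trans ax; apply: am; rewrite leq_maxl.
  apply: (le_trans y2); apply: incrle => //.
  by apply: (le_trans xb); apply: bm; rewrite leq_maxr.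
have mG n : measurable_fun `[F (a n), F (b n)] (EFin \o G).
  apply/measurable_EFinP; apply: subspace_continuous_measurable_fun => //.
  apply: continuous_in_subspaceT => y; rewrite inE/= in_itv/= => /FabJ; exact: cG.
have cGF x : p < x -> {for x, continuous (fun x => G (F x) * F' x)}.
  move=> px; apply: cvgM; last exact: cF'.
  by apply: continuous_comp; [exact: cF|apply: cG; exact: FJ].
have mGF n : measurable_fun `[a n, b n] (EFin \o (fun x => G (F x) * F' x)).
  apply/measurable_EFinP; apply: subspace_continuous_measurable_fun => //.
  apply: continuous_in_subspaceT => y; rewrite inE/= in_itv/= => /andP[ay _].
  by apply: cGF; have := pa n; lra.
have cv1 : (\int[mu]_(y in `[F (a n), F (b n)]) (G y)%:E)%E @[n --> \oo] --> (\int[mu]_(y in J) (G y)%:E)%E.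
  rewrite -bigJ; apply: ge0_cvg_integral_bigcup => //.
  - move=> n m nm; apply: subset_itv; rewrite bnd_simp; apply: incrle => //; first exact: am.
    by apply: lt_le_trans (pa n) (ab n).
    exact: bm.
  - by move=> n; apply/measurable_EFinP.
  - by move=> n x /=; rewrite in_itv/= => /FabJ; exact: G0.
have cv2 : (\int[mu]_(x in `[a n, b n]) (G (F x) * F' x)%:E)%E @[n --> \oo] -->
    (\int[mu]_(x in `]p, +oo[) (G (F x) * F' x)%:E)%E.
  rewrite -bigI; apply: ge0_cvg_integral_bigcup => //.
  - by move=> n m nm; apply: subset_itv; rewrite bnd_simp; [exact: am|exact: bm].
  - by move=> n; apply/measurable_EFinP.
  - move=> n x /=; rewrite in_itv/= => /andP[ax _].
    have px : p < x by have := pa n; lra.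
    by rewrite mulr_ge0 ?G0 ?ltW ?F'0//; exact: FJ.
suff E n : (\int[mu]_(y in `[F (a n), F (b n)]) (G y)%:E =
   \int[mu]_(x in `[a n, b n]) (G (F x) * F' x)%:E)%E.
  have /cvg_lim <- := cv1 => //; have /cvg_lim <- := cv2 => //.
  by congr (limn _); apply/funext.
rewrite integration_by_substitution_increasing//.
- apply: eq_integral => x; rewrite inE/= in_itv/= => /andP[ax _].
  by rewrite /GRing.mul/= dE//; have := pa n; lra.
- move=> x y; rewrite !in_itv/= => /andP[ax _] _; apply: incr; have := pa n; lra.
- by move=> x; rewrite in_itv/= => /andP[ax _]; apply: cdF; have := pa n; lra.
- by apply/cvg_ex; exists (F^`()%classic (a n)); apply: cvg_at_right_filter; exact: cdF.
- apply/cvg_ex; exists (F^`()%classic (b n)); apply: cvg_at_left_filter; apply: cdF.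
  by have := pa n; have := ab n; lra.
- split.
  + move=> x; rewrite in_itv/= => /andP[ax _].
    by case: (dF x) => //; have := pa n; lra.
  + by apply: cvg_at_right_filter; exact: cF.
  + by apply: cvg_at_left_filter; apply: cF; have := pa n; have := ab n; lra.
- apply: continuous_in_subspaceT => y; rewrite inE/= in_itv/= => /FabJ; exact: cG.
Unshelve. all: by end_near.
Qed.

End change_of_variables.

(** * Powers and elementary integration *)

Section analysis_tools.
Variable R : realType.
Notation mu := (@lebesgue_measure R).

Lemma is_derive_powR (p x : R) : 0 < x -> is_derive x 1 (fun t : R => t `^ p) (p * x `^ (p - 1)).
Proof.
move=> x0; have xi : x \in `]0, +oo[ by rewrite in_itv/= x0.
apply: DeriveDef; first exact: derivable_powR xi.
by rewrite -derive1E powR_derive1.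
Qed.

Lemma continuous_powR (p x : R) : 0 < x -> {for x, continuous (fun t : R => t `^ p)}.
Proof.
by move=> x0; apply/differentiable_continuous/derivable1_diffP; case: (is_derive_powR p x0).
Qed.

(** The integral is the length of the range of F; bounding that range avoids
computing the limits of F at the ends of the half-line. *)
Lemma integral_derive_le (F F' : R -> R) (p l1 l2 : R) :
  (forall x, p < x -> is_derive x 1 F (F' x)) ->
  (forall x, p < x -> 0 < F' x) ->
  (forall x, p < x -> {for x, continuous F'}) ->
  (forall x, p < x -> l1 < F x < l2) ->
  (\int[mu]_(x in `]p, +oo[) (F' x)%:E <= (l2 - l1)%:E)%E.
Proof.
move=> dF F'0 cF' FJ.
have l12 : l1 <= l2 by have := FJ (p + 1); lra.
pose J : set R := F @` `]p, +oo[.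
have iJ : is_interval J.
  apply/connected_intervalP; apply: connected_continuous_connected.
    by apply/connected_intervalP; exact: interval_is_interval.
  apply: continuous_in_subspaceT => x; rewrite inE/= in_itv/= andbT => px.
  by apply/differentiable_continuous/derivable1_diffP; case: (dF x px).
have H : (\int[mu]_(y in J) (cst 1 y)%:E = \int[mu]_(x in `]p, +oo[) (cst 1 (F x) * F' x)%:E)%E.
  apply: ge0_integral_subst => //.
  - by move=> x px; exists x => //=; rewrite in_itv/= px.
  - by move=> y [x/=]; rewrite in_itv/= andbT => px <-; exists x, x; split => //; rewrite lexx.
  - by move=> y _; exact: cst_continuous.
rewrite (_ : (\int[mu]_(x in _) _ = \int[mu]_(y in J) (cst 1 y)%:E)%E); last first.
  by rewrite H; apply: eq_integral => x _; rewrite /= mul1r.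
rewrite (eq_integral (cst 1%:E))// integral_cst ?mul1e; last exact: is_interval_measurable.
apply: (@le_trans _ _ (mu `]l1, l2[%classic)).
  apply: le_measure; rewrite ?inE//; first exact: is_interval_measurable.
  by move=> y [x/=]; rewrite in_itv/= andbT => px <-; rewrite in_itv/= FJ.
rewrite lebesgue_measure_itv/= lte_fin; case: ifPn => // _.
by rewrite lee_fin subr_ge0.
Qed.

Lemma powR_le (p x y : R) : 0 <= p -> 0 <= x -> x <= y -> x `^ p <= y `^ p.
Proof. by move=> p0 x0 xy; apply: ge0_ler_powR; rewrite ?nnegrE// (le_trans x0). Qed.

Lemma powRN_le (p x y : R) : 0 <= p -> 0 < x -> x <= y -> y `^ (- p) <= x `^ (- p).
Proof.
move=> p0 x0 xy; rewrite !powRN lef_pV2 ?posrE ?powR_gt0 ?(lt_le_trans x0)//.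
by apply: powR_le => //; exact: ltW.
Qed.

Lemma powRV (p x : R) : 0 < x -> (x^-1) `^ p = x `^ (- p).
Proof. by move=> x0; rewrite -powR_inv1 ?ltW// -powRrM mulN1r. Qed.

Lemma powR_div (p x y : R) : 0 <= x -> 0 < y -> (x / y) `^ p = x `^ p / y `^ p.
Proof. by move=> x0 y0; rewrite powRM// ?invr_ge0 ?(ltW y0)// powRV// powRN. Qed.

Lemma measurable_fun_EFin (D : set R) (f : R -> R) : measurable_fun D f -> measurable_fun D (fun x => (f x)%:E).
Proof. by move/measurable_EFinP. Qed.

Lemma le_integral_ge0 (D : set R) (f g : R -> R) : measurable D ->
  measurable_fun D f -> measurable_fun D g ->
  (forall x, D x -> 0 <= f x <= g x) ->
  (\int[mu]_(x in D) (f x)%:E <= \int[mu]_(x in D) (g x)%:E)%E.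
Proof.
move=> mD mf mg fg; apply: ge0_le_integral => //.
- by move=> x /fg /andP[f0 _]; rewrite lee_fin.
- exact: measurable_fun_EFin.
- exact: measurable_fun_EFin.
- by move=> x /fg /andP[f0 fg']; rewrite lee_fin.
Qed.

Lemma ge0_integralZ_fin (D : set R) (k : R) (f : R -> R) : measurable D ->
  measurable_fun D f -> 0 <= k -> (forall x, D x -> 0 <= f x) ->
  (\int[mu]_(x in D) (k * f x)%:E = k%:E * \int[mu]_(x in D) (f x)%:E)%E.
Proof.
move=> mD mf k0 f0; under eq_integral do rewrite EFinM.
by rewrite ge0_integralZl//; exact: measurable_fun_EFin.
Qed.

Lemma ge0_integralD_fin (D : set R) (f g : R -> R) : measurable D ->
  measurable_fun D f -> measurable_fun D g ->
  (forall x, D x -> 0 <= f x) -> (forall x, D x -> 0 <= g x) ->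
  (\int[mu]_(x in D) (f x + g x)%:E =
   \int[mu]_(x in D) (f x)%:E + \int[mu]_(x in D) (g x)%:E)%E.
Proof.
move=> mD mf mg f0 g0; under eq_integral do rewrite EFinD.
by rewrite ge0_integralD//; exact: measurable_fun_EFin.
Qed.

Lemma measurable_funSR (E D : set R) (f : R -> R) : measurable E -> D `<=` E ->
  measurable_fun E f -> measurable_fun D f.
Proof. by move=> mE DE; exact: measurable_funS. Qed.

Lemma ge0_subset_integral_fin (A B : set R) (f : R -> R) : measurable A -> measurable B ->
  A `<=` B -> measurable_fun B f -> (forall x, B x -> 0 <= f x) ->
  (\int[mu]_(x in A) (f x)%:E <= \int[mu]_(x in B) (f x)%:E)%E.
Proof.
move=> mA mB AB mf f0; apply: ge0_subset_integral => //; exact: measurable_fun_EFin.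
Qed.

(** Inversion is discontinuous at 0, but x^-1 = x |x|^(- 2) also there. *)
Lemma measurable_fun_inv d (T : measurableType d) (D : set T) (f : T -> R) : measurable_fun D f -> measurable_fun D (fun x => (f x)^-1).
Proof.
move=> mf; have -> : (fun x => (f x)^-1) = (fun x => f x * (`|f x| `^ (- 2))).
  apply/funext => x; rewrite powR_invn ?normr_ge0// real_normK ?num_real//.
  have [->|fx0] := eqVneq (f x) 0; first by rewrite expr0n/= !invr0 mulr0.
  by field.
apply: measurable_funM => //; apply: (measurableT_comp (measurable_powR _)).
exact: measurableT_comp.
Qed.

End analysis_tools.

(** * The Poisson kernel of an interval *)

Section poisson.
Variable R : realType.
Notation mu := (@lebesgue_measure R).
Variable be : R.
Hypotheses (be0 : 0 < be) (be1 : be < 1).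

(** The Euler integral B(1 - be, be). *)
Definition beta_integral : \bar R :=
  (\int[mu]_(t in `]0%R, +oo[) (t `^ (- be) / (1 + t))%:E)%E.

Lemma measurable_itvoy_continuous (p : R) (f : R -> R) : (forall x, p < x -> {for x, continuous f}) ->
  measurable_fun `]p, +oo[ f.
Proof.
move=> cf; apply: open_continuous_measurable_fun => // x.
by rewrite inE/= in_itv/= andbT; exact: cf.
Qed.

Lemma beta_integrand_continuous (x : R) : 0 < x -> {for x, continuous (fun t : R => t `^ (- be) / (1 + t))}.
Proof.
move=> x0; apply: cvgM; first exact: continuous_powR.
by apply: cvgV; [lra|apply: cvgD; [exact: cvg_cst|exact: cvg_id]].
Qed.

Lemma measurable_beta_integrand : measurable_fun `]0 : R, +oo[ (fun t : R => t `^ (- be) / (1 + t)).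
Proof. by apply: measurable_itvoy_continuous; exact: beta_integrand_continuous. Qed.

(** The integrand is dominated by a multiple of the derivative of the bounded
function 1 - (1 + t^(1 - be))^(- be / (1 - be)). *)
Lemma beta_integral_lty : (beta_integral < +oo)%E.
Proof.
pose g : R := 1 - be; have g0 : 0 < g by rewrite subr_gt0.
pose ka := be / g; have ka0 : 0 < ka by rewrite divr_gt0.
pose F t : R := 1 - (1 + t `^ g) `^ (- ka).
pose F' t : R := ka * (1 + t `^ g) `^ (- ka - 1) * (g * t `^ (g - 1)).
have p1 (x : R) : 0 < 1 + x `^ g by rewrite ltr_pwDl ?powR_ge0.
have dF (x : R) : 0 < x -> is_derive x 1 F (F' x).
  move=> x0.
  have d1 := is_derive_powR g x0.
  have d2 := is_derive_powR (- ka) (p1 x).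
  have d3 : is_derive x 1 (fun t : R => 1 + t `^ g) (g * x `^ (g - 1)).
    by move: (is_deriveD (is_derive_cst (1 : R) x 1) d1); rewrite add0r.
  have d4 := @is_derive1_comp R (fun t : R => t `^ (- ka)) (fun t : R => 1 + t `^ g) x _ _ d2 d3.
  have -> : F = cst 1 - ((fun t : R => t `^ (- ka)) \o (fun t : R => 1 + t `^ g)) by [].
  by apply: is_derive_eq; rewrite /F' sub0r mulNr mulNr opprK.
have F'0 (x : R) : 0 < x -> 0 < F' x.
  move=> x0; apply: mulr_gt0; apply: mulr_gt0 => //; apply: powR_gt0 => //; exact: p1.
have cF' (x : R) : 0 < x -> {for x, continuous F'}.
  move=> x0; apply: cvgM; last by apply: cvgMr; exact: continuous_powR.
  apply: cvgMr; apply: (@continuous_comp _ _ _ (fun t : R => 1 + t `^ g) (fun t : R => t `^ (- ka - 1))).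
    by apply: cvgD; [exact: cvg_cst|exact: continuous_powR].
  by apply: continuous_powR; exact: p1.
have FJ (x : R) : 0 < x -> 0 < F x < 1.
  move=> x0; rewrite /F subr_gt0 gtrBl powR_gt0 ?p1// andbT powRN invf_lt1 ?powR_gt0 ?p1//.
  have := @gt0_ltr_powR R ka ka0 1 (1 + x `^ g); rewrite powR1; apply; rewrite ?nnegrE ?ltW ?p1//.
  by rewrite ltrDl powR_gt0.
have I1 := integral_derive_le dF F'0 cF' FJ.
pose p := g^-1.
have p0 : 0 < p by rewrite invr_gt0.
have K (x : R) : 0 < x -> x `^ (- be) / (1 + x) <= 2 `^ p / be * F' x.
  move=> x0; set s : R := x `^ g; have s0 : 0 < s by rewrite powR_gt0.
  have gE : g - 1 = - be by rewrite /g; ring.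
  have kE : - ka - 1 = - p by rewrite /ka /p /g; field; rewrite -/g gt_eqF.
  have sp : s `^ p = x by rewrite /s -powRrM /p mulfV ?gt_eqF// powRr1 ?ltW.
  have -> : 2 `^ p / be * F' x = x `^ (- be) * (2 `^ p / (1 + s) `^ p).
    rewrite /F' gE kE -/s (powRN (1 + s) p) /ka; field.
    by rewrite (lt0r_neq0 g0) (lt0r_neq0 be0) lt0r_neq0 // powR_gt0 // addr_gt0.
  rewrite ler_wpM2l ?powR_ge0// -[leLHS]mul1r ler_pdivrMr ?addr_gt0//.
  rewrite mulrAC ler_pdivlMr ?powR_gt0 ?addr_gt0// mul1r.
  have [s1|s1] := leP s 1.
    apply: (@le_trans _ _ (2 `^ p)).
      by apply: powR_le; lra.
    by rewrite ler_peMr ?powR_ge0//; lra.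
  apply: (@le_trans _ _ ((2 * s) `^ p)).
    by apply: powR_le; lra.
  by rewrite powRM// ?(ltW s0)// sp ler_wpM2l ?powR_ge0//; lra.
apply: (@le_lt_trans _ _ (\int[mu]_(t in `]0%R, +oo[) (2 `^ p / be * F' t)%:E)%E).
  rewrite /beta_integral; apply: le_integral_ge0 => //.
  - exact: measurable_beta_integrand.
  - by apply: measurable_itvoy_continuous => x x0; apply: cvgMr; exact: cF'.
  - move=> x /=; rewrite in_itv/= andbT => x0; rewrite K// andbT.
    by rewrite divr_ge0 ?powR_ge0// addr_ge0// ltW.
rewrite ge0_integralZ_fin//.
- rewrite lte_mul_pinfty ?lee_fin ?divr_ge0 ?powR_ge0 ?(ltW be0)// (le_lt_trans I1)//.
  by rewrite subr0 ltry.
- exact: measurable_itvoy_continuous.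
- by rewrite divr_ge0 ?powR_ge0 ?(ltW be0).
- by move=> x /=; rewrite in_itv/= andbT => x0; rewrite ltW ?F'0.
Qed.

Lemma beta_integral_gt0 : (0 < beta_integral)%E.
Proof.
apply: (@lt_le_trans _ _ (\int[mu]_(t in `[1%R, 2%R]) (6^-1)%:E)%E).
  rewrite (eq_integral (cst (6^-1)%:E))// integral_cst//= lebesgue_measure_itv/= lte_fin.
  rewrite ifT; last by lra.
  by rewrite -EFinD -EFinM lte_fin; lra.
rewrite /beta_integral.
apply: (@le_trans _ _ (\int[mu]_(t in `[1%R, 2%R]) (t `^ (- be) / (1 + t))%:E)%E).
  apply: le_integral_ge0 => //.
    apply: (@measurable_funSR R `]0, +oo[%classic) => //.
      by move=> x /=; rewrite !in_itv/= andbT => /andP[]; lra.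
    exact: measurable_beta_integrand.
  move=> x /=; rewrite in_itv/= => /andP[x1 x2].
  have h1 : 2^-1 <= x `^ (- be).
    rewrite -(@powR_inv1 _ 2)//; apply: (@le_trans _ _ (2 `^ (- be))).
      by apply: ler_powR; [lra|have := be1; lra].
    by apply: powRN_le; have := be0; lra.
  have h2 : 3^-1 <= (1 + x)^-1 by rewrite lef_pV2 ?posrE; lra.
  rewrite invr_ge0 ler0n/=; apply: le_trans (ler_pM _ _ h1 h2); rewrite ?invr_ge0; lra.
apply: ge0_subset_integral_fin => //.
- by move=> x /=; rewrite !in_itv/= andbT => /andP[]; lra.
- exact: measurable_beta_integrand.
- by move=> x /=; rewrite in_itv/= andbT => x0; rewrite divr_ge0 ?powR_ge0//; lra.
Qed.

Definition poisson_cst : R := (fine beta_integral)^-1.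

Lemma poisson_cst_gt0 : 0 < poisson_cst.
Proof. by rewrite invr_gt0 fine_gt0// beta_integral_gt0 beta_integral_lty. Qed.

Lemma beta_integralE : beta_integral = (poisson_cst^-1)%:E.
Proof.
by rewrite /poisson_cst invrK fineK// ge0_fin_numE ?beta_integral_lty// ltW// beta_integral_gt0.
Qed.

(** Riesz's kernel for the fractional Laplacian of order 2 be on ]a, b[. *)
Definition pkernel (a b x y : R) : R :=
  poisson_cst * (((x - a) * (b - x)) / ((y - a) * (y - b))) `^ be / `|y - x|.

Definition ext (a b : R) : set R := ~` `[a, b].

Lemma extE a b : a <= b -> ext a b = `]-oo, a[ `|` `]b, +oo[.
Proof.
move=> ab; apply/seteqP; split => y; rewrite /ext/= !in_itv/= andbT.
  by move=> /negP; rewrite negb_and -!ltNge => /orP.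
by move=> /orP yab; apply/negP; rewrite negb_and -!ltNge.
Qed.

Lemma measurable_ext a b : measurable (ext a b).
Proof. exact: measurableC. Qed.

Lemma ext_gt0 a b y : a < b -> ext a b y -> 0 < (y - a) * (y - b).
Proof.
move=> ab; rewrite extE ?(ltW ab)//= !in_itv/= andbT => -[ya|yb].
  by rewrite -mulrNN mulr_gt0// oppr_gt0; lra.
by rewrite mulr_gt0//; lra.
Qed.

Lemma ext_neq a b x y : a < x < b -> ext a b y -> y - x != 0.
Proof. by move=> /andP[ax xb] yab; apply/eqP => yx; apply: yab; rewrite /= in_itv/=; lra. Qed.

Lemma pkernel_gt0 a b x y : a < x < b -> ext a b y -> 0 < pkernel a b x y.
Proof.
move=> axb yab; have ab : a < b by case/andP: axb; lra.
rewrite /pkernel divr_gt0 ?normr_gt0 ?(ext_neq axb)// mulr_gt0 ?poisson_cst_gt0//.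
rewrite powR_gt0// divr_gt0 ?ext_gt0// mulr_gt0//; case/andP: axb; lra.
Qed.

Lemma measurable_pkernel2 a b : measurable_fun setT (fun z : R * R => pkernel a b z.1 z.2).
Proof.
have m1 : measurable_fun setT (fun z : R * R => z.1) by exact: measurable_fst.
have m2 : measurable_fun setT (fun z : R * R => z.2) by exact: measurable_snd.
rewrite /pkernel; apply: measurable_funM.
  apply: measurable_funM; first exact: measurable_cst.
  apply: (measurableT_comp (measurable_powR be)).
  apply: measurable_funM.
    by apply: measurable_funM; apply: measurable_funB => //; exact: measurable_cst.
  apply: measurable_fun_inv.
  by apply: measurable_funM; apply: measurable_funB => //; exact: measurable_cst.
apply: measurable_fun_inv; apply: measurableT_comp => //; exact: measurable_funB.
Qed.

Lemma measurable_pkernel a b x : measurable_fun setT (pkernel a b x).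
Proof.
have := measurable_pkernel2 a b => h.
have -> : pkernel a b x = (fun z : R * R => pkernel a b z.1 z.2) \o (fun y => (x, y)) by [].
by apply: (measurableT_comp h); exact: measurable_pair1.
Qed.

(** The two components of the exterior are folded at the centre of the interval.
*)
Lemma ge0_integral_ext a b (f : R -> R) : a <= b -> measurable_fun (ext a b) f ->
  (forall y, ext a b y -> 0 <= f y) ->
  (\int[mu]_(y in ext a b) (f y)%:E =
   \int[mu]_(s in `]((b - a) / 2)%R, +oo[) (f ((a + b) / 2 + s) + f ((a + b) / 2 - s))%:E)%E.
Proof.
move=> ab mf f0.
have mf1 : measurable_fun `]b, +oo[ f.
  by apply: measurable_funSR mf; [exact: measurable_ext|rewrite extE//; exact: subsetUr].
have mf2 : measurable_fun `]-oo, a[ f.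
  by apply: measurable_funSR mf; [exact: measurable_ext|rewrite extE//; exact: subsetUl].
have f1 y : b < y -> 0 <= f y by move=> yb; apply: f0; rewrite extE//; right; rewrite /= in_itv/= yb.
have f2 y : y < a -> 0 <= f y by move=> yb; apply: f0; rewrite extE//; left; rewrite /= in_itv/= yb.
have disj : [disjoint `]-oo, a[ & `]b, +oo[].
  apply/disj_setPS => y/=; rewrite !in_itv/= andbT; lra.
rewrite extE// ge0_integral_setU//; last first.
  - by move=> y [] /=; rewrite in_itv/= ?andbT lee_fin => ?; [exact: f2|exact: f1].
  - by apply: measurable_fun_EFin; rewrite -extE.
have E1 : (\int[mu]_(y in `]b, +oo[) (f y)%:E = \int[mu]_(s in `]((b - a) / 2)%R, +oo[) (f ((a + b) / 2 + s))%:E)%E.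
  rewrite (@ge0_integral_affine R 1 ((a + b) / 2))//.
  - rewrite normr1 mul1e.
    have -> : (fun x => 1 * x + (a + b) / 2) @^-1` `]b, +oo[ = `](b - a) / 2, +oo[%classic.
      by apply/seteqP; split => y/=; rewrite !in_itv/= !andbT; lra.
    by apply: eq_integral => x _; rewrite mul1r addrC.
  - exact: measurable_fun_EFin.
  - by move=> y/=; rewrite in_itv/= andbT lee_fin; exact: f1.
have E2 : (\int[mu]_(y in `]-oo, a[) (f y)%:E = \int[mu]_(s in `]((b - a) / 2)%R, +oo[) (f ((a + b) / 2 - s))%:E)%E.
  rewrite (@ge0_integral_affine R (-1) ((a + b) / 2))//.
  - rewrite normrN normr1 mul1e.
    have -> : (fun x => -1 * x + (a + b) / 2) @^-1` `]-oo, a[ = `](b - a) / 2, +oo[%classic.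
      by apply/seteqP; split => y/=; rewrite !in_itv/= !andbT; lra.
    by apply: eq_integral => x _; rewrite mulN1r addrC.
  - exact: measurable_fun_EFin.
rewrite E1 E2 addeC -ge0_integralD_fin//.
- apply: (measurable_comp (F := `]b, +oo[)) mf1 _ => //.
    by move=> _ /= [x /= + <-]; rewrite !in_itv/= !andbT; lra.
  apply: measurable_funD => //; exact: measurable_cst.
- apply: (measurable_comp (F := `]-oo, a[)) mf2 _ => //.
    by move=> _ /= [x /= + <-]; rewrite !in_itv/= !andbT; lra.
  apply: measurable_funB => //; exact: measurable_cst.
- by move=> x /=; rewrite in_itv/= andbT => ?; apply: f1; lra.
- by move=> x /=; rewrite in_itv/= andbT => ?; apply: f2; lra.
Qed.

(** With l = (b - a) / 2 and y at distance s > l from the centre of the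
interval, the two branches of the folded kernel add up, and t = (s^2 - l^2) /
((x - a)(b - x)) turns the sum into the Euler integral, whatever x is. *)
Lemma pkernel_mass a b x : a < x < b -> (\int[mu]_(y in ext a b) (pkernel a b x y)%:E = 1)%E.
Proof.
move=> axb; case/andP: (axb) => ax xb.
have ab : a < b by lra.
rewrite ge0_integral_ext; last 3 first.
- exact: ltW.
- exact: measurable_funTS (measurable_pkernel _ _ _).
- by move=> y yab; rewrite ltW// pkernel_gt0.
set l := (b - a) / 2; set m := (a + b) / 2.
pose A := x - a; pose B := b - x.
have AB0 : 0 < A * B by rewrite mulr_gt0 /A /B ?subr_gt0.
pose h (s : R) : R := (s ^+ 2 - l ^+ 2) / (A * B).
pose h' (s : R) : R := 2 * s / (A * B).
pose G (t : R) : R := poisson_cst * (t `^ (- be) / (1 + t)).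
have sl s : l < s -> 0 < s ^+ 2 - l ^+ 2.
  by move=> ls; rewrite subr_gt0 ltrXn2r// ?nnegrE /l; move: ls; rewrite /l; lra.
transitivity (\int[mu]_(s in `]l, +oo[) (G (h s) * h' s)%:E)%E.
  apply: eq_integral => s; rewrite inE/= in_itv/= andbT => ls.
  congr EFin; rewrite /pkernel -/A -/B.
  have hs : 0 < h s by rewrite /h divr_gt0// sl.
  have l0 : 0 < l by rewrite /l; lra.
  have d1 : m + s - x > 0 by rewrite /m; move: ls; rewrite /l; lra.
  have d2 : m - s - x < 0 by rewrite /m; move: ls; rewrite /l; lra.
  have -> : A * B / ((m + s - a) * (m + s - b)) = (h s)^-1.
    by rewrite /h invf_div; congr (_ / _); rewrite /m /l; field.
  have -> : A * B / ((m - s - a) * (m - s - b)) = (h s)^-1.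
    by rewrite /h invf_div; congr (_ / _); rewrite /m /l; field.
  rewrite gtr0_norm// ltr0_norm// powRV// /G /h' -!mulrA -!mulrDr.
  do 2 congr (_ * _).
  have e1 : (1 + h s) * (A * B) = (m + s - x) * - (m - s - x).
    by rewrite /h mulrDl mul1r divfK ?gt_eqF// /A /B /m /l; field.
  have -> : (1 + h s)^-1 = (A * B) / ((m + s - x) * - (m - s - x)).
    by rewrite -e1 invfM mulrCA divff ?mulr1// gt_eqF.
  move: d1 d2 e1; rewrite -oppr_gt0; set p := m + s - x; set q := - (m - s - x) => p0 q0 e1.
  have sE : s = (p + q) / 2 by rewrite /p /q; field.
  clearbody p q; move: AB0; set AB := A * B; clearbody AB => AB0.
  by rewrite [X in X / AB]sE; field; rewrite !lt0r_neq0.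
transitivity (\int[mu]_(t in `]0%R, +oo[) (G t)%:E)%E; last first.
  rewrite /G ge0_integralZ_fin//.
  + by rewrite -/beta_integral beta_integralE -EFinM divff// lt0r_neq0// poisson_cst_gt0.
  + exact: measurable_beta_integrand.
  + by rewrite ltW// poisson_cst_gt0.
  + by move=> t /=; rewrite in_itv/= andbT => t0; rewrite divr_ge0 ?powR_ge0//; lra.
have l0 : 0 < l by rewrite /l; lra.
apply/esym; apply: ge0_integral_subst.
- exact: interval_is_interval.
- move=> s ls.
  have d := is_deriveM (is_deriveB (is_deriveM (is_derive_id s (1 : R)) (is_derive_id s (1 : R))) (is_derive_cst (l ^+ 2) s (1 : R))) (is_derive_cst (A * B)^-1 s (1 : R)).
  apply: (is_derive_eq d); rewrite /h' /= /GRing.scale/=; ring.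
- by move=> s ls; rewrite /h' divr_gt0//; lra.
- by move=> s ls; apply: cvgMl; apply: cvgMr; exact: cvg_id.
- by move=> s ls; rewrite /= in_itv/= andbT /h divr_gt0// sl.
- move=> t; rewrite /= in_itv/= andbT => t0.
  have p : 0 < t * (A * B) by rewrite mulr_gt0.
  pose s : R := Num.sqrt (t * (A * B) + l ^+ 2).
  have s2 : s ^+ 2 = t * (A * B) + l ^+ 2 by rewrite sqr_sqrtr// addr_ge0 ?sqr_ge0// ltW.
  have s0 : 0 <= s by exact: sqrtr_ge0.
  have ls : l < s by rewrite ltNge; apply/negP => sl'; nra.
  have -> : t = h s by rewrite /h s2 addrK mulfK// lt0r_neq0.
  by exists s, s; split => //; rewrite lexx.
- by move=> t; rewrite /= in_itv/= andbT => t0; apply: cvgMr; exact: beta_integrand_continuous.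
- move=> t; rewrite /= in_itv/= andbT => t0.
  by rewrite /G mulr_ge0 ?(ltW poisson_cst_gt0)// divr_ge0 ?powR_ge0//; lra.
Qed.

End poisson.

(** * The balance identity of the kernel *)

Section kernel_identity.
Variable R : realType.
Notation mu := (@lebesgue_measure R).
Variable be : R.
Hypotheses (be0 : 0 < be) (be1 : be < 1).
Notation pk := (pkernel be).
Notation c := (poisson_cst be).

(** The density of the fractional Laplacian of order 2 be. *)
Definition jump (z : R) : R := (`|z| `^ (1 + 2 * be))^-1.

Lemma jumpE z : z != 0 -> jump z = (z ^+ 2) `^ (- be) / `|z|.
Proof.
move=> z0; have nz : 0 < `|z| by rewrite normr_gt0.
rewrite /jump powRD; last by rewrite (lt0r_neq0 nz) implybT.
rewrite powRr1 ?ltW// invfM mulrC; congr (_ / _).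
by rewrite -real_normK ?num_real// -powRN -powR_mulrn ?ltW// -powRrM; congr (_ `^ _); ring.
Qed.

Lemma jump_gt0 z : z != 0 -> 0 < jump z.
Proof. by move=> z0; rewrite invr_gt0 powR_gt0 ?normr_gt0. Qed.

Lemma jumpN z : jump (- z) = jump z.
Proof. by rewrite /jump normrN. Qed.

Lemma jump_ge0 z : 0 <= jump z.
Proof. by rewrite invr_ge0 powR_ge0. Qed.

Lemma continuous_jump (z : R) : z != 0 -> {for z, continuous jump}.
Proof.
move=> z0; apply: cvgV; first by apply/lt0r_neq0/powR_gt0; rewrite normr_gt0.
apply: (@continuous_comp _ _ _ (fun z : R => `|z|) (fun t : R => t `^ (1 + 2 * be))).
  exact: norm_continuous.
by apply: continuous_powR; rewrite normr_gt0.
Qed.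

Lemma continuous_pkernel (a b w y : R) : a < w < b -> ext a b y ->
  {for w, continuous (fun w : R => pk a b w y)}.
Proof.
move=> awb yab; have ab : a < b by case/andP: awb; lra.
have D0 := ext_gt0 ab yab.
have T0 : 0 < (w - a) * (b - w) / ((y - a) * (y - b)).
  by apply: divr_gt0 => //; apply: mulr_gt0; case/andP: awb; lra.
apply: cvgM; last first.
  apply: cvgV; first by rewrite normr_eq0 (ext_neq awb).
  by apply: cvg_norm; apply: cvgB; [exact: cvg_cst|exact: cvg_id].
apply: cvgMr; apply: (@continuous_comp _ _ _ (fun w : R => (w - a) * (b - w) / ((y - a) * (y - b))) (fun t : R => t `^ be)); last exact: continuous_powR.
apply: cvgMl; apply: cvgM; apply: cvgB; by [exact: cvg_cst|exact: cvg_id].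
Qed.

Lemma measurable_jump : measurable_fun setT jump.
Proof.
by apply: measurable_fun_inv; apply: (measurableT_comp (measurable_powR _)).
Qed.

Lemma pkernelN a b x y : pk (- b) (- a) (- x) (- y) = pk a b x y.
Proof.
have E : - y - - x = - (y - x) by ring.
rewrite /pkernel E normrN; congr (_ * _ `^ _ / _).
by congr (_ / _); ring.
Qed.

(** As a function of s^2, the Moebius map of the half-line s > 0 onto ]a, b[
that takes the value x at s = 1. In this variable both factors of pk a b w y *
jump (w - x) become explicit. *)
Definition mob (a b x s : R) : R :=
  b - (b - a) * (b - x) / ((b - x) + (x - a) * s ^+ 2).

Lemma mob_den_gt0 (a b x s : R) : a < x < b -> 0 < (b - x) + (x - a) * s ^+ 2.
Proof. by case/andP => ax xb; have := sqr_ge0 s; nra. Qed.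

Lemma mob_subr (a b x s : R) : a < x < b ->
  b - mob a b x s = (b - a) * (b - x) / ((b - x) + (x - a) * s ^+ 2).
Proof. by rewrite /mob opprB addrC subrK. Qed.

Lemma mob_subl (a b x s : R) : a < x < b ->
  mob a b x s - a = (b - a) * (x - a) * s ^+ 2 / ((b - x) + (x - a) * s ^+ 2).
Proof.
by move=> axb; have := lt0r_neq0 (mob_den_gt0 s axb) => d0; rewrite /mob; field.
Qed.

Lemma mob_subx (a b x s : R) : a < x < b ->
  mob a b x s - x = (x - a) * (b - x) * (s ^+ 2 - 1) / ((b - x) + (x - a) * s ^+ 2).
Proof.
by move=> axb; have := lt0r_neq0 (mob_den_gt0 s axb) => d0; rewrite /mob; field.
Qed.

Lemma mob_dist (a b x y s : R) : a < x < b -> ext a b y ->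
  `|y - mob a b x s| = ((x - a) * `|y - b| * s ^+ 2 + (b - x) * `|y - a|) /
    ((b - x) + (x - a) * s ^+ 2).
Proof.
move=> axb; have Es := mob_den_gt0 s axb; have d0 := lt0r_neq0 Es.
have mb := mob_subr s axb; have ma := mob_subl s axb; case/andP: (axb) => ax xb.
have w1 : 0 <= b - mob a b x s.
  by rewrite mb divr_ge0 ?mulr_ge0 ?(ltW Es)//; lra.
have w2 : 0 <= mob a b x s - a.
  by rewrite ma; apply: divr_ge0 (ltW Es); apply: mulr_ge0 (sqr_ge0 _); nra.
rewrite extE; last by lra.
rewrite /= !in_itv/= andbT => -[ya|yb].
  rewrite !ltr0_norm; [|lra..].
  have -> : - (y - mob a b x s) = (mob a b x s - a) + (a - y) by ring.
  by rewrite ma; field.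
rewrite !gtr0_norm; [|lra..].
have -> : y - mob a b x s = (b - mob a b x s) + (y - b) by ring.
by rewrite mb; field.
Qed.

Definition dmob (a b x s : R) : R :=
  2 * (b - a) * (x - a) * (b - x) * s / ((b - x) + (x - a) * s ^+ 2) ^+ 2.

Lemma is_derive_mob (a b x s : R) : a < x < b -> is_derive s 1 (mob a b x) (dmob a b x s).
Proof.
move=> axb; have n0 := lt0r_neq0 (mob_den_gt0 s axb).
rewrite /mob /dmob; move: n0; set A := x - a; set B := b - x => n0.
have d1 := is_deriveD (is_derive_cst B s (1 : R)) (is_deriveM (is_derive_cst A s (1 : R))
    (is_deriveM (is_derive_id s (1 : R)) (is_derive_id s (1 : R)))).
have d2 := is_deriveV (n0 : ((cst B : R -> R) + (cst A : R -> R) * (id * id)) s != 0) d1.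
have d3 := is_deriveB (is_derive_cst b s (1 : R)) (is_deriveM (is_derive_cst ((b - a) * B) s (1 : R)) d2).
apply: (is_derive_eq d3); rewrite /= /GRing.scale/= /GRing.scale/=.
have -> : (cst B + cst A * (id * id)) s = B + A * s ^+ 2 by [].
by clearbody A B; field.
Qed.

Lemma mob_image (a b x s0 : R) : a < x < b -> 0 <= s0 ->
  [set w | exists2 s, s0 < s & w = mob a b x s] = `]mob a b x s0, b[%classic.
Proof.
move=> axb s00; case/andP: (axb) => ax xb.
have A0 : 0 < x - a by rewrite subr_gt0.
have B0 : 0 < b - x by rewrite subr_gt0.
apply/seteqP; split => w /=; rewrite in_itv/=.
  move=> [s s0s ->].
  have E0 := mob_den_gt0 s0 axb; have Es := mob_den_gt0 s axb.
  apply/andP; split; last by rewrite -subr_gt0 mob_subr// divr_gt0// mulr_gt0//; lra.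
  rewrite -[ltLHS]opprK -[ltRHS]opprK ltrN2 -(ltrD2l b) !mob_subr//.
  have P : 0 < (b - a) * (b - x) by rewrite mulr_gt0//; lra.
  have ss : s0 ^+ 2 < s ^+ 2 by nra.
  by rewrite (ltr_pM2l P) ltf_pV2 ?posrE// ltrD2l (ltr_pM2l A0).
move=> /andP[s0w wb].
pose q := ((b - a) * (b - x) / (b - w) - (b - x)) / (x - a).
have E0 := mob_den_gt0 s0 axb.
have q0 : s0 ^+ 2 < q.
  rewrite /q ltr_pdivlMr// ltrBrDl ltr_pdivlMr ?subr_gt0// mulrC -ltr_pdivlMr// mulrC.
    have := mob_subr s0 axb; rewrite (mulrC (s0 ^+ 2)) mulrC => <-; lra.
  exact: E0.
exists (Num.sqrt q).
  by rewrite -(ger0_norm s00) -sqrtr_sqr ltr_sqrt// (le_lt_trans (sqr_ge0 _) q0).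
rewrite /mob sqr_sqrtr; last by rewrite ltW// (le_lt_trans (sqr_ge0 _) q0).
have -> : (b - x) + (x - a) * q = (b - a) * (b - x) / (b - w).
  by rewrite /q; field; rewrite !lt0r_neq0// subr_gt0.
by field; rewrite !lt0r_neq0//; lra.
Qed.

(** The substitution w = mob a b x s. *)
Lemma right_pkernel_jump (a b x y s0 : R) : a < x < b -> ext a b y -> 1 <= s0 ->
  (\int[mu]_(w in `](mob a b x s0), b[) (pk a b w y * jump (w - x))%:E =
   \int[mu]_(s in `]s0, +oo[)
     (c * ((b - a) ^+ 2 / ((x - a) * (b - x) * ((y - a) * (y - b)))) `^ be
      * ((s - s^-1) ^+ 2) `^ (- be) * 2 * (b - a) /
      (((x - a) * `|y - b| * s ^+ 2 + (b - x) * `|y - a|) * (s - s^-1)))%:E)%E.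
Proof.
move=> axb yab s01; case/andP: (axb) => ax xb.
have ab : a < b by lra.
pose A := x - a; pose B := b - x; have A0 : 0 < A by rewrite /A subr_gt0.
have B0 : 0 < B by rewrite /B subr_gt0.
have D0 := ext_gt0 ab yab.
transitivity (\int[mu]_(s in `]s0, +oo[) (pk a b (mob a b x s) y * jump (mob a b x s - x) * dmob a b x s)%:E)%E; last first.
  apply: eq_integral => s; rewrite inE/= in_itv/= andbT => ss0; congr EFin.
  have s1 : 1 < s by lra.
  have sg0 : 0 < s by lra.
  have ss1 : 0 < s ^+ 2 - 1 by rewrite subr_gt0 exprn_egt1.
  have Es := mob_den_gt0 s axb; have En := lt0r_neq0 Es.
  have Wx := mob_subx s axb.
  have Wx0 : 0 < mob a b x s - x by rewrite Wx divr_gt0// !mulr_gt0// subr_gt0.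
  rewrite jumpE ?lt0r_neq0// (gtr0_norm Wx0) /pkernel (mob_dist s axb yab).
  rewrite (mob_subl s axb) (mob_subr s axb) Wx /dmob -/A -/B.
  move: Es En; rewrite -/A -/B; set E := B + A * s ^+ 2 => Es En.
  have vE : s - s^-1 = (s ^+ 2 - 1) / s by field; rewrite lt0r_neq0.
  have v0 : 0 < s - s^-1 by rewrite vE divr_gt0.
  move: D0; set D := (y - a) * (y - b) => D0.
  pose g := (A * B * s / E) ^+ 2.
  have g0 : 0 < g by rewrite exprn_gt0// divr_gt0// !mulr_gt0.
  pose Q := (b - a) ^+ 2 / (A * B * D).
  have Q0 : 0 < Q.
    by apply: divr_gt0; [apply: exprn_gt0; lra|apply: mulr_gt0 => //; exact: mulr_gt0].
  have An := lt0r_neq0 A0; have Bn := lt0r_neq0 B0; have Dn := lt0r_neq0 D0.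
  have sn := lt0r_neq0 sg0.
  have -> : (b - a) * A * s ^+ 2 / E * ((b - a) * B / E) / D = Q * g.
    by rewrite /Q /g; clearbody A B D E; field; rewrite En An Bn Dn.
  have -> : (A * B * (s ^+ 2 - 1) / E) ^+ 2 = (s - s^-1) ^+ 2 * g.
    by rewrite vE /g; clearbody A B D E; field; rewrite En sn.
  rewrite (powRM _ (ltW Q0) (ltW g0)) (powRM _ (sqr_ge0 _) (ltW g0)) (powRN g).
  rewrite -/Q.
  have gbn : g `^ be != 0 by rewrite lt0r_neq0// powR_gt0.
  set N := A * `|y - b| * s ^+ 2 + B * `|y - a|.
  have Nn : N != 0.
    apply/lt0r_neq0/ltr_pwDl; last by apply: mulr_ge0; [exact: ltW|exact: normr_ge0].
    apply: mulr_gt0; last exact: exprn_gt0.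
    apply: mulr_gt0 => //; rewrite normr_gt0; apply/eqP => yb0.
    by move: D0; rewrite /D yb0 mulr0 ltxx.
  have vn := lt0r_neq0 v0.
  rewrite vE in vn *.
  have s1n := lt0r_neq0 ss1.
  move: (Q `^ be) ((((s ^+ 2 - 1) / s) ^+ 2) `^ (- be)) (g `^ be) gbn => Qb Vb gb gbn.
  by clearbody A B D E N; field; rewrite gbn En An Bn Nn sn s1n.
apply: ge0_integral_subst.
- exact: interval_is_interval.
- by move=> s ss0; exact: is_derive_mob.
- move=> s ss0; apply: divr_gt0; last by apply: exprn_gt0; exact: mob_den_gt0.
  by rewrite -/A -/B; apply: mulr_gt0; [apply: mulr_gt0 => //; apply: mulr_gt0 => //; lra|lra].
- move=> s ss0; apply: cvgM.
    by apply: cvgMr; exact: cvg_id.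
  apply: cvgV; first by rewrite expf_neq0// lt0r_neq0// mob_den_gt0.
  have cE : {for s, continuous (fun s : R => b - x + (x - a) * s ^+ 2)}.
    by apply: cvgD; [exact: cvg_cst|apply: cvgMr; exact: exprn_continuous].
  exact: (cvgM cE cE).
- move=> s ss0; have := mob_image axb (le_trans ler01 s01).
  by move/seteqP => [+ _]; apply; exists s.
- move=> w; have := mob_image axb (le_trans ler01 s01).
  move/seteqP => [_ h] /h [s s0s ->]; by exists s, s; split => //; rewrite lexx.
- move=> w; rewrite /= in_itv/= => /andP[sw wb].
  have Wx0 : 0 <= mob a b x s0 - x.
    rewrite mob_subx//; apply: divr_ge0; last by rewrite ltW// mob_den_gt0.
    by apply: mulr_ge0; [rewrite -/A -/B mulr_ge0 ?ltW|rewrite subr_ge0 exprn_ege1].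
  have wx : x < w by lra.
  have aw : a < w by lra.
  apply: cvgM; first by apply: continuous_pkernel; rewrite ?aw.
  apply: (@continuous_comp _ _ _ (fun w : R => w - x) jump).
    by apply: cvgB; [exact: cvg_id|exact: cvg_cst].
  by apply: continuous_jump; lra.
- move=> w; rewrite /= in_itv/= => /andP[sw wb].
  by rewrite mulr_ge0 ?jump_ge0// mulr_ge0 ?invr_ge0// mulr_ge0 ?powR_ge0// ltW// poisson_cst_gt0.
Qed.

(** This is mob a b x (s^-1), in a form that inherits the properties of mob by
reflection. *)
Definition lmob (a b x s : R) : R := - mob (- b) (- a) (- x) s.

Lemma left_pkernel_jump (a b x y s0 : R) : a < x < b -> ext a b y -> 1 <= s0 ->
  (\int[mu]_(w in `]a, (lmob a b x s0)[) (pk a b w y * jump (w - x))%:E =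
   \int[mu]_(s in `]s0, +oo[)
     (c * ((b - a) ^+ 2 / ((x - a) * (b - x) * ((y - a) * (y - b)))) `^ be
      * ((s - s^-1) ^+ 2) `^ (- be) * 2 * (b - a) /
      (((b - x) * `|y - a| * s ^+ 2 + (x - a) * `|y - b|) * (s - s^-1)))%:E)%E.
Proof.
move=> axb yab s01.
have axb' : - b < - x < - a by rewrite !ltrN2 andbC.
have yab' : ext (- b) (- a) (- y).
  by move=> h; apply: yab; move: h; rewrite /= !in_itv/= !lerN2 andbC.
have := right_pkernel_jump axb' yab' s01.
rewrite (@integral_affine R (-1) 0); last 3 first.
- by rewrite oppr_eq0 oner_eq0.
- by [].
- apply: measurable_funTS; apply: measurable_funM.
    have := measurable_pkernel2 be (- b) (- a) => h.
    by apply: (measurableT_comp h (measurable_pair2 (- y))).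
  by apply: (measurableT_comp measurable_jump); apply: measurable_funB.
rewrite normrN1 mul1e.
have -> : (fun w : R => -1 * w + 0) @^-1` `](mob (- b) (- a) (- x) s0), (- a)[ = `]a, (lmob a b x s0)[%classic.
  apply/seteqP; split => w; rewrite /= !in_itv/= addr0 mulN1r /lmob; lra.
have -> : (\int[mu]_(w in `]a, (lmob a b x s0)[) (pk (- b) (- a) (-1 * w + 0)%R (- y) * jump (-1 * w + 0 - - x))%:E
  = \int[mu]_(w in `]a, (lmob a b x s0)[) (pk a b w y * jump (w - x))%:E)%E.
  apply: eq_integral => w _; rewrite addr0 mulN1r pkernelN -[in RHS]jumpN.
  by congr (_ * jump _)%:E; ring.
move=> ->; apply: eq_integral => s _.
have -> : - a - - b = b - a by ring.
have -> : - x - - b = b - x by ring.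
have -> : - a - - x = x - a by ring.
have E1 : - y - - b = - (y - b) by ring.
have E2 : - y - - a = - (y - a) by ring.
rewrite E1 E2 !normrN mulrNN (mulrC (b - x) (x - a)) (mulrC (y - b)).
by [].
Qed.

(** Factors of the substituted integrand: zfac depends on the pole x alone, kfun
on s alone, and the dependence on y is in mfac, which enters through 1 + mfac (s
- 1/s)^2. *)
Definition zfac (a b x : R) : R := ((b - a) ^+ 2 / ((x - a) * (b - x)) ^+ 2) `^ be.
Definition mfac (a b x y : R) : R :=
  (x - a) * (b - x) * ((y - a) * (y - b)) / ((b - a) ^+ 2 * (y - x) ^+ 2).
Definition kfun (s : R) : R :=
  ((s - s^-1) ^+ 2) `^ (- be) / (s - s^-1) * (1 + s ^- 2).

(** Only the sum of the two branches factors; their denominators combine by (b -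
a) |y - x| = (x - a) |y - b| + (b - x) |y - a|. *)
Lemma pkernel_jump_sum (a b x y s : R) : a < x < b -> ext a b y -> 1 < s ->
  c * ((b - a) ^+ 2 / ((x - a) * (b - x) * ((y - a) * (y - b)))) `^ be
      * ((s - s^-1) ^+ 2) `^ (- be) * 2 * (b - a) /
      (((x - a) * `|y - b| * s ^+ 2 + (b - x) * `|y - a|) * (s - s^-1)) +
  c * ((b - a) ^+ 2 / ((x - a) * (b - x) * ((y - a) * (y - b)))) `^ be
      * ((s - s^-1) ^+ 2) `^ (- be) * 2 * (b - a) /
      (((b - x) * `|y - a| * s ^+ 2 + (x - a) * `|y - b|) * (s - s^-1)) =
  2 * zfac a b x * pk a b x y * (kfun s / (1 + mfac a b x y * (s - s^-1) ^+ 2)).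
Proof.
move=> axb yab s1; case/andP: (axb) => ax xb; have ab : a < b by lra.
have D0 := ext_gt0 ab yab; have yx := ext_neq axb yab.
rewrite /zfac /mfac /kfun /pkernel.
have ny : (b - a) * `|y - x| = (x - a) * `|y - b| + (b - x) * `|y - a|.
  move: yab; rewrite extE ?(ltW ab)//= !in_itv/= andbT => -[ya|yb].
    by rewrite !ltr0_norm; [ring|lra..].
  by rewrite !gtr0_norm; [ring|lra..].
have Dn : (y - a) * (y - b) = `|y - b| * `|y - a|.
  by rewrite -normrM mulrC gtr0_norm// mulrC.
have nx2 : (y - x) ^+ 2 = `|y - x| ^+ 2 by rewrite real_normK ?num_real.
have yx0 : 0 < `|y - x| by rewrite normr_gt0.
have ya0 : 0 < `|y - a|.
  by rewrite normr_gt0; apply/eqP => h; move: D0; rewrite h mul0r ltxx.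
have yb0 : 0 < `|y - b|.
  by rewrite normr_gt0; apply/eqP => h; move: D0; rewrite h mulr0 ltxx.
rewrite nx2 Dn.
have A0 : 0 < x - a by lra.
have B0 : 0 < b - x by lra.
have C0 : 0 < b - a by lra.
have s0 : 0 < s by lra.
have ss1 : 0 < s ^+ 2 - 1 by rewrite subr_gt0 exprn_egt1.
have vE : s - s^-1 = (s ^+ 2 - 1) / s by field; rewrite lt0r_neq0.
have Qpos : 0 < (b - a) ^+ 2 / ((x - a) * (b - x)) ^+ 2.
  by apply: divr_gt0; apply: exprn_gt0 => //; exact: mulr_gt0.
have Tpos : 0 < (x - a) * (b - x) / (`|y - b| * `|y - a|).
  by apply: divr_gt0; exact: mulr_gt0.
move: ny Qpos Tpos A0 B0 C0 yx0 ya0 yb0.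
move: (x - a) (b - x) (b - a) `|y - x| `|y - a| `|y - b| => A B C nx na nb.
move=> ny Qpos Tpos A0 B0 C0 nx0 na0 nb0.
have -> : C ^+ 2 / (A * B * (nb * na)) = (C ^+ 2 / (A * B) ^+ 2) * (A * B / (nb * na)).
  by field; rewrite !lt0r_neq0.
rewrite (powRM _ (ltW Qpos) (ltW Tpos)).
have -> : nx = (A * nb + B * na) / C by rewrite -ny; field; rewrite lt0r_neq0.
move: ((C ^+ 2 / (A * B) ^+ 2) `^ be) ((A * B / (nb * na)) `^ be) (((s - s^-1) ^+ 2) `^ (- be)) => Z T V.
rewrite vE.
have AnB : 0 < A * nb + B * na by apply: addr_gt0; exact: mulr_gt0.
have e1 : 0 < A * nb * s ^+ 2 + B * na by apply: addr_gt0; do ?apply: mulr_gt0; rewrite ?exprn_gt0.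
have e2 : 0 < B * na * s ^+ 2 + A * nb by apply: addr_gt0; do ?apply: mulr_gt0; rewrite ?exprn_gt0.
clear -AnB e1 e2 s0 ss1 A0 B0 C0 na0 nb0.
field.
rewrite (lt0r_neq0 s0) (lt0r_neq0 C0) (lt0r_neq0 AnB) (lt0r_neq0 ss1) (lt0r_neq0 e1) (lt0r_neq0 e2) /= andbT.
apply/lt0r_neq0/ltr_pwDl; first by apply: exprn_gt0; exact: mulr_gt0.
by apply: mulr_ge0; [apply/ltW; apply: mulr_gt0; exact: mulr_gt0|exact: sqr_ge0].
Qed.

Lemma measurable_pkernel_jump (D : set R) (a b x y : R) :
  measurable_fun D (fun w => pk a b w y * jump (w - x)).
Proof.
apply: measurable_funTS; apply: measurable_funM.
  by apply: (measurableT_comp (measurable_pkernel2 be a b) (measurable_pair2 y)).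
by apply: (measurableT_comp measurable_jump); apply: measurable_funB.
Qed.

Lemma kfun_gt0 (s : R) : 1 < s -> 0 < kfun s.
Proof.
move=> s1; have s0 : 0 < s by lra.
have vE : 0 < s - s^-1.
  by rewrite subr_gt0 (lt_trans _ s1)// invf_lt1.
rewrite /kfun mulr_gt0// ?divr_gt0 ?powR_gt0 ?exprn_gt0// addr_gt0// invr_gt0 exprn_gt0//.
Qed.

Lemma measurable_kfun : measurable_fun setT kfun.
Proof.
have mi : measurable_fun setT (fun s : R => s^-1) by exact: measurable_fun_inv.
have mv : measurable_fun setT (fun s : R => s - s^-1) by exact: measurable_funB.
apply: measurable_funM; last first.
  by apply: measurable_funD => //; apply: measurable_fun_inv; exact: measurable_funX.
apply: measurable_funM; last exact: measurable_fun_inv.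
by apply: (measurableT_comp (measurable_powR _)); exact: measurable_funX.
Qed.

Lemma mfac_gt0 (a b x y : R) : a < x < b -> ext a b y -> 0 < mfac a b x y.
Proof.
move=> axb yab; have yx := ext_neq axb yab; case/andP: (axb) => ax xb.
have ab : a < b by lra.
have D0 := ext_gt0 ab yab.
apply: divr_gt0; first by apply: mulr_gt0 => //; apply: mulr_gt0; lra.
apply: mulr_gt0; first by apply: exprn_gt0; lra.
by rewrite -real_normK ?num_real// exprn_gt0// normr_gt0.
Qed.

Lemma excised_pkernel_jump (a b x y s0 : R) : a < x < b -> ext a b y -> 1 <= s0 ->
  (\int[mu]_(w in `]a, (lmob a b x s0)[) (pk a b w y * jump (w - x))%:E +
   \int[mu]_(w in `](mob a b x s0), b[) (pk a b w y * jump (w - x))%:E =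
   \int[mu]_(s in `]s0, +oo[)
     (2 * zfac a b x * pk a b x y * (kfun s / (1 + mfac a b x y * (s - s^-1) ^+ 2)))%:E)%E.
Proof.
move=> axb yab s01; case/andP: (axb) => ax xb; have ab : a < b by lra.
rewrite left_pkernel_jump// right_pkernel_jump// addeC.
have D0 := ext_gt0 ab yab.
have v0 (s : R) : s0 < s -> 0 < s - s^-1.
  by move=> ss0; rewrite subr_gt0 (@lt_trans _ _ 1)// ?invf_lt1//; lra.
have mi : measurable_fun setT (fun s : R => s^-1) by exact: measurable_fun_inv.
have mv : measurable_fun setT (fun s : R => s - s^-1) by exact: measurable_funB.
have mm (p q : R) : measurable_fun (`]s0, +oo[%classic : set R) (fun s : R =>
     c * ((b - a) ^+ 2 / ((x - a) * (b - x) * ((y - a) * (y - b)))) `^ be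
      * ((s - s^-1) ^+ 2) `^ (- be) * 2 * (b - a) /
      ((p * s ^+ 2 + q) * (s - s^-1))).
  apply: measurable_funTS; apply: measurable_funM; last first.
    apply: measurable_fun_inv; apply: measurable_funM => //.
    by apply: measurable_funD => //; apply: measurable_funM => //; exact: measurable_funX.
  do 2 (apply: measurable_funM => //).
  by apply: measurable_funM => //; apply: (measurableT_comp (measurable_powR _)); exact: measurable_funX.
have pos (p q s : R) : 0 <= p -> 0 <= q -> s0 < s ->
  0 <= c * ((b - a) ^+ 2 / ((x - a) * (b - x) * ((y - a) * (y - b)))) `^ be
      * ((s - s^-1) ^+ 2) `^ (- be) * 2 * (b - a) /
      ((p * s ^+ 2 + q) * (s - s^-1)).
  move=> p0 q0 ss0; apply: divr_ge0; last first.
    by apply: mulr_ge0; [apply: addr_ge0 => //; apply: mulr_ge0 => //; exact: sqr_ge0|exact/ltW/v0].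
  do 2 (apply: mulr_ge0; last lra).
  by apply: mulr_ge0; [apply: mulr_ge0|]; rewrite ?powR_ge0// ltW// poisson_cst_gt0.
rewrite -ge0_integralD_fin//.
- apply: eq_integral => s; rewrite inE/= in_itv/= andbT => ss0.
  by rewrite pkernel_jump_sum//; lra.
- by move=> s /=; rewrite in_itv/= andbT => ss0; apply: pos => //; apply: mulr_ge0; rewrite ?normr_ge0; lra.
- by move=> s /=; rewrite in_itv/= andbT => ss0; apply: pos => //; apply: mulr_ge0; rewrite ?normr_ge0; lra.
Qed.

(** The substitution t = m (s - 1/s)^2 leads to the Euler integral. *)
Lemma kfun_beta (m : R) : 0 < m ->
  (\int[mu]_(s in `]1%R, +oo[) (kfun s * (m * (s - s^-1) ^+ 2 / (1 + m * (s - s^-1) ^+ 2)))%:E =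
  (m `^ be / (2 * c))%:E)%E.
Proof.
move=> m0.
pose F (s : R) : R := m * (s - s^-1) ^+ 2.
pose F' (s : R) : R := 2 * m * (s - s^-1) * (1 + s ^- 2).
pose G (t : R) : R := m `^ be / 2 * (t `^ (- be) / (1 + t)).
have v0 (s : R) : 1 < s -> 0 < s - s^-1.
  by move=> s1; rewrite subr_gt0 (@lt_trans _ _ 1)// invf_lt1//; lra.
transitivity (\int[mu]_(s in `]1%R, +oo[) (G (F s) * F' s)%:E)%E.
  apply: eq_integral => s; rewrite inE/= in_itv/= andbT => s1; congr EFin.
  have vs := v0 s s1; have s0 : 0 < s by lra.
  have d0 : 0 < 1 + m * (s - s^-1) ^+ 2.
    by apply: addr_gt0 => //; apply: mulr_gt0 => //; exact: exprn_gt0.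
  rewrite /kfun /G /F /F' (powRM _ (ltW m0) (sqr_ge0 _)) (powRN m).
  have mb : m `^ be != 0 by apply/lt0r_neq0/powR_gt0.
  move: (m `^ be) mb => M mb; move: (((s - s^-1) ^+ 2) `^ (- be)) => V.
  move: vs d0; set v := s - s^-1 => vs d0; clearbody v.
  by field; rewrite (lt0r_neq0 d0) (lt0r_neq0 s0) mb (lt0r_neq0 vs).
transitivity (\int[mu]_(t in `]0%R, +oo[) (G t)%:E)%E; last first.
  rewrite /G ge0_integralZ_fin//.
  - rewrite -/(beta_integral be) beta_integralE// -EFinM; congr EFin.
    by field; rewrite lt0r_neq0// poisson_cst_gt0.
  - exact: measurable_beta_integrand.
  - by rewrite divr_ge0 ?powR_ge0.
  - by move=> t /=; rewrite in_itv/= andbT => t0; rewrite divr_ge0 ?powR_ge0//; lra.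
apply/esym; apply: ge0_integral_subst.
- exact: interval_is_interval.
- move=> s s1; have sn : id s != 0 by apply: lt0r_neq0; rewrite /=; lra.
  have d1 := is_deriveB (is_derive_id s (1 : R)) (is_deriveV sn (is_derive_id s (1 : R))).
  have d2 := is_deriveM (is_derive_cst m s (1 : R)) (is_deriveM d1 d1).
  apply: (is_derive_eq d2); rewrite scaler0 addr0 /F'.
  have -> : (id - [eta GRing.inv]) s = s - s^-1 by [].
  by rewrite /GRing.scale/= /GRing.scale/=; ring.
- move=> s s1; apply: mulr_gt0; first by apply: mulr_gt0; [lra|exact: v0].
  by apply: addr_gt0 => //; rewrite invr_gt0 exprn_gt0//; lra.
- move=> s s1; have sn : s != 0 by apply: lt0r_neq0; lra.
  apply: cvgM; first by apply: cvgMr; apply: cvgB; [exact: cvg_id|exact: inv_continuous].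
  apply: cvgD; first exact: cvg_cst.
  by apply: cvgV; [rewrite expf_neq0|exact: exprn_continuous].
- move=> s s1; rewrite /= in_itv/= andbT; apply: mulr_gt0 => //; apply: exprn_gt0; exact: v0.
- move=> t; rewrite /= in_itv/= andbT => t0.
  have [q tE q0] : exists2 q, t = m * q & 0 < q.
    by exists (t / m); [field; exact: lt0r_neq0|exact: divr_gt0].
  pose e : R := Num.min 1 (q / 4).
  have e0 : 0 < e by rewrite lt_min; apply/andP; split; lra.
  have e1 : e <= 1 by rewrite ge_min lexx.
  have e2 : e <= q / 4 by rewrite ge_min lexx orbT.
  (* the choice of e gives (2 e)^2 <= 4 e <= q, and 1 + q bounds the other difference below *)
  exists (1 + e), (2 + q); split; [lra|lra|].
  rewrite /F tE !(ler_pM2l m0); apply/andP; split.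
    have i0 : 0 < (1 + e)^-1 by rewrite invr_gt0; lra.
    have i1 : (1 + e)^-1 * (1 + e) = 1 by rewrite mulVf// lt0r_neq0//; lra.
    have h1 : 0 <= 1 + e - (1 + e)^-1 by nra.
    have h2 : 1 + e - (1 + e)^-1 <= 2 * e by nra.
    nra.
  have i0 : 0 < (2 + q)^-1 by rewrite invr_gt0; lra.
  have i1 : (2 + q)^-1 <= 1 by rewrite invf_le1; lra.
  have h1 : 1 + q <= 2 + q - (2 + q)^-1 by lra.
  nra.
- by move=> t; rewrite /= in_itv/= andbT => t0; apply: cvgMr; exact: beta_integrand_continuous.
- move=> t; rewrite /= in_itv/= andbT => t0.
  by rewrite /G mulr_ge0 ?divr_ge0 ?powR_ge0//; lra.
Qed.

(** With [kfun_beta], this writes the direct jump to y in the factors of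
[pkernel_jump_sum]. *)
Lemma jump_pkernel (a b x y : R) : a < x < b -> ext a b y ->
  jump (y - x) = 2 * zfac a b x * pk a b x y * (mfac a b x y `^ be / (2 * c)).
Proof.
move=> axb yab; have yx := ext_neq axb yab; case/andP: (axb) => ax xb.
have ab : a < b by lra.
have D0 := ext_gt0 ab yab.
rewrite (jumpE yx) /zfac /mfac /pkernel.
have A0 : 0 < x - a by lra.
have B0 : 0 < b - x by lra.
have C0 : 0 < b - a by lra.
have Y0 : 0 < (y - x) ^+ 2 by rewrite -real_normK ?num_real// exprn_gt0// normr_gt0.
have c0 : 0 < c by exact: poisson_cst_gt0.
have n0 : 0 < `|y - x| by rewrite normr_gt0.
move: A0 B0 C0 D0 Y0 c0 n0; move: (x - a) (b - x) (b - a) ((y - a) * (y - b)) ((y - x) ^+ 2) c `|y - x|.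
move=> A B C D Y k n A0 B0 C0 D0 Y0 k0 n0.
have AB0 : 0 < A * B by exact: mulr_gt0.
have P1 : 0 < C ^+ 2 / (A * B) ^+ 2 by apply: divr_gt0; exact: exprn_gt0.
have P2 : 0 < A * B / D by exact: divr_gt0.
have P3 : 0 < A * B * D / (C ^+ 2 * Y).
  by apply: divr_gt0; apply: mulr_gt0 => //; exact: exprn_gt0.
have -> : Y `^ (- be) = (C ^+ 2 / (A * B) ^+ 2) `^ be * (A * B / D) `^ be * (A * B * D / (C ^+ 2 * Y)) `^ be.
  rewrite -(powRM _ (ltW P1) (ltW P2)) -(powRM _ (ltW (mulr_gt0 P1 P2)) (ltW P3)) -powRV//.
  by congr (_ `^ _); field; rewrite !lt0r_neq0.
by field; rewrite !lt0r_neq0.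
Qed.

(** Arithmetic-geometric mean inequality for the two terms of (b - a)(y - x) =
(x - a)(y - b) + (b - x)(y - a). *)
Lemma mfac_le (a b x y : R) : a < x < b -> ext a b y -> mfac a b x y <= 4^-1.
Proof.
move=> axb yab; have yx := ext_neq axb yab; case/andP: (axb) => ax xb.
have ab : a < b by lra.
have Y0 : 0 < (y - x) ^+ 2 by rewrite -real_normK ?num_real// exprn_gt0// normr_gt0.
rewrite /mfac ler_pdivrMr; last by apply: mulr_gt0 => //; apply: exprn_gt0; lra.
have -> : (b - a) ^+ 2 * (y - x) ^+ 2 = ((x - a) * (y - b) + (b - x) * (y - a)) ^+ 2 by ring.
have := sqr_ge0 ((x - a) * (y - b) - (b - x) * (y - a)); nra.
Qed.

(** The error term, with mfac replaced by the bound 1/4 in order to be uniform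
in y. *)
Definition krem (s0 : R) : \bar R :=
  (\int[mu]_(s in `]1%R, s0]) (kfun s * (4^-1 * (s - s^-1) ^+ 2 / (1 + 4^-1 * (s - s^-1) ^+ 2)))%:E)%E.

Definition kmain (s0 : R) : \bar R := (\int[mu]_(s in `]s0, +oo[) (kfun s)%:E)%E.

Lemma measurable_kfrac (m : R) (D : set R) : measurable_fun D
  (fun s => kfun s * (m * (s - s^-1) ^+ 2 / (1 + m * (s - s^-1) ^+ 2))).
Proof.
apply: measurable_funTS.
have mi : measurable_fun setT (fun s : R => s^-1) by exact: measurable_fun_inv.
have mv : measurable_fun setT (fun s : R => m * (s - s^-1) ^+ 2).
  by apply: measurable_funM => //; apply: measurable_funX; exact: measurable_funB.
apply: measurable_funM; first exact: measurable_kfun.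
by apply: measurable_funM => //; apply: measurable_fun_inv; exact: measurable_funD.
Qed.

Lemma kfrac_ge0 (m s : R) : 0 < m -> 1 < s ->
  0 <= kfun s * (m * (s - s^-1) ^+ 2 / (1 + m * (s - s^-1) ^+ 2)).
Proof.
move=> m0 s1; have := kfun_gt0 s1 => k0.
have q0 : 0 <= m * (s - s^-1) ^+ 2 by apply: mulr_ge0 (sqr_ge0 _); lra.
by apply: mulr_ge0; [lra|apply: divr_ge0 => //; lra].
Qed.

(** With v = s - 1/s and m = mfac a b x y, the indirect jumps to y contribute
the integral of kfun / (1 + m v^2) over s > s0, and the direct jump that of kfun
m v^2 / (1 + m v^2) over s > 1. On s > s0 the two densities add up to kfun, and
the rest is at most krem. *)
Lemma kernel_balance (a b x y s0 : R) : a < x < b -> ext a b y -> 1 <= s0 ->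
  ((2 * zfac a b x * pk a b x y)%:E * kmain s0 <=
   \int[mu]_(w in `]a, (lmob a b x s0)[) (pk a b w y * jump (w - x))%:E +
   \int[mu]_(w in `](mob a b x s0), b[) (pk a b w y * jump (w - x))%:E
   + (jump (y - x))%:E <= (2 * zfac a b x * pk a b x y)%:E * (kmain s0 + krem s0))%E.
Proof.
move=> axb yab s01; rewrite excised_pkernel_jump// (jump_pkernel axb yab).
have pk0 := pkernel_gt0 be0 be1 axb yab.
have z0 : 0 < 2 * zfac a b x * pk a b x y.
  apply: mulr_gt0 => //; apply: mulr_gt0 => //; apply: powR_gt0.
  case/andP: (axb) => ax xb; apply: divr_gt0; apply: exprn_gt0; [lra|apply: mulr_gt0; lra].
have m0 := mfac_gt0 axb yab; have m4 := mfac_le axb yab.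
move: z0 m0 m4; move: (2 * zfac a b x * pk a b x y) (mfac a b x y) => z m z0 m0 m4.
have gt1 (s : R) : s0 < s -> 1 < s by lra.
have pos1 (s : R) : 1 < s -> 0 <= kfun s / (1 + m * (s - s^-1) ^+ 2).
  move=> s1; apply: divr_ge0; first exact/ltW/kfun_gt0.
  by apply: addr_ge0 => //; apply: mulr_ge0 (sqr_ge0 _); lra.
have mes1 (D : set R) : measurable_fun D (fun s => kfun s / (1 + m * (s - s^-1) ^+ 2)).
  apply: measurable_funTS.
  apply: measurable_funM; first exact: measurable_kfun.
  apply: measurable_fun_inv; apply: measurable_funD => //; apply: measurable_funM => //.
  by apply: measurable_funX; apply: measurable_funB => //; exact: measurable_fun_inv.
rewrite ge0_integralZ_fin//; last 2 first.
- exact: ltW.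
- by move=> s /=; rewrite in_itv/= andbT => /gt1; exact: pos1.
rewrite EFinM -kfun_beta// -muleDr//; last first.
  apply: ge0_adde_def; rewrite inE; apply: integral_ge0 => s; rewrite /= in_itv/= andbT lee_fin => ?.
    by apply: pos1; lra.
  exact: kfrac_ge0.
have split : (\int[mu]_(s in `]1%R, +oo[) (kfun s * (m * (s - s^-1) ^+ 2 / (1 + m * (s - s^-1) ^+ 2)))%:E
  = \int[mu]_(s in `]1%R, s0]) (kfun s * (m * (s - s^-1) ^+ 2 / (1 + m * (s - s^-1) ^+ 2)))%:E
  + \int[mu]_(s in `]s0, +oo[) (kfun s * (m * (s - s^-1) ^+ 2 / (1 + m * (s - s^-1) ^+ 2)))%:E)%E.
  rewrite (_ : `]1, +oo[%classic = `]1, s0] `|` `]s0, +oo[); last first.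
    by apply/seteqP; split => s /=; rewrite !in_itv/= ?andbT; lra.
  rewrite ge0_integral_setU//.
  - by apply: measurable_fun_EFin; exact: measurable_kfrac.
  - by move=> s /= [] /=; rewrite in_itv/= ?andbT => h; rewrite lee_fin; apply: kfrac_ge0 => //; lra.
  - by apply/disj_setPS => s/=; rewrite !in_itv/= andbT; lra.
rewrite split addeCA -ge0_integralD_fin//; last 3 first.
- exact: measurable_kfrac.
- by move=> s /=; rewrite in_itv/= andbT => /gt1; exact: pos1.
- by move=> s /=; rewrite in_itv/= andbT => /gt1; exact: kfrac_ge0.
rewrite (_ : (\int[mu]_(s in `]s0, +oo[) (kfun s / _ + _)%:E = kmain s0)%E); last first.
  apply: eq_integral => s; rewrite inE/= in_itv/= andbT => /gt1 s1; congr EFin.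
  move: (sqr_ge0 (s - s^-1)) (kfun s); move: ((s - s^-1) ^+ 2) => q q0 k.
  by field; apply: lt0r_neq0; nra.
apply/andP; split.
  rewrite lee_pmul2l ?lte_fin// leeDr// integral_ge0// => s /=; rewrite in_itv/= => /andP[s1 _].
  by rewrite lee_fin; exact: kfrac_ge0.
rewrite lee_pmul2l ?lte_fin// addeC leeD2l//; apply: le_integral_ge0 => //.
- exact: measurable_kfrac.
- exact: measurable_kfrac.
move=> s /=; rewrite in_itv/= => /andP[s1 _]; rewrite kfrac_ge0//=.
apply: ler_wpM2l; first exact/ltW/kfun_gt0.
move: (sqr_ge0 (s - s^-1)); move: ((s - s^-1) ^+ 2) => q q0.
have d1 : 0 < 1 + m * q by nra.
have d2 : 0 < 1 + 4^-1 * q by nra.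
by rewrite ler_pdivrMr// mulrAC ler_pdivlMr//; nra.
Qed.

End kernel_identity.

(** * Poisson integrals *)

Section poisson_integral.
Variable R : realType.
Notation mu := (@lebesgue_measure R).
Variable be : R.
Hypotheses (be0 : 0 < be) (be1 : be < 1).
Notation pk := (pkernel be).
Notation c := (poisson_cst be).
Notation jump := (jump be).

Lemma tonelli_on (A B : set R) (f : R -> R -> R) : measurable A -> measurable B ->
  measurable_fun setT (fun z : R * R => f z.1 z.2) -> (forall x y, 0 <= f x y) ->
  (\int[mu]_(x in A) \int[mu]_(y in B) (f x y)%:E =
   \int[mu]_(y in B) \int[mu]_(x in A) (f x y)%:E)%E.
Proof.
move=> mA mB mf f0.
pose h (z : R * R) := ((f z.1 z.2) * \1_A z.1 * \1_B z.2)%:E.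
have mh : measurable_fun setT h.
  apply/measurable_EFinP; apply: measurable_funM.
    apply: measurable_funM => //.
    by apply: (measurableT_comp (f := (\1_A : R -> R))) => //; exact: measurable_indic.
  by apply: (measurableT_comp (f := (\1_B : R -> R))) => //; exact: measurable_indic.
have h0 z : (0 <= h z)%E by rewrite /h lee_fin !mulr_ge0.
have := @fubini_tonelli _ _ _ _ R mu mu h mh h0.
have -> : (\int[mu]_x \int[mu]_y h (x, y) = \int[mu]_(x in A) \int[mu]_(y in B) (f x y)%:E)%E.
  rewrite [RHS]integral_mkcond; apply: eq_integral => x _; rewrite patchE.
  case: ifPn => xA; last first.
    apply: integral0_eq => y _; rewrite /h/= indicE (negbTE xA) mulr0 mul0r//.
  rewrite [RHS]integral_mkcond; apply: eq_integral => y _; rewrite patchE /h/= !indicE xA mulr1.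
  by case: ifPn => yB; rewrite ?mulr1 ?mulr0.
move=> ->.
rewrite [RHS]integral_mkcond; apply: eq_integral => y _; rewrite patchE.
case: ifPn => yB; last first.
  by apply: integral0_eq => x _; rewrite /h/= [X in _ * X]indicE (negbTE yB) mulr0.
rewrite [RHS]integral_mkcond; apply: eq_integral => x _; rewrite patchE /h/= !indicE yB mulr1.
by case: ifPn => xA; rewrite ?mulr1 ?mulr0.
Qed.

Lemma pkernel_ge0 (a b x y : R) : 0 <= pk a b x y.
Proof.
by rewrite mulr_ge0 ?invr_ge0// mulr_ge0 ?powR_ge0// ltW// poisson_cst_gt0.
Qed.

Lemma ge0_integrable (D : set R) (f : R -> R) : measurable D -> measurable_fun D f ->
  (forall x, D x -> 0 <= f x) -> (\int[mu]_(x in D) (f x)%:E < +oo)%E ->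
  mu.-integrable D (EFin \o f).
Proof.
move=> mD mf f0 foo; apply/integrableP; split; first exact/measurable_EFinP.
have <- : (\int[mu]_(x in D) (f x)%:E = \int[mu]_(x in D) `|(EFin \o f) x|)%E => //.
by apply: eq_integral => x /[!inE] Dx /=; rewrite ger0_norm// f0.
Qed.

Lemma integrable_pkernel (a b x : R) : a < x < b ->
  mu.-integrable (ext a b) (EFin \o pk a b x).
Proof.
move=> axb; apply: ge0_integrable.
- exact: measurable_ext.
- by apply: measurable_funTS; exact: measurable_pkernel.
- by move=> y _; exact: pkernel_ge0.
- by rewrite pkernel_mass ?ltry.
Qed.

Lemma integrable_mul_bounded (D : set R) (f g : R -> R) (M : R) : measurable D ->
  mu.-integrable D (EFin \o f) -> measurable_fun D g -> (forall x, D x -> `|g x| <= M) ->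
  mu.-integrable D (EFin \o (fun x => f x * g x)).
Proof.
move=> mD fi mg gM.
have := @integrableMr _ _ R mu D mD g (EFin \o f) mg _ fi.
have -> : ((EFin \o g) \* (EFin \o f))%E = EFin \o (fun x => f x * g x).
  by apply/funext => x /=; rewrite -EFinM mulrC.
apply; exists `|M|; split; first exact: num_real.
by move=> K MK x Dx /=; rewrite (le_trans (gM x Dx))// (le_trans (ler_norm _))// ltW.
Qed.

Definition pint (a b : R) (g : R -> R) (x : R) : R :=
  \int[mu]_(y in ext a b) (pk a b x y * g y).

Definition pext (a b : R) (g : R -> R) (x : R) : R :=
  if a < x < b then pint a b g x else g x.

Lemma integrable_pint (a b x M : R) (g : R -> R) : a < x < b -> measurable_fun setT g ->
  (forall y, `|g y| <= M) -> mu.-integrable (ext a b) (EFin \o (fun y => pk a b x y * g y)).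
Proof.
move=> axb mg gM; apply: (integrable_mul_bounded (M := M)) => //.
- exact: measurable_ext.
- exact: integrable_pkernel.
- exact: measurable_funTS.
Qed.

Lemma pintE (a b x M : R) (g : R -> R) : a < x < b -> measurable_fun setT g ->
  (forall y, `|g y| <= M) ->
  (\int[mu]_(y in ext a b) (pk a b x y * g y)%:E = (pint a b g x)%:E)%E.
Proof.
move=> axb mg gM; rewrite /pint /Rintegral fineK//.
by apply: integrable_fin_num; [exact: measurable_ext|exact: (integrable_pint axb mg gM)].
Qed.

Lemma pint_cst (a b x k : R) : a < x < b -> pint a b (fun=> k) x = k.
Proof.
move=> axb; rewrite /pint RintegralZr//; last first.
- exact: integrable_pkernel.
- exact: measurable_ext.
by rewrite /Rintegral pkernel_mass//= mul1r.
Qed.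

Lemma measurable_pint (a b : R) (g : R -> R) : measurable_fun setT g ->
  (forall y, 0 <= g y) -> measurable_fun setT (pint a b g).
Proof.
move=> mg g0.
pose f (z : R * R) : \bar R := (pk a b z.1 z.2 * g z.2 * \1_(ext a b) z.2)%:E.
have mf : measurable_fun setT f.
  apply/measurable_EFinP; apply: measurable_funM.
    apply: measurable_funM; first exact: measurable_pkernel2.
    exact: (measurableT_comp mg measurable_snd).
  apply: (measurableT_comp (f := (\1_(ext a b) : R -> R))) => //.
  by apply: measurable_indic; exact: measurable_ext.
have f0 z : (0 <= f z)%E by rewrite /f lee_fin; apply: mulr_ge0 => //; apply: mulr_ge0 => //; exact: pkernel_ge0.
have := @measurable_fun_fubini_tonelli_F _ _ _ _ R mu f mf f0 => mF.
have -> : pint a b g = fine \o fubini_F mu f.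
  apply/funext => x; rewrite /pint /Rintegral /fubini_F /=; congr fine.
  rewrite integral_mkcond; apply: eq_integral => y _; rewrite patchE /f/= indicE.
  by case: ifPn => yY; rewrite ?mulr1 ?mulr0.
by apply: measurableT_comp mF; exact: fine_measurable.
Qed.

Lemma measurable_pext (a b : R) (g : R -> R) : measurable_fun setT g ->
  (forall y, 0 <= g y) -> measurable_fun setT (pext a b g).
Proof.
move=> mg g0; rewrite /pext; apply: measurable_fun_ifT => //.
  apply: measurable_and; first exact: measurable_fun_ltr.
  exact: measurable_fun_ltr.
exact: measurable_pint.
Qed.

Lemma pint_le (a b x M : R) (f g : R -> R) : a < x < b ->
  measurable_fun setT f -> measurable_fun setT g ->
  (forall y, `|f y| <= M) -> (forall y, `|g y| <= M) ->
  (forall y, ext a b y -> f y <= g y) -> pint a b f x <= pint a b g x.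
Proof.
move=> axb mf mg fM gM fg; apply: le_Rintegral.
- exact: measurable_ext.
- exact: (integrable_pint axb mf fM).
- exact: (integrable_pint axb mg gM).
- by move=> y yab; apply: ler_wpM2l; [exact: pkernel_ge0|exact: fg].
Qed.

Lemma pint_itv (a b x m M : R) (g : R -> R) : a < x < b ->
  measurable_fun setT g -> (forall y, m <= g y <= M) -> m <= pint a b g x <= M.
Proof.
move=> axb mg gM; pose N : R := `|m| + `|M|.
have gN y : `|g y| <= N.
  rewrite ler_norml; have /andP[h1 h2] := gM y.
  by have := ler_norm M; have := ler_norm (- m); rewrite normrN /N; have := normr_ge0 m; have := normr_ge0 M; lra.
have mN : `|m| <= N by rewrite lerDl.
have MN : `|M| <= N by rewrite lerDr.
apply/andP; split.
  by rewrite -[leLHS](pint_cst m axb); apply: (@pint_le _ _ _ N) => // y _; case/andP: (gM y).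
by rewrite -[leRHS](pint_cst M axb); apply: (@pint_le _ _ _ N) => // y _; case/andP: (gM y).
Qed.

Lemma ge0_integral_setU_fin (A B : set R) (f : R -> R) : measurable A -> measurable B ->
  measurable_fun setT f -> (forall x, 0 <= f x) -> [disjoint A & B] ->
  (\int[mu]_(x in A `|` B) (f x)%:E = \int[mu]_(x in A) (f x)%:E + \int[mu]_(x in B) (f x)%:E)%E.
Proof.
move=> mA mB mf f0 AB; rewrite ge0_integral_setU//.
  by apply: measurable_fun_EFin; exact: measurable_funTS.
by move=> x _; rewrite lee_fin.
Qed.

Lemma measurable_integral_param (A : set R) (f : R -> R -> R) : measurable A ->
  measurable_fun setT (fun z : R * R => f z.1 z.2) -> (forall x y, 0 <= f x y) ->
  measurable_fun setT (fun y => \int[mu]_(x in A) (f x y)%:E)%E.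
Proof.
move=> mA mf f0.
pose h (z : R * R) : \bar R := (f z.1 z.2 * \1_A z.1)%:E.
have mh : measurable_fun setT h.
  apply/measurable_EFinP; apply: measurable_funM => //.
  by apply: (measurableT_comp (f := (\1_A : R -> R))) => //; exact: measurable_indic.
have h0 z : (0 <= h z)%E by rewrite /h lee_fin mulr_ge0.
have := @measurable_fun_fubini_tonelli_G _ _ _ _ R mu h mh h0.
apply: eq_measurable_fun => y _; rewrite /fubini_G.
rewrite [RHS]integral_mkcond; apply: eq_integral => x _; rewrite patchE /h/= indicE.
by case: ifPn => xA; rewrite ?mulr1 ?mulr0.
Qed.

Lemma mob_bounds (a b x s0 : R) : a < x < b -> 1 <= s0 ->
  [/\ a < lmob a b x s0, lmob a b x s0 <= x, x <= mob a b x s0 & mob a b x s0 < b].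
Proof.
have H (a' b' x' : R) : a' < x' < b' -> 1 <= s0 -> x' <= mob a' b' x' s0 /\ mob a' b' x' s0 < b'.
  move=> axb s1; case/andP: (axb) => ax xb; have d0 := mob_den_gt0 s0 axb; split.
    rewrite -subr_ge0 mob_subx//; apply: divr_ge0; last exact: ltW.
    by apply: mulr_ge0; [apply: mulr_ge0; lra|rewrite subr_ge0 exprn_ege1].
  by rewrite -subr_gt0 mob_subr//; apply: divr_gt0 => //; apply: mulr_gt0; lra.
move=> axb s1; have [h1 h2] := H _ _ _ axb s1.
have axb' : - b < - x < - a by case/andP: axb; lra.
by have [h3 h4] := H _ _ _ axb' s1; rewrite /lmob; split; lra.
Qed.

Lemma measurable_jump_sub (x : R) : measurable_fun setT (fun w : R => jump (w - x)).
Proof. by apply: measurableT_comp; [exact: measurable_jump|exact: measurable_funB]. Qed.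

(** Integration of [kernel_balance] against g, after exchanging the order of
integration. *)
Lemma pext_excised (a b x s0 : R) (g : R -> R) : a < x < b -> 1 <= s0 ->
  measurable_fun setT g -> (forall y, 0 <= g y <= 1) ->
  ((2 * zfac be a b x * pint a b g x)%:E * kmain be s0 <=
   \int[mu]_(w in ext (lmob a b x s0) (mob a b x s0)) (pext a b g w * jump (w - x))%:E <=
   (2 * zfac be a b x * pint a b g x)%:E * (kmain be s0 + krem be s0))%E.
Proof.
move=> axb s1 mg g01; have ab : a < b by case/andP: axb; lra.
have [ap px xq qb] := mob_bounds axb s1.
set p := lmob a b x s0 in ap px *; set q := mob a b x s0 in xq qb *.
have g0 y : 0 <= g y by case/andP: (g01 y).
have gN y : `|g y| <= 1 by rewrite ger0_norm//; case/andP: (g01 y).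
pose F w := pext a b g w * jump (w - x).
have mpe := measurable_pext a b mg g0.
have mF : measurable_fun setT F by apply: measurable_funM => //; exact: measurable_jump_sub.
have pe0 w : 0 <= pext a b g w.
  rewrite /pext; case: ifPn => // awb.
  by apply: Rintegral_ge0 => y _; apply: mulr_ge0 => //; exact: pkernel_ge0.
have F0 w : 0 <= F w by apply: mulr_ge0 => //; exact: jump_ge0.
pose f w y := pk a b w y * jump (w - x) * g y.
have mf : measurable_fun setT (fun z : R * R => f z.1 z.2).
  apply: measurable_funM; last exact: (measurableT_comp mg measurable_snd).
  apply: measurable_funM; first exact: measurable_pkernel2.
  exact: (measurableT_comp (measurable_jump_sub x) measurable_fst).
have f0 w y : 0 <= f w y.
  by apply: mulr_ge0 => //; apply: mulr_ge0; [exact: pkernel_ge0|exact: jump_ge0].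
have piece (A : set R) : measurable A -> A `<=` `]a, b[ ->
  (\int[mu]_(w in A) (F w)%:E =
   \int[mu]_(y in ext a b) ((g y)%:E * \int[mu]_(w in A) (pk a b w y * jump (w - x))%:E))%E.
  move=> mA Aab.
  transitivity (\int[mu]_(w in A) \int[mu]_(y in ext a b) (f w y)%:E)%E.
    apply: eq_integral => w; rewrite inE => /Aab; rewrite /= in_itv/= => awb.
    rewrite /F /pext awb mulrC EFinM -(pintE awb mg gN).
    rewrite -ge0_integralZ_fin//.
    - by apply: eq_integral => y _; congr EFin; rewrite /f; ring.
    - exact: measurable_ext.
    - by apply: measurable_funTS; apply: measurable_funM => //; exact: measurable_pkernel.
    - exact: jump_ge0.
    - by move=> y _; apply: mulr_ge0 => //; exact: pkernel_ge0.
  rewrite tonelli_on//; last exact: measurable_ext.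
  apply: eq_integral => y _; rewrite -ge0_integralZ_fin//.
  - by apply: eq_integral => w _; rewrite /f mulrC.
  - by apply: measurable_pkernel_jump.
  - by move=> w _; apply: mulr_ge0; [exact: pkernel_ge0|exact: jump_ge0].
have mp : measurable (`]a, p[%classic : set R) by [].
have mq : measurable (`]q, b[%classic : set R) by [].
pose E1 y := (\int[mu]_(w in `]a, p[) (pk a b w y * jump (w - x))%:E)%E.
pose E2 y := (\int[mu]_(w in `]q, b[) (pk a b w y * jump (w - x))%:E)%E.
have mE (A : set R) : measurable A ->
    measurable_fun setT (fun y => \int[mu]_(w in A) (pk a b w y * jump (w - x))%:E)%E.
  move=> mA; apply: (measurable_integral_param (f := fun w y => pk a b w y * jump (w - x))) => //.
    apply: measurable_funM; first exact: measurable_pkernel2.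
    exact: (measurableT_comp (measurable_jump_sub x) measurable_fst).
  by move=> w y; apply: mulr_ge0; [exact: pkernel_ge0|exact: jump_ge0].
have E0 (A : set R) y : (0 <= \int[mu]_(w in A) (pk a b w y * jump (w - x))%:E)%E.
  by apply: integral_ge0 => w _; rewrite lee_fin; apply: mulr_ge0; [exact: pkernel_ge0|exact: jump_ge0].
have mgE (h : R -> \bar R) : measurable_fun setT h ->
    measurable_fun (ext a b) (fun y => (g y)%:E * h y)%E.
  move=> mh; apply: measurable_funTS; apply: emeasurable_funM => //.
  exact: measurable_fun_EFin.
have total : (\int[mu]_(w in ext p q) (F w)%:E =
    \int[mu]_(y in ext a b) ((g y)%:E * (E1 y + E2 y + (jump (y - x))%:E)))%E.
  have -> : ext p q = ext a b `|` (`[a, p[ `|` `]q, b]).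
    have pq : p <= q by lra.
    rewrite !extE//; last exact: ltW.
    by apply/seteqP; split => w /=; rewrite !in_itv/= ?andbT; lra.
  have mpq : measurable (`[a, p[%classic : set R) by [].
  have mqb : measurable (`]q, b]%classic : set R) by [].
  have dis1 : [disjoint ext a b & `[a, p[ `|` `]q, b]].
    apply/disj_setPS => w; rewrite extE; last exact: ltW.
    by rewrite /= !in_itv/= ?andbT; lra.
  have dis2 : [disjoint `[a, p[ & `]q, b]].
    by apply/disj_setPS => w; rewrite /= !in_itv/=; lra.
  rewrite (ge0_integral_setU_fin (measurable_ext a b) (measurableU _ _ mpq mqb) mF F0 dis1).
  rewrite (ge0_integral_setU_fin mpq mqb mF F0 dis2).
  rewrite -integral_itv_obnd_cbnd; last exact: measurable_fun_EFin (measurable_funTS mF).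
  rewrite -integral_itv_bndo_bndc; last exact: measurable_fun_EFin (measurable_funTS mF).
  have h1 : `]a, p[%classic `<=` `]a, b[ by move=> w; rewrite /= !in_itv/=; lra.
  have h2 : `]q, b[%classic `<=` `]a, b[ by move=> w; rewrite /= !in_itv/=; lra.
  rewrite (piece _ mp h1) (piece _ mq h2).
  have gE0 (A : set R) y : (0 <= (g y)%:E * \int[mu]_(w in A) (pk a b w y * jump (w - x))%:E)%E.
    by apply: mule_ge0; rewrite ?lee_fin.
  rewrite -ge0_integralD//; [|exact: measurable_ext|exact: mgE (mE _ mp)|exact: mgE (mE _ mq)].
  rewrite -ge0_integralD//; last 5 first.
  - exact: measurable_ext.
  - by move=> y _; rewrite lee_fin.
  - exact: measurable_fun_EFin (measurable_funTS mF).
  - by move=> y _; exact: adde_ge0.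
  - by apply: emeasurable_funD; [exact: mgE (mE _ mp)|exact: mgE (mE _ mq)].
  apply: eq_integral => y; rewrite inE => yab.
  have nab : (a < y < b) = false.
    by apply/negbTE/negP => ayb; apply: yab; rewrite /= in_itv/=; lra.
  have dist (e1 e2 k : \bar R) : (0 <= e1 -> 0 <= e2 -> 0 <= k ->
      k * (g y)%:E + ((g y)%:E * e1 + (g y)%:E * e2) = (g y)%:E * (e1 + e2 + k))%E.
    by move=> e10 e20 k0; rewrite !ge0_muleDr ?adde_ge0// addeC [(k * _)%E]muleC.
  rewrite /F /pext nab mulrC EFinM -dist ?lee_fin ?jump_ge0//; exact: E0.
have pkg0 y : 0 <= pk a b x y * g y by apply: mulr_ge0 => //; exact: pkernel_ge0.
have mpkg : measurable_fun (ext a b) (fun y => pk a b x y * g y).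
  by apply: measurable_funTS; apply: measurable_funM => //; exact: measurable_pkernel.
have pintK (K : \bar R) : (0 <= K)%E ->
  ((2 * zfac be a b x * pint a b g x)%:E * K =
   \int[mu]_(y in ext a b) ((g y)%:E * ((2 * zfac be a b x * pk a b x y)%:E * K)))%E.
  move=> K0; have K0' : (0 <= (2 * zfac be a b x)%:E * K)%E.
    by apply: mule_ge0 => //; rewrite lee_fin mulr_ge0 ?powR_ge0.
  rewrite EFinM muleAC muleC -(pintE axb mg gN) -ge0_integralZr//; last 3 first.
  - exact: measurable_ext.
  - exact: measurable_fun_EFin.
  - by move=> y _; rewrite lee_fin.
  apply: eq_integral => y _; rewrite !muleA -!EFinM; congr (_%:E * _)%E; ring.
have kmain0 : (0 <= kmain be s0)%E.
  by apply: integral_ge0 => s; rewrite /= in_itv/= andbT lee_fin => s0s; apply/ltW/kfun_gt0; lra.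
have krem0 : (0 <= krem be s0)%E.
  apply: integral_ge0 => s; rewrite /= in_itv/= lee_fin => /andP[s1' _].
  by apply: kfrac_ge0 => //; lra.
have mK (K : \bar R) : measurable_fun (ext a b) (fun y => (g y)%:E * ((2 * zfac be a b x * pk a b x y)%:E * K))%E.
  apply: mgE; apply: emeasurable_funM => //; apply: measurable_fun_EFin.
  by apply: measurable_funM => //; exact: measurable_pkernel.
have mT : measurable_fun (ext a b) (fun y => (g y)%:E * (E1 y + E2 y + (jump (y - x))%:E))%E.
  apply: mgE; apply: emeasurable_funD.
    by apply: emeasurable_funD; exact: mE.
  by apply: measurable_fun_EFin; exact: measurable_jump_sub.
have z0 y : 0 <= 2 * zfac be a b x * pk a b x y.
  by apply: mulr_ge0; [apply: mulr_ge0; rewrite ?powR_ge0|exact: pkernel_ge0].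
have E120 y : (0 <= E1 y + E2 y + (jump (y - x))%:E)%E.
  by apply: adde_ge0; [apply: adde_ge0; exact: E0|rewrite lee_fin jump_ge0].
rewrite /F in total; rewrite total (pintK _ kmain0) (pintK _ (adde_ge0 kmain0 krem0)); apply/andP; split.
  apply: ge0_le_integral => //.
  - exact: measurable_ext.
  - by move=> y _; apply: mule_ge0; [rewrite lee_fin|apply: mule_ge0; rewrite ?lee_fin].
  - exact: mK.
  - move=> y yab; apply: lee_wpmul2l; first by rewrite lee_fin.
    by have /andP[h _] := kernel_balance be0 be1 axb yab s1.
apply: ge0_le_integral => //.
- exact: measurable_ext.
- by move=> y _; apply: mule_ge0; rewrite ?lee_fin.
- exact: mK.
- move=> y yab; apply: lee_wpmul2l; first by rewrite lee_fin.
  by have /andP[_ h] := kernel_balance be0 be1 axb yab s1.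
Qed.

End poisson_integral.

(** * Harmonicity of Poisson integrals *)

Section harmonicity.
Variable R : realType.
Notation mu := (@lebesgue_measure R).
Variable be : R.
Hypotheses (be0 : 0 < be) (be1 : be < 1).
Notation pk := (pkernel be).
Notation c := (poisson_cst be).
Notation jump := (jump be).

Lemma EFin_Rint (D : set R) (f : R -> R) : measurable D -> mu.-integrable D (EFin \o f) ->
  (\int[mu]_(x in D) (f x)%:E = (\int[mu]_(x in D) f x)%:E)%E.
Proof. by move=> mD fi; rewrite /Rintegral fineK//; apply: integrable_fin_num fi. Qed.

Lemma integral_jump_lty (x p q : R) : p < x < q ->
  (\int[mu]_(w in ext p q) (jump (w - x))%:E < +oo)%E.
Proof.
move=> /andP[px xq].
pose e : R := Num.min (x - p) (q - x).
have e0 : 0 < e by rewrite lt_min; apply/andP; split; lra.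
have ep : e <= x - p by rewrite ge_min lexx.
have eq : e <= q - x by rewrite ge_min lexx orbT.
have mj := measurable_jump_sub be x.
apply: (@le_lt_trans _ _ (\int[mu]_(w in ext (x - e) (x + e)) (jump (w - x))%:E)%E).
  apply: ge0_subset_integral_fin.
  - exact: measurable_ext.
  - exact: measurable_ext.
  - by move=> w; rewrite !extE /= ?in_itv/= ?in_itv/=; lra.
  - exact: measurable_funTS.
  - by move=> w _; exact: jump_ge0.
rewrite ge0_integral_ext; last 3 first.
- lra.
- exact: measurable_funTS.
- by move=> w _; exact: jump_ge0.
have -> : (x + e - (x - e)) / 2 = e by field.
have -> : (x - e + (x + e)) / 2 = x by field.
pose F (s : R) : R := - (be^-1 * s `^ (- (2 * be))).
pose F' (s : R) : R := 2 * s `^ (- (1 + 2 * be)).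
have b2 : 0 < 2 * be by rewrite mulr_gt0.
have := @integral_derive_le R F F' e (- (be^-1 * e `^ (- (2 * be)))  - 1) 0 _ _ _ _.
have -> : (\int[mu]_(s in `]e, +oo[) (jump (x + s - x) + jump (x - s - x))%:E =
    \int[mu]_(s in `]e, +oo[) (F' s)%:E)%E.
  apply: eq_integral => s; rewrite inE/= in_itv/= andbT => es; congr EFin.
  have -> : x + s - x = s by ring.
  have -> : x - s - x = - s by ring.
  by rewrite jumpN /F' /jump gtr0_norm ?powRN; [ring|lra].
move=> H; apply: le_lt_trans (H _ _ _ _) _; last by rewrite ltry.
- move=> s es; have s0 : 0 < s by lra.
  have d := is_deriveN (is_deriveM (is_derive_cst be^-1 s (1 : R)) (is_derive_powR (- (2 * be)) s0)).
  apply: (is_derive_eq d); rewrite scaler0 addr0 /F' /= /GRing.scale/=.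
  have -> : - (2 * be) - 1 = - (1 + 2 * be) by ring.
  by field; rewrite lt0r_neq0.
- by move=> s es; rewrite /F' mulr_gt0// powR_gt0//; lra.
- move=> s es; apply: cvgMr; apply: continuous_powR; lra.
- move=> s es; rewrite /F oppr_lt0 mulr_gt0 ?invr_gt0 ?powR_gt0//; last lra.
  rewrite andbT; have : be^-1 * s `^ (- (2 * be)) <= be^-1 * e `^ (- (2 * be)).
    apply: ler_wpM2l; first by rewrite invr_ge0 ltW.
    by apply: powRN_le; lra.
  lra.
Qed.

Lemma integrable_jump (x p q : R) : p < x < q ->
  mu.-integrable (ext p q) (EFin \o (fun w => jump (w - x))).
Proof.
move=> pxq; apply: ge0_integrable.
- exact: measurable_ext.
- by apply: measurable_funTS; exact: measurable_jump_sub.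
- by move=> w _; exact: jump_ge0.
- exact: integral_jump_lty.
Qed.

Lemma integrable_jump_mul (x p q M : R) (f : R -> R) : p < x < q ->
  measurable_fun setT f -> (forall w, `|f w| <= M) ->
  mu.-integrable (ext p q) (EFin \o (fun w => f w * jump (w - x))).
Proof.
move=> pxq mf fM.
have := @integrable_mul_bounded R (ext p q) (fun w => jump (w - x)) f M (measurable_ext _ _)
  (integrable_jump pxq) (measurable_funTS mf) (fun w _ => fM w).
by under eq_fun do rewrite mulrC.
Qed.

Definition incr (p q : R) (u : R -> R) (x : R) : R :=
  \int[mu]_(w in ext p q) ((u w - u x) * jump (w - x)).

Lemma integrable_incr (x p q M : R) (u : R -> R) : p < x < q ->
  measurable_fun setT u -> (forall w, `|u w| <= M) ->
  mu.-integrable (ext p q) (EFin \o (fun w => (u w - u x) * jump (w - x))).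
Proof.
move=> pxq mu' uM; apply: (integrable_jump_mul (M := M + M)) => //.
  exact: measurable_funB.
by move=> w; rewrite (le_trans (ler_normB _ _))// lerD.
Qed.

(** The principal value defining the fractional Laplacian of u at x vanishes. *)
Definition pvharm (u : R -> R) (x : R) : Prop :=
  incr (x - e) (x + e) u x @[e --> 0^'+] --> 0.

Lemma mob_bounds_lt (a b x s0 : R) : a < x < b -> 1 < s0 ->
  lmob a b x s0 < x < mob a b x s0.
Proof.
have H (a' b' x' : R) : a' < x' < b' -> 1 < s0 -> x' < mob a' b' x' s0.
  move=> axb s1; case/andP: (axb) => ax xb; have d0 := mob_den_gt0 s0 axb.
  rewrite -subr_gt0 mob_subx//; apply: divr_gt0 => //.
  by apply: mulr_gt0; [apply: mulr_gt0; lra|rewrite subr_gt0 exprn_egt1].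
move=> axb s1; have h1 := H _ _ _ axb s1.
have axb' : - b < - x < - a by case/andP: axb; lra.
by have h2 := H _ _ _ axb' s1; rewrite /lmob; lra.
Qed.

Lemma zfac_gt0 (a b x : R) : a < x < b -> 0 < zfac be a b x.
Proof.
by move=> axb; apply: powR_gt0; apply: divr_gt0; apply: exprn_gt0; case/andP: axb => ? ?; [lra|apply: mulr_gt0; lra].
Qed.

Lemma pext_itv (a b w : R) (g : R -> R) : measurable_fun setT g ->
  (forall y, 0 <= g y <= 1) -> 0 <= pext be a b g w <= 1.
Proof.
by move=> mg g01; rewrite /pext; case: ifPn => // awb; exact: pint_itv.
Qed.

(** Comparing [pext_excised] for g and for the constant 1 eliminates kmain,
which blows up as s0 tends to 1. *)
Lemma excised_incr_bound (a b x s0 : R) (g : R -> R) : a < x < b -> 1 < s0 ->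
  measurable_fun setT g -> (forall y, 0 <= g y <= 1) -> (krem be s0 < +oo)%E ->
  `|incr (lmob a b x s0) (mob a b x s0) (pext be a b g) x| <= 2 * zfac be a b x * fine (krem be s0).
Proof.
move=> axb s1 mg g01 kfin.
have g0 y : 0 <= g y by case/andP: (g01 y).
have pxq := mob_bounds_lt axb s1.
have s1' := ltW s1.
set p := lmob a b x s0 in pxq *; set q := mob a b x s0 in pxq *.
pose u := pext be a b g.
have mu' : measurable_fun setT u by exact: measurable_pext.
have u01 w : 0 <= u w <= 1 by exact: pext_itv.
have uN w : `|u w| <= 1 by rewrite ger0_norm; case/andP: (u01 w).
have iu := integrable_jump_mul pxq mu' uN.
have ij := integrable_jump pxq.
have mD := measurable_ext p q.
set J1 := \int[mu]_(w in ext p q) (u w * jump (w - x)).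
set J0 := \int[mu]_(w in ext p q) (jump (w - x)).
have -> : incr p q u x = J1 - u x * J0.
  rewrite /incr (_ : (fun w => _) = (fun w => u w * jump (w - x) - u x * jump (w - x))); last first.
    by apply/funext => w; rewrite mulrBl.
  rewrite RintegralB//; last exact: (integrable_jump_mul (f := fun=> u x) pxq (measurable_cst _) (fun _ => uN x)).
  by rewrite RintegralZl.
have ux : u x = pint be a b g x by rewrite /u /pext axb.
have := pext_excised be0 be1 axb s1' mg g01; rewrite -/p -/q -/u -ux.
have -> : (\int[mu]_(w in ext p q) (u w * jump (w - x))%:E = J1%:E)%E.
  exact: EFin_Rint mD iu.
have m1 : measurable_fun setT (fun _ : R => 1 : R) by exact: measurable_cst.
have h1 : forall y : R, (0 : R) <= (1 : R) <= (1 : R) by move=> _; rewrite ler01 lexx.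
have := pext_excised be0 be1 axb s1' m1 h1; clear h1; rewrite -/p -/q pint_cst//.
have -> : (\int[mu]_(w in ext p q) (pext be a b (fun=> 1) w * jump (w - x))%:E = J0%:E)%E.
  rewrite /J0 -(EFin_Rint mD ij).
  apply: eq_integral => w _; rewrite /pext; case: ifPn => awb; last by rewrite mul1r.
  by rewrite pint_cst// mul1r.
have z0 := zfac_gt0 axb.
have kmain0 : (0 <= kmain be s0)%E.
  by apply: integral_ge0 => s; rewrite /= in_itv/= andbT lee_fin => s0s; apply/ltW/kfun_gt0; lra.
have krem0 : (0 <= krem be s0)%E.
  apply: integral_ge0 => s; rewrite /= in_itv/= lee_fin => /andP[s1'' _].
  by apply: kfrac_ge0 => //; lra.
move: (zfac be a b x) z0 (u x) (u01 x) J1 J0 => Z Z0 U /andP[U0 U1] J1 J0.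
have Z2 : 0 < 2 * Z * 1 by rewrite mulr1 mulr_gt0.
move: (kmain be s0) kmain0 (krem be s0) krem0 kfin => [k| |]// k0 [r| |]//= r0 _; last first.
  by rewrite gt0_muley ?lte_fin// leye_eq.
rewrite -!EFinD -!EFinM !lee_fin in k0 r0 *.
move=> /andP[a1 a2] /andP[a3 a4]; rewrite ler_norml.
have b1 : U * (2 * Z * k) <= U * J0 by apply: ler_wpM2l => //; lra.
have b2 : U * J0 <= U * (2 * Z * (k + r)) by apply: ler_wpM2l => //; lra.
have b3 : 0 <= 2 * Z * r by apply: mulr_ge0 => //; lra.
have b4 : U * (2 * Z * r) <= 2 * Z * r by rewrite ler_piMl.
apply/andP; split; nra.
Qed.

Lemma krem_small (eta : R) : 0 < eta -> exists2 s1, 1 < s1 &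
  forall s0, 1 < s0 -> s0 <= s1 -> (krem be s0 <= eta%:E)%E.
Proof.
move=> eta0.
pose f (s : R) : R := kfun be s * (4^-1 * (s - s^-1) ^+ 2 / (1 + 4^-1 * (s - s^-1) ^+ 2)).
have mf (D : set R) : measurable_fun D f by exact: measurable_kfrac.
have f0 (s : R) : 1 <= s -> 0 <= f s.
  rewrite le_eqVlt => /predU1P[<-|s1]; last exact: kfrac_ge0.
  by rewrite /f invr1 subrr expr0n/= mulr0 mul0r mulr0.
have fin2 : (\int[mu]_(s in `[1%R, 2%R]) (f s)%:E < +oo)%E.
  rewrite -integral_itv_obnd_cbnd; last exact: measurable_fun_EFin.
  apply: (@le_lt_trans _ _ (\int[mu]_(s in `]1%R, +oo[) (f s)%:E)%E).
    apply: ge0_subset_integral_fin => //.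
    - by move=> s /=; rewrite !in_itv/= andbT => /andP[].
    - by move=> s /=; rewrite in_itv/= andbT => s1; apply: f0; exact: ltW.
  by rewrite kfun_beta// ltry.
have fi : mu.-integrable `[1, 2] (EFin \o f).
  by apply: ge0_integrable => // s /=; rewrite in_itv/= => /andP[s1 _]; exact: f0.
have lt12 : (1 : R) < 2 by lra.
have [d /= d0 H] := @parameterized_integral_near_left R 1 2 eta f lt12 eta0 fi.
exists (1 + Num.min 1 (d / 2)).
  by rewrite ltrDl lt_min; apply/andP; split; lra.
move=> s0 s01 s0s1.
have m1 : Num.min 1 (d / 2) <= 1 by rewrite ge_min lexx.
have m2 : Num.min 1 (d / 2) <= d / 2 by rewrite ge_min lexx orbT.
have bs : ball_ (fun x : R => `|x|) 1 d s0.
  by rewrite /ball_/= ltr0_norm; lra.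
have := H s0 bs (ltW s01); rewrite /parameterized_integral => /ltW h.
rewrite /krem integral_itv_obnd_cbnd; last exact: measurable_fun_EFin.
have fi0 : mu.-integrable `[1, s0] (EFin \o f).
  apply: integrableS fi => //; apply: subset_itvl; rewrite bnd_simp; lra.
rewrite (EFin_Rint _ fi0)// lee_fin (le_trans _ h)//; exact: ler_norm.
Qed.

Lemma powR_near1 (r : R) : 0 < r -> `|r `^ be - 1| <= `|r - 1|.
Proof.
move=> r0; have [r1|r1] := leP 1 r.
  have h1 : 1 <= r `^ be by rewrite -[leLHS](powRr0 r); apply: ler_powR => //; exact: ltW.
  have h2 : r `^ be <= r by apply: ler1_powR => //; exact: ltW.
  by rewrite !ger0_norm; lra.
have h1 : r <= r `^ be by apply: ger1_powR; [rewrite r0 ltW|exact: ltW].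
have h2 : r `^ be <= 1.
  rewrite -[leRHS](powRr0 r); apply: ger_powR; [rewrite r0 ltW//|exact: ltW].
by rewrite !ler0_norm; lra.
Qed.

Lemma pkernelE (a b x w y : R) : a < x < b -> a < w < b -> ext a b y ->
  pk a b w y = pk a b x y *
   (((w - a) * (b - w) / ((x - a) * (b - x))) `^ be * (`|y - x| / `|y - w|)).
Proof.
move=> axb awb yab; case/andP: (axb) => ax xb; case/andP: (awb) => aw wb.
have ab : a < b by lra.
have D0 := ext_gt0 ab yab.
have yx := ext_neq axb yab; have yw := ext_neq awb yab.
have X0 : 0 < (x - a) * (b - x) by apply: mulr_gt0; lra.
have W0 : 0 < (w - a) * (b - w) by apply: mulr_gt0; lra.
rewrite /pkernel (powR_div be (ltW W0) D0) (powR_div be (ltW X0) D0) (powR_div be (ltW W0) X0).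
have n1 : `|y - x| != 0 by rewrite normr_eq0.
have n2 : `|y - w| != 0 by rewrite normr_eq0.
have n3 : ((x - a) * (b - x)) `^ be != 0 by apply/lt0r_neq0/powR_gt0.
have n4 : ((y - a) * (y - b)) `^ be != 0 by apply/lt0r_neq0/powR_gt0.
by move: (((x - a) * (b - x)) `^ be) (((y - a) * (y - b)) `^ be) (((w - a) * (b - w)) `^ be) n3 n4 => p1 p2 p3 n3 n4; field; rewrite n1 n2 n3 n4.
Qed.

(** The bound is relative to the kernel itself, which makes it uniform in the
exit point y. *)
Lemma pkernel_lip (a b x : R) : a < x < b -> exists L d : R, [/\ 0 < L, 0 < d,
  d <= x - a, d <= b - x & forall w y, ext a b y -> `|w - x| < d ->
   `|pk a b w y - pk a b x y| <= L * `|w - x| * pk a b x y].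
Proof.
move=> axb; case/andP: (axb) => ax xb.
pose d : R := Num.min (x - a) (b - x) / 2.
have m0 : 0 < Num.min (x - a) (b - x) by rewrite lt_min; apply/andP; split; lra.
have d0 : 0 < d by rewrite /d; lra.
have dA : 2 * d <= x - a by rewrite /d mulrC divfK// ge_min lexx.
have dB : 2 * d <= b - x by rewrite /d mulrC divfK// ge_min lexx orbT.
have X0 : 0 < (x - a) * (b - x) by apply: mulr_gt0; lra.
exists (2 * (b - a) / ((x - a) * (b - x)) + d^-1), d; split; [|by []|lra|lra|].
  by apply: addr_gt0; [apply: divr_gt0 => //; lra|rewrite invr_gt0].
move=> w y yab wxd.
have awb : a < w < b by move: wxd; rewrite ltr_norml => /andP[]; lra.
have pk0 := pkernel_gt0 be0 be1 axb yab.
have PE (P E : R) : P * E - P = P * (E - 1) by ring.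
rewrite (pkernelE axb awb yab) PE normrM (gtr0_norm pk0) mulrC ler_wpM2r//; first exact: ltW.
have yx2 : 2 * d <= `|y - x|.
  move: yab; rewrite extE; last lra.
  rewrite /= !in_itv/= andbT => -[ya|yb]; [rewrite ltr0_norm|rewrite gtr0_norm]; lra.
have yw1 : `|y - x| - `|w - x| <= `|y - w|.
  have -> : y - x = (y - w) + (w - x) by ring.
  by have := ler_normD (y - w) (w - x); lra.
have yw2 : `|y - w| <= `|y - x| + `|w - x|.
  have -> : y - w = (y - x) - (w - x) by ring.
  by have := ler_normB (y - x) (w - x); lra.
have yw0 : d <= `|y - w| by lra.
have ywp : 0 < `|y - w| by lra.
set r := (w - a) * (b - w) / ((x - a) * (b - x)).
set s := `|y - x| / `|y - w|.
have r0 : 0 < r by apply: divr_gt0 => //; apply: mulr_gt0; case/andP: awb; lra.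
have s0 : 0 <= s by apply: divr_ge0.
have s2 : s <= 2 by rewrite ler_pdivrMr//; lra.
have es : `|s - 1| <= d^-1 * `|w - x|.
  have -> : s - 1 = (`|y - x| - `|y - w|) / `|y - w| by rewrite /s mulrBl divff// lt0r_neq0.
  rewrite normrM normfV (ger0_norm (ltW ywp)) mulrC; apply: ler_pM => //.
    by rewrite lef_pV2 ?posrE.
  by rewrite ler_norml; apply/andP; split; lra.
have er : `|r `^ be - 1| <= (b - a) / ((x - a) * (b - x)) * `|w - x|.
  apply: (le_trans (powR_near1 r0)).
  have -> : r - 1 = (w - x) * (a + b - w - x) / ((x - a) * (b - x)).
    by rewrite /r; field; rewrite !lt0r_neq0//; lra.
  rewrite normrM normfV (ger0_norm (ltW X0)) normrM [leRHS]mulrAC (mulrC (b - a)).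
  apply: ler_wpM2r; first by rewrite invr_ge0 ltW.
  apply: ler_wpM2l => //; rewrite ler_norml; case/andP: awb => *; apply/andP; split; lra.
have -> : r `^ be * s - 1 = (r `^ be - 1) * s + (s - 1) by ring.
apply: (le_trans (ler_normD _ _)); rewrite [leRHS]mulrDl; apply: lerD => //.
rewrite normrM (ger0_norm s0).
have := normr_ge0 (r `^ be - 1); have := normr_ge0 (w - x).
move: er; set q := (b - a) / _; have -> : 2 * (b - a) / ((x - a) * (b - x)) = 2 * q by rewrite /q mulrA.
move=> er w0 r1; apply: (@le_trans _ _ (q * `|w - x| * 2)); last lra.
by apply: ler_pM.
Qed.

Lemma integrableB_fin (D : set R) (f g : R -> R) : measurable D ->
  mu.-integrable D (EFin \o f) -> mu.-integrable D (EFin \o g) ->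
  mu.-integrable D (EFin \o (fun x => f x - g x)).
Proof.
move=> mD fi gi; have := @integrableB _ _ _ mu D mD _ _ fi gi.
by congr (mu.-integrable _ _); apply/funext => x /=; rewrite EFinB.
Qed.

Lemma integrableD_fin (D : set R) (f g : R -> R) : measurable D ->
  mu.-integrable D (EFin \o f) -> mu.-integrable D (EFin \o g) ->
  mu.-integrable D (EFin \o (fun x => f x + g x)).
Proof.
move=> mD fi gi; have := @integrableD _ _ _ mu D mD _ _ fi gi.
by congr (mu.-integrable _ _); apply/funext => x /=; rewrite EFinD.
Qed.

Lemma integrableZ_fin (D : set R) (k : R) (f : R -> R) : measurable D ->
  mu.-integrable D (EFin \o f) -> mu.-integrable D (EFin \o (fun x => k * f x)).
Proof.
move=> mD fi; have := @integrableZl _ _ _ mu D mD k _ fi.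
by congr (mu.-integrable _ _); apply/funext => x /=; rewrite EFinM.
Qed.

Lemma Rint_norm_le (D : set R) (f g : R -> R) : measurable D ->
  mu.-integrable D (EFin \o f) -> mu.-integrable D (EFin \o g) ->
  (forall x, D x -> `|f x| <= g x) ->
  `|\int[mu]_(x in D) f x| <= \int[mu]_(x in D) g x.
Proof.
move=> mD fi gi fg; apply: le_trans; first by apply: le_normr_Rintegral fi => //.
apply: le_Rintegral => //.
have := @integrable_abse _ _ _ mu D _ fi.
by congr (mu.-integrable _ _); apply/funext => x.
Qed.

Lemma pint_lip (a b x : R) (g : R -> R) : a < x < b -> measurable_fun setT g ->
  (forall y, 0 <= g y <= 1) -> exists L d : R, [/\ 0 < L, 0 < d,
  d <= x - a, d <= b - x & forall w, `|w - x| < d ->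
   `|pint be a b g w - pint be a b g x| <= L * `|w - x|].
Proof.
move=> axb mg g01; have [L [d [L0 d0 da db H]]] := pkernel_lip axb.
exists L, d; split => // w wxd.
have awb : a < w < b by move: wxd; rewrite ltr_norml => /andP[]; lra.
have gN y : `|g y| <= 1 by rewrite ger0_norm; case/andP: (g01 y).
have mY := measurable_ext a b.
have iw := integrable_pint be0 be1 awb mg gN.
have ix := integrable_pint be0 be1 axb mg gN.
have i1 := integrable_pkernel be0 be1 axb.
rewrite /pint -RintegralB//.
have mm : measurable_fun setT (fun y => pk a b w y * g y - pk a b x y * g y).
  by apply: measurable_funB; apply: measurable_funM => //; exact: measurable_pkernel.
have ii : mu.-integrable (ext a b) (EFin \o (fun y => pk a b w y * g y - pk a b x y * g y)).
  exact: integrableB_fin.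
have i2 : mu.-integrable (ext a b) (EFin \o (fun y => L * `|w - x| * pk a b x y)).
  exact: integrableZ_fin.
apply: (@le_trans _ _ (\int[mu]_(y in ext a b) (L * `|w - x| * pk a b x y))).
  apply: Rint_norm_le => //.
  move=> y yab; rewrite -mulrBl normrM; apply: le_trans (H w y yab wxd).
  by rewrite ler_piMr.
by rewrite RintegralZl// /Rintegral pkernel_mass//= mulr1.
Qed.

(** This repairs an asymmetric truncation: near x the increments of a Lipschitz
function have a density of order |w - x|^(- 2 be). *)
Lemma incr_gap (p1 p2 x q L : R) (u : R -> R) : p1 <= p2 -> p2 < x -> x < q ->
  measurable_fun setT u -> (forall w, `|u w| <= 1) -> 0 <= L ->
  (forall w, p1 <= w -> w < p2 -> `|u w - u x| <= L * `|w - x|) ->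
  `|incr p2 q u x - incr p1 q u x| <= L * (x - p2) `^ (- (2 * be)) * (p2 - p1).
Proof.
move=> p12 p2x xq mu' uN L0 H.
pose f w := (u w - u x) * jump (w - x).
have i2 : mu.-integrable (ext p2 q) (EFin \o f).
  by apply: (integrable_incr (M := 1)); rewrite ?p2x.
have mI : measurable (`[p1, p2[%classic : set R) by [].
have E : ext p2 q = ext p1 q `|` `[p1, p2[.
  by rewrite !extE; [apply/seteqP; split => w /=; rewrite !in_itv/= ?andbT; lra|lra|lra].
have dis : [disjoint ext p1 q & `[p1, p2[].
  apply/disj_setPS => w; rewrite extE; last lra.
  by rewrite /= !in_itv/= andbT; lra.
have -> : incr p2 q u x = incr p1 q u x + \int[mu]_(w in `[p1, p2[) f w.
  rewrite /incr E Rintegral_setU//; first exact: measurable_ext.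
  by rewrite -E.
rewrite addrC addKr.
have iI : mu.-integrable `[p1, p2[ (EFin \o f).
  by apply: integrableS i2 => //; [exact: measurable_ext|rewrite E; exact: subsetUr].
set K := L * _; have K0 : 0 <= K by rewrite mulr_ge0 ?powR_ge0.
apply: (@le_trans _ _ (\int[mu]_(w in `[p1, p2[) K)).
  apply: Rint_norm_le => //.
    apply: ge0_integrable => //; rewrite (eq_integral (cst K%:E))// integral_cst//= lebesgue_measure_itv/= lte_fin.
    by case: ifP => _; rewrite ?mule0 -?EFinD -?EFinM ltry.
  move=> w /=; rewrite in_itv/= => /andP[pw wp].
  have wx : 0 < `|w - x| by rewrite normr_gt0 subr_eq0; apply/eqP => wx; lra.
  rewrite /f normrM (ger0_norm (jump_ge0 _ _)).
  apply: (@le_trans _ _ (L * `|w - x| * jump (w - x))).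
    by apply: ler_wpM2r; [exact: jump_ge0|exact: H].
  rewrite -mulrA; apply: ler_wpM2l => //.
  have -> : `|w - x| * jump (w - x) = `|w - x| `^ (- (2 * be)).
    rewrite /jump powRD; last by rewrite (lt0r_neq0 wx) implybT.
    by rewrite powRr1 ?(ltW wx)// invfM mulrA divff ?lt0r_neq0// mul1r powRN.
  apply: powRN_le; [|lra|]; first by rewrite mulr_ge0// ltW.
  by rewrite ltr0_norm; lra.
rewrite Rintegral_cst//= lebesgue_measure_itv/= lte_fin.
case: ifPn => [_|h]; first by rewrite -EFinD.
by rewrite mulr0 mulr_ge0// ?subr_ge0// mulr_ge0// powR_ge0.
Qed.

Lemma mob_inv (a b x z s1 : R) : a < x < b -> 1 < s1 -> x < z -> z < mob a b x s1 ->
  exists s0, [/\ 1 < s0, s0 <= s1 & mob a b x s0 = z].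
Proof.
move=> axb s11 xz zs.
have [_ _ _ qb] := mob_bounds axb (ltW s11).
have m1 : mob a b x 1 = x by apply/eqP; rewrite -subr_eq0 mob_subx// expr1n subrr mulr0 mul0r.
have : (`](mob a b x 1), b[%classic : set R) z by rewrite /= in_itv/= m1; lra.
rewrite -mob_image// => -[s0 s01 zE]; rewrite zE in zs *; exists s0; split => //.
rewrite leNgt; apply/negP => s1s0.
have : [set w | exists2 s, s1 < s & w = mob a b x s] (mob a b x s0) by exists s0.
rewrite mob_image//; last lra.
by rewrite /= in_itv/= => /andP[h _]; lra.
Qed.

(** The reciprocals of the half-widths e and e1 of the window ]lmob, mob[ differ
by a constant, so the window is symmetric about x up to second order. *)
Lemma lmob_gap (a b x s0 e : R) : a < x < b -> 1 < s0 -> mob a b x s0 = x + e ->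
  let k := (b - x)^-1 - (x - a)^-1 in
  let e1 := x - lmob a b x s0 in
  e1 - e = k * (e * e1).
Proof.
move=> axb s01 me k e1; case/andP: (axb) => ax xb.
have axb' : - b < - x < - a by lra.
have d1 := mob_den_gt0 s0 axb; have d2 := mob_den_gt0 s0 axb'.
have ss1 : 0 < s0 ^+ 2 - 1 by rewrite subr_gt0 exprn_egt1.
have -> : e = (x - a) * (b - x) * (s0 ^+ 2 - 1) / (b - x + (x - a) * s0 ^+ 2).
  by rewrite -mob_subx// me; ring.
have -> : e1 = (x - a) * (b - x) * (s0 ^+ 2 - 1) / (x - a + (b - x) * s0 ^+ 2).
  have -> : e1 = mob (- b) (- a) (- x) s0 - - x by rewrite /e1 /lmob; ring.
  rewrite mob_subx//; congr (_ / _); ring.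
have d2' : 0 < x - a + (b - x) * s0 ^+ 2 by have := sqr_ge0 s0; nra.
rewrite /k.
have A0 : 0 < x - a by lra.
have B0 : 0 < b - x by lra.
by field; rewrite !lt0r_neq0.
Qed.

(** The truncation to the window ]lmob, mob[ is controlled by
[excised_incr_bound]. Making the window symmetric costs O(e^2 e^(- 2 be)), which
vanishes in the limit since be < 1. *)
Lemma pvharm_pext (a b x : R) (g : R -> R) : a < x < b -> measurable_fun setT g ->
  (forall y, 0 <= g y <= 1) -> pvharm (pext be a b g) x.
Proof.
move=> axb mg g01; case/andP: (axb) => ax xb.
have g0 y : 0 <= g y by case/andP: (g01 y).
have [L [d [L0 d0 da db lip]]] := pint_lip axb mg g01.
set u := pext be a b g.
have mu' : measurable_fun setT u by exact: measurable_pext.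
have u01 w : 0 <= u w <= 1 by exact: pext_itv.
have uN w : `|u w| <= 1 by rewrite ger0_norm; case/andP: (u01 w).
have ulip w : `|w - x| < d -> `|u w - u x| <= L * `|w - x|.
  move=> wx; rewrite /u /pext axb.
  have -> : a < w < b by move: wx; rewrite ltr_norml => /andP[]; lra.
  exact: lip.
have Z0 := zfac_gt0 axb.
set Z := zfac be a b x in Z0.
apply/cvgrPdist_le => /= eta eta0.
have e20 : 0 < eta / 2 / (2 * Z) by apply: divr_gt0; [lra|apply: mulr_gt0].
have [s1 s11 ks] := krem_small e20.
pose k : R := (b - x)^-1 - (x - a)^-1.
pose C : R := L * 2 `^ (2 * be) * (2 * `|k|).
have C0 : 0 <= C by rewrite /C !mulr_ge0 ?powR_ge0// ltW.
have cC : (fun e : R => C * e `^ (2 - 2 * be)) x0 @[x0 --> 0^'+] --> C * 0.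
  by apply: cvgMr; apply: powR_cvg0; have := be1; lra.
have /andP[_ xq1] := mob_bounds_lt axb s11.
near=> e.
have e0 : 0 < e by near: e; exact: nbhs_right_gt.
have ed : e < d / 2 by near: e; apply: nbhs_right_lt; lra.
have es1 : e < mob a b x s1 - x by near: e; apply: nbhs_right_lt; lra.
have ek : e * `|k| <= 2^-1.
  have : e < (2 * (`|k| + 1))^-1.
    by near: e; apply: nbhs_right_lt; rewrite invr_gt0 mulr_gt0// ltr_wpDl.
  rewrite invfM => h; have k1 : 0 < `|k| + 1 by rewrite ltr_wpDl.
  have : e * (`|k| + 1) <= 2^-1 by rewrite -ler_pdivlMr// ltW.
  by apply: le_trans; rewrite ler_wpM2l ?(ltW e0)// lerDl.
have Ce : C * e `^ (2 - 2 * be) <= eta / 2.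
  have : `|C * 0 - C * e `^ (2 - 2 * be)| <= eta / 2.
    by near: e; apply: cvgr_dist_le cC _ _; lra.
  by rewrite mulr0 sub0r normrN ger0_norm// mulr_ge0 ?powR_ge0.
have xe : x < x + e by rewrite ltrDl.
have xes : x + e < mob a b x s1 by rewrite addrC -ltrBrDr.
have [s0 [s01 s0s1 ms0]] := mob_inv axb s11 xe xes.
pose e1 := x - lmob a b x s0.
have gap := lmob_gap axb s01 ms0; rewrite -/e1 -/k /= in gap.
have /andP[px _] := mob_bounds_lt axb s01.
have e10 : 0 < e1 by rewrite subr_gt0.
have h1 : `|e1 - e| <= 2^-1 * e1.
  rewrite gap !normrM (ger0_norm (ltW e0)) (ger0_norm (ltW e10)) mulrA.
  by apply: ler_wpM2r; [exact: ltW|rewrite mulrC].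
have e12 : e1 <= 2 * e by clear -h1; move: h1; rewrite ler_norml => /andP[]; lra.
have e13 : e / 2 <= e1 by clear -h1 e10; move: h1; rewrite ler_norml => /andP[]; lra.
have h2 : `|e1 - e| <= `|k| * (2 * e ^+ 2).
  rewrite gap !normrM (ger0_norm (ltW e0)) (ger0_norm (ltW e10)).
  by apply: ler_wpM2l => //; clear -e12 e0; nra.
have bnd (e' : R) : e / 2 <= e' -> L * e' `^ (- (2 * be)) * `|e1 - e| <= C * e `^ (2 - 2 * be).
  move=> e'e.
  have -> : C * e `^ (2 - 2 * be) = L * (e / 2) `^ (- (2 * be)) * (`|k| * (2 * e ^+ 2)).
    rewrite (powRM _ (ltW e0) (_ : 0 <= 2^-1)) ?invr_ge0// powRV// opprK.
    rewrite powRD ?(lt0r_neq0 e0) ?implybT//.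
    rewrite -(powR_mulrn 2 (ltW e0)) /C; ring.
  apply: ler_pM => //.
    by rewrite mulr_ge0 ?powR_ge0// ltW.
  apply: ler_wpM2l; first exact: ltW.
  by apply: powRN_le; [rewrite mulr_ge0// ltW|clear -e0; lra|].
have main : `|incr (lmob a b x s0) (x + e) u x| <= eta / 2.
  rewrite -ms0; have kf := ks _ s01 s0s1.
  have kfin : (krem be s0 < +oo)%E by apply: (le_lt_trans kf); rewrite ltry.
  apply: (le_trans (excised_incr_bound axb s01 mg g01 kfin)).
  rewrite -/Z mulrC -ler_pdivlMr; last exact: mulr_gt0.
  rewrite -lee_fin fineK// ge0_fin_numE//.
  apply: integral_ge0 => s; rewrite /= in_itv/= lee_fin => /andP[s1' _].
  by apply: kfrac_ge0 => //; lra.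
have lE : lmob a b x s0 = x - e1 by rewrite /e1; ring.
have diff : `|incr (x - e) (x + e) u x - incr (lmob a b x s0) (x + e) u x| <= eta / 2.
  apply: le_trans Ce; rewrite lE; have [ee|ee] := leP e1 e.
    rewrite distrC; apply: le_trans (bnd e1 e13).
    have -> : `|e1 - e| = (x - e1) - (x - e) by clear -ee; rewrite ler0_norm; lra.
    have -> : e1 `^ (- (2 * be)) = (x - (x - e1)) `^ (- (2 * be)) by congr (_ `^ _); ring.
    apply: incr_gap => //; [clear -ee; lra|clear -e10; lra|exact: ltW|].
    by move=> w w1 w2; apply: ulip; clear -w1 w2 ee ed e10; rewrite ltr0_norm; lra.
  have e2 : e / 2 <= e by clear -e0; lra.
  apply: le_trans (bnd e e2).
  have -> : `|e1 - e| = (x - e) - (x - e1) by clear -ee; rewrite gtr0_norm; lra.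
  have -> : e `^ (- (2 * be)) = (x - (x - e)) `^ (- (2 * be)) by congr (_ `^ _); ring.
  apply: incr_gap => //; [clear -ee; lra|clear -e0; lra|exact: ltW|].
  by move=> w w1 w2; apply: ulip; clear -w1 w2 ee ed e0 e12; rewrite ltr0_norm; lra.
rewrite sub0r normrN.
have -> : incr (x - e) (x + e) u x = (incr (x - e) (x + e) u x - incr (lmob a b x s0) (x + e) u x) + incr (lmob a b x s0) (x + e) u x by ring.
by apply: (le_trans (ler_normD _ _)); clear -diff main; lra.
Unshelve. all: by end_near.
Qed.

End harmonicity.

(** * Boundary behaviour and minimum principles *)

Section boundary.
Variable R : realType.
Notation mu := (@lebesgue_measure R).
Variable be : R.
Hypotheses (be0 : 0 < be) (be1 : be < 1).
Notation pk := (pkernel be).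
Notation c := (poisson_cst be).
Notation jump := (jump be).
Notation pint := (pint be).
Notation pext := (pext be).

(** Away from the endpoint e the kernel vanishes like |x - e|^be, uniformly
relative to the kernel at the centre, which is integrable. *)
Lemma pkernel_far (a b e h x y : R) : a < x < b -> ext a b y -> e = a \/ e = b ->
  0 < h -> h <= `|y - e| -> `|x - e| <= h / 2 ->
  pk a b x y <= (`|x - e| / ((b - a) / 4)) `^ be * (1 + 2 * (b - a) / h) * pk a b ((a + b) / 2) y.
Proof.
move=> axb yab eab h0 hy hx; case/andP: (axb) => ax xb.
have ab : a < b by lra.
have amb : a < (a + b) / 2 < b by apply/andP; split; lra.
rewrite (pkernelE be amb axb yab) mulrC.
have pk0 := pkernel_gt0 be0 be1 amb yab.
apply: ler_wpM2r; first exact: ltW.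
have xe0 : 0 < `|x - e| by rewrite normr_gt0 subr_eq0; apply/eqP => xe; case: eab => ee; lra.
have -> : ((a + b) / 2 - a) * (b - (a + b) / 2) = (b - a) * ((b - a) / 4) by field.
have C0 : 0 < (b - a) * ((b - a) / 4) by apply: mulr_gt0; lra.
have X0 : 0 <= (x - a) * (b - x) by apply: mulr_ge0; lra.
have yx : `|y - x| >= h / 2.
  have -> : y - x = (y - e) - (x - e) by ring.
  by have := lerB_normD (y - e) (- (x - e)); rewrite normrN; lra.
have yx0 : 0 < `|y - x| by lra.
apply: ler_pM; rewrite ?powR_ge0// ?divr_ge0//.
  apply: powR_le; [exact: ltW|by rewrite divr_ge0// ltW|].
  rewrite ler_pdivrMr//.
  have -> : `|x - e| / ((b - a) / 4) * ((b - a) * ((b - a) / 4)) = `|x - e| * (b - a).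
    by field; apply: lt0r_neq0; lra.
  case: eab => ->.
    by rewrite gtr0_norm ?subr_gt0// ler_wpM2l; lra.
  by rewrite ltr0_norm ?subr_lt0// opprB mulrC ler_wpM2l; lra.
rewrite ler_pdivrMr//.
have -> : y - (a + b) / 2 = (y - x) + (x - (a + b) / 2) by ring.
apply: (le_trans (ler_normD _ _)); rewrite [leRHS]mulrDl mul1r lerD2l.
apply: (@le_trans _ _ (b - a)).
  by rewrite ler_norml; apply/andP; split; lra.
rewrite [leLHS](_ : b - a = 2 * (b - a) / h * (h / 2)); last by field; exact: lt0r_neq0.
apply: ler_wpM2l => //.
by apply: divr_ge0; [lra|exact: ltW].
Qed.

Lemma powR_small (p eps t : R) : 0 < p -> 0 < eps -> 0 <= t -> t <= eps `^ p^-1 -> t `^ p <= eps.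
Proof.
move=> p0 e0 t0 te; rewrite -[leRHS](powRr1 (ltW e0)) -(mulVf (lt0r_neq0 p0)) powRrM.
by apply: powR_le => //; exact: ltW.
Qed.

Lemma continuous_epsP (g : R -> R) (x : R) : {for x, continuous g} <->
  (forall eta : R, 0 < eta -> exists2 d : R, 0 < d & forall y, `|y - x| < d -> `|g y - g x| <= eta).
Proof.
split=> [cg eta eta0|H].
  have /cvgrPdist_le /(_ _ eta0) [d /= d0 hd] : g y @[y --> x] --> g x by exact: cg.
  by exists d => // y yx; rewrite distrC; apply: hd; rewrite /ball_/= distrC.
apply/cvgrPdist_le => /= eta eta0; have [d d0 hd] := H _ eta0.
by exists d => //= y; rewrite /ball_/= distrC => yx; rewrite distrC; exact: hd.
Qed.

(** As x tends to the endpoint e the mass of the kernel concentrates at e. *)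
Lemma pint_boundary (a b e : R) (g : R -> R) (eta : R) : a < b -> e = a \/ e = b ->
  measurable_fun setT g -> (forall y, 0 <= g y <= 1) ->
  (forall eta : R, 0 < eta -> exists2 d : R, 0 < d & forall y, ext a b y -> `|y - e| < d -> `|g y - g e| <= eta) ->
  0 < eta ->
  exists2 d : R, 0 < d & forall x, a < x < b -> `|x - e| < d -> `|pint a b g x - g e| <= eta.
Proof.
move=> ab eab mg g01 cg eta0.
have e20 : 0 < eta / 2 by lra.
have [h h0 hg] := cg _ e20.
have gN y : `|g y| <= 1 by rewrite ger0_norm; case/andP: (g01 y).
have amb : a < (a + b) / 2 < b by apply/andP; split; lra.
set m := (a + b) / 2 in amb *.
pose C := 1 + 2 * (b - a) / h.
have C0 : 0 < C by rewrite ltr_pwDl// divr_ge0 ?(ltW h0)//; lra.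
have L0 : 0 < (b - a) / 4 by lra.
have eC0 : 0 < eta / 2 / C by apply: divr_gt0.
exists (Num.min (h / 2) ((eta / 2 / C) `^ be^-1 * ((b - a) / 4))).
  by rewrite lt_min; apply/andP; split; [lra|apply: mulr_gt0 => //; exact: powR_gt0].
move=> x axb; rewrite lt_min => /andP[xh xe].
pose K := (`|x - e| / ((b - a) / 4)) `^ be * C.
have K0 : 0 <= K by rewrite mulr_ge0 ?powR_ge0// ltW.
have Ke : K <= eta / 2.
  rewrite -ler_pdivlMr//; apply: powR_small => //; first by rewrite divr_ge0// ltW.
  by rewrite ler_pdivrMr// ltW.
have mY := measurable_ext a b.
have ix := integrable_pkernel be0 be1 axb.
have im := integrable_pkernel be0 be1 amb.
have igx := integrable_pint be0 be1 axb mg gN.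
have ie : mu.-integrable (ext a b) (EFin \o (fun y => g e * pk a b x y)) by exact: integrableZ_fin.
have -> : pint a b g x - g e = \int[mu]_(y in ext a b) (pk a b x y * g y - g e * pk a b x y).
  rewrite RintegralB// RintegralZl// [X in _ = _ - _ * X](_ : _ = 1) ?mulr1//.
  by rewrite /Rintegral pkernel_mass.
have i1 : mu.-integrable (ext a b) (EFin \o (fun y => eta / 2 * pk a b x y)) by exact: integrableZ_fin.
have i2 : mu.-integrable (ext a b) (EFin \o (fun y => K * pk a b m y)) by exact: integrableZ_fin.
apply: (@le_trans _ _ (\int[mu]_(y in ext a b) (eta / 2 * pk a b x y + K * pk a b m y))).
  apply: Rint_norm_le => //; [exact: integrableB_fin|exact: integrableD_fin|].
  move=> y yab; have -> : pk a b x y * g y - g e * pk a b x y = pk a b x y * (g y - g e) by ring.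
  rewrite normrM (ger0_norm (pkernel_ge0 be0 be1 _ _ _ _)).
  have p1 := pkernel_ge0 be0 be1 a b x y; have p2 := pkernel_ge0 be0 be1 a b m y.
  have [ye|ye] := ltP `|y - e| h.
    have ge : `|g y - g e| <= eta / 2 by exact: hg.
    rewrite mulrC ler_wpDr//; first exact: mulr_ge0.
    exact: ler_wpM2r.
  have ge : `|g y - g e| <= 1.
    by rewrite ler_norml; have := g01 y; have := g01 e; clear; lra.
  rewrite ler_wpDl//; first by apply: mulr_ge0 => //; exact: ltW.
  apply: (@le_trans _ _ (pk a b x y)); first by rewrite ler_piMr.
  by apply: pkernel_far => //; exact: ltW.
rewrite RintegralD// !RintegralZl//.
by rewrite /Rintegral !pkernel_mass//= !mulr1; clear -Ke; lra.
Qed.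

(** The limit of pk a b x y / (x - a)^be as x tends to a. *)
Definition flux_kernel (a b y : R) : R := c * ((b - a) / ((y - a) * (y - b))) `^ be / `|y - a|.

Definition flux (a b : R) (f : R -> R) : R := \int[mu]_(y in ext a b) (flux_kernel a b y * f y).

Lemma flux_kernel_ge0 (a b y : R) : 0 <= flux_kernel a b y.
Proof. by rewrite /flux_kernel divr_ge0// mulr_ge0 ?powR_ge0// ltW// poisson_cst_gt0. Qed.

Lemma measurable_flux_kernel (a b : R) : measurable_fun setT (flux_kernel a b).
Proof.
apply: measurable_funM; last first.
  apply: measurable_fun_inv; apply: measurableT_comp => //.
  by apply: measurable_funB => //; exact: measurable_cst.
apply: measurable_funM; first exact: measurable_cst.
apply: (measurableT_comp (measurable_powR be)).
apply: measurable_funM; first exact: measurable_cst.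
apply: measurable_fun_inv.
by apply: measurable_funM; apply: measurable_funB => //; exact: measurable_cst.
Qed.

Lemma pkernel_flux (a b x y : R) : a < x < b -> ext a b y ->
  pk a b x y = (x - a) `^ be * flux_kernel a b y * (((b - x) / (b - a)) `^ be * (`|y - a| / `|y - x|)).
Proof.
move=> axb yab; case/andP: (axb) => ax xb; have ab : a < b by lra.
have D0 := ext_gt0 ab yab; have yx := ext_neq axb yab.
have ya : y - a != 0 by apply/eqP => ya; move: D0; rewrite ya mul0r ltxx.
have ba0 : 0 < b - a by lra.
have xa0 : 0 < x - a by lra.
have bx0 : 0 < b - x by lra.
have W0 : 0 < (x - a) * (b - x) by apply: mulr_gt0.
rewrite /pkernel /flux_kernel (powR_div be (ltW W0) D0) (powR_div be (ltW ba0) D0) (powR_div be (ltW bx0) ba0).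
rewrite (powRM be (ltW xa0) (ltW bx0)).
have n1 : `|y - x| != 0 by rewrite normr_eq0.
have n2 : `|y - a| != 0 by rewrite normr_eq0.
have n3 : (b - a) `^ be != 0 by apply/lt0r_neq0/powR_gt0.
have n4 : ((y - a) * (y - b)) `^ be != 0 by apply/lt0r_neq0/powR_gt0.
by move: ((b - a) `^ be) (((y - a) * (y - b)) `^ be) n3 n4 => p1 p2 n3 n4; field; rewrite n1 n2 n3 n4.
Qed.

Lemma flux_kernel_le_pkernel (a b h y : R) : a < b -> 0 < h -> ext a b y -> h <= `|y - a| ->
  flux_kernel a b y <= (1 + (b - a) / h) / ((b - a) / 4) `^ be * pk a b ((a + b) / 2) y.
Proof.
move=> ab h0 yab hy; have amb : a < (a + b) / 2 < b by apply/andP; split; lra.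
rewrite (pkernel_flux amb yab).
have -> : (a + b) / 2 - a = (b - a) / 2 by field.
have -> : (b - (a + b) / 2) / (b - a) = 2^-1 by field; apply: lt0r_neq0; lra.
have -> : (b - a) / 4 = (b - a) / 2 * 2^-1 by field.
have ba : 0 < (b - a) / 2 by lra.
rewrite (powRM be (ltW ba)); last by lra.
have p1 : 0 < ((b - a) / 2) `^ be by exact: powR_gt0.
have p2 : 0 < (2^-1 : R) `^ be by apply: powR_gt0; lra.
have w0 := flux_kernel_ge0 a b y.
have yx0 : 0 < `|y - (a + b) / 2| by rewrite normr_gt0; exact: ext_neq amb yab.
have ya0 : 0 < `|y - a| by lra.
have key : `|y - (a + b) / 2| <= (1 + (b - a) / h) * `|y - a|.
  have -> : y - (a + b) / 2 = (y - a) + (a - (a + b) / 2) by ring.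
  apply: (le_trans (ler_normD _ _)); rewrite [leRHS]mulrDl mul1r lerD2l.
  rewrite ltr0_norm; last lra.
  apply: (@le_trans _ _ (b - a)); first lra.
  rewrite [leLHS](_ : b - a = (b - a) / h * h); last by field; exact: lt0r_neq0.
  by apply: ler_wpM2l => //; apply: divr_ge0; lra.
set q := 1 + _ in key *; set p := (_ / 2) `^ be in p1 *; set r := 2^-1 `^ be in p2 *.
set A := `|y - _| in yx0 key *; set B := `|y - a| in ya0 key *.
have -> : q / (p * r) * (p * flux_kernel a b y * (r * (B / A))) = flux_kernel a b y * (q * B / A).
  by move: p1 p2 yx0; clear; clearbody p r A q; move=> p1 p2 A0; field; rewrite !lt0r_neq0.
by rewrite ler_peMr// ler_pdivlMr// mul1r.
Qed.

Lemma integrable_flux (a b h : R) (f : R -> R) : a < b -> 0 < h ->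
  measurable_fun setT f -> (forall y, `|f y| <= 1) ->
  (forall y, ext a b y -> `|y - a| < h -> f y = 0) ->
  mu.-integrable (ext a b) (EFin \o (fun y => flux_kernel a b y * f y)).
Proof.
move=> ab h0 mf fN f0.
have amb : a < (a + b) / 2 < b by apply/andP; split; lra.
set N := (1 + (b - a) / h) / ((b - a) / 4) `^ be.
have i1 : mu.-integrable (ext a b) (EFin \o (fun y => N * pk a b ((a + b) / 2) y)).
  by apply: integrableZ_fin; [exact: measurable_ext|exact: integrable_pkernel].
apply: (le_integrable _ _ _ i1).
- exact: measurable_ext.
- apply: measurable_fun_EFin; apply: measurable_funTS; apply: measurable_funM => //; exact: measurable_flux_kernel.
- move=> y yab /=; rewrite lee_fin normrM (ger0_norm (flux_kernel_ge0 _ _ _)).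
  have [ya|ya] := ltP `|y - a| h; first by rewrite f0// normr0 mulr0.
  apply: (@le_trans _ _ (flux_kernel a b y)); first by rewrite ler_piMr// flux_kernel_ge0.
  by apply: (le_trans (flux_kernel_le_pkernel ab h0 yab ya)); exact: ler_norm.
Qed.

(** The quotient of pk a b x y by (x - a)^be * flux_kernel a b y tends to 1 at a
linear rate, uniformly on the support of f. *)
Lemma pint_expansion (a b h x : R) (f : R -> R) : 0 < h -> h <= b - a ->
  measurable_fun setT f -> (forall y, 0 <= f y <= 1) ->
  (forall y, ext a b y -> `|y - a| < h -> f y = 0) -> a < x < b -> x - a <= h / 2 ->
  `|pint a b f x - (x - a) `^ be * flux a b f| <= (2 / (b - a) + 2 / h) * (x - a) * (x - a) `^ be * flux a b f.
Proof.
move=> h0 hab mf f01 f0 axb xh; case/andP: (axb) => ax xb.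
have fN y : `|f y| <= 1 by rewrite ger0_norm; case/andP: (f01 y).
have ab : a < b by lra.
have mY := measurable_ext a b.
have iw := integrable_flux ab h0 mf fN f0.
have ip := integrable_pint be0 be1 axb mf fN.
set C := 2 / (b - a) + 2 / h; set X := (x - a) `^ be.
have X0 : 0 <= X by exact: powR_ge0.
rewrite /pint /flux -!RintegralZl//.
have iX : mu.-integrable (ext a b) (EFin \o (fun y => X * (flux_kernel a b y * f y))) by exact: integrableZ_fin.
rewrite -RintegralB//; apply: Rint_norm_le => //; [exact: integrableB_fin|exact: integrableZ_fin|].
move=> y yab; have [ya|ya] := ltP `|y - a| h; first by rewrite f0// !mulr0 subrr normr0.
have w0 := flux_kernel_ge0 a b y; have /andP[fy0 _] := f01 y.
rewrite (pkernel_flux axb yab) -/X.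
set E := ((b - x) / (b - a)) `^ be * _.
have -> : X * flux_kernel a b y * E * f y - X * (flux_kernel a b y * f y) = X * (flux_kernel a b y * f y) * (E - 1) by ring.
have -> : C * (x - a) * X * (flux_kernel a b y * f y) = X * (flux_kernel a b y * f y) * (C * (x - a)) by ring.
have Q0 : 0 <= X * (flux_kernel a b y * f y) by apply: mulr_ge0 => //; apply: mulr_ge0.
rewrite normrM (ger0_norm Q0); apply: ler_wpM2l => //.
have yx1 : `|y - a| - (x - a) <= `|y - x|.
  have -> : y - x = (y - a) - (x - a) by ring.
  by have := lerB_normD (y - a) (- (x - a)); rewrite normrN (ger0_norm (_ : 0 <= x - a)); lra.
have yx2 : `|y - x| <= `|y - a| + (x - a).
  have -> : y - x = (y - a) - (x - a) by ring.
  by have := ler_normB (y - a) (x - a); rewrite (ger0_norm (_ : 0 <= x - a)); lra.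
have yx0 : h / 2 <= `|y - x| by lra.
have yxp : 0 < `|y - x| by lra.
have r0 : 0 < (b - x) / (b - a) by apply: divr_gt0; lra.
have er : `|((b - x) / (b - a)) `^ be - 1| <= (x - a) / (b - a).
  apply: (le_trans (powR_near1 be0 be1 r0)).
  have -> : (b - x) / (b - a) - 1 = - ((x - a) / (b - a)) by field; apply: lt0r_neq0; lra.
  by rewrite normrN ger0_norm//; apply: divr_ge0; clear -ax ab; lra.
have s0 : 0 <= `|y - a| / `|y - x| by exact: divr_ge0.
have s2 : `|y - a| / `|y - x| <= 2 by rewrite ler_pdivrMr//; lra.
have es : `| (`|y - a| / `|y - x|) - 1| <= 2 / h * (x - a).
  have -> : `|y - a| / `|y - x| - 1 = (`|y - a| - `|y - x|) / `|y - x| by rewrite mulrBl divff// lt0r_neq0.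
  rewrite normrM normfV (ger0_norm (ltW yxp)) mulrC; apply: ler_pM => //.
    rewrite -[leRHS]invf_div lef_pV2 ?posrE//; lra.
  by rewrite ler_norml; apply/andP; split; lra.
rewrite {}/E; move: (((b - x) / (b - a)) `^ be) er (`|y - a| / `|y - x|) s0 s2 es => r er s s0 s2 es.
have -> : r * s - 1 = (r - 1) * s + (s - 1) by ring.
apply: (le_trans (ler_normD _ _)); rewrite [leRHS]mulrDl; apply: lerD => //.
rewrite normrM (ger0_norm s0).
have -> : 2 / (b - a) * (x - a) = (x - a) / (b - a) * 2 by ring.
exact: ler_pM.
Qed.

(** The extension depends on g outside ]a, b[ only, so continuity of g is
assumed along that set; in this form the lemma applies to a fixed point u = pext
a b u. *)
Lemma pext_continuous (a b x : R) (g : R -> R) : a < b ->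
  measurable_fun setT g -> (forall y, 0 <= g y <= 1) ->
  (~~ (a < x < b) -> forall eta : R, 0 < eta -> exists2 d : R, 0 < d &
     forall y, ~~ (a < y < b) -> `|y - x| < d -> `|g y - g x| <= eta) ->
  {for x, continuous (pext a b g)}.
Proof.
move=> ab mg g01 H; apply/continuous_epsP => eta eta0.
have [axb|axb] := boolP (a < x < b).
  have [L [d [L0 d0 da db lip]]] := pint_lip be0 be1 axb mg g01.
  exists (Num.min d (eta / L)); first by rewrite lt_min d0 divr_gt0.
  move=> y; rewrite lt_min => /andP[yd yL].
  have ayb : a < y < b by move: yd; rewrite ltr_norml => /andP[]; clear -da db; lra.
  rewrite /pext axb ayb; apply: (le_trans (lip _ yd)).
  by rewrite mulrC -ler_pdivlMr// ltW.
have [h h0 hg] := H axb _ eta0.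
have extN y : ext a b y -> ~~ (a < y < b).
  move=> yab; apply/negP => ayb; apply: yab; rewrite /= in_itv/=.
  by case/andP: ayb => h1 h2; rewrite !ltW.
have bd e : e = a \/ e = b -> x = e -> exists2 d : R, 0 < d & forall y, `|y - x| < d -> `|pext a b g y - pext a b g x| <= eta.
  move=> eab xe; subst e.
  have [|d d0 hd] := @pint_boundary a b x g eta ab eab mg g01 _ eta0.
    move=> eta' eta'0; have [d d0 hd] := H axb _ eta'0.
    by exists d => // y /extN yab; exact: hd.
  exists (Num.min d h); first by rewrite lt_min d0 h0.
  move=> y; rewrite lt_min => /andP[yd yh]; rewrite /pext (negbTE axb).
  by case: ifPn => ayb; [exact: hd|exact: hg].
have [xa|xa] := eqVneq x a; first by apply: (bd a) => //; left.
have [xb|xb] := eqVneq x b; first by apply: (bd b) => //; right.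
have [d d0 hd] : exists2 d : R, 0 < d & forall y, `|y - x| < d -> ~~ (a < y < b).
  have [lxa|gxa] := ltP x a.
    exists (a - x); first by rewrite subr_gt0.
    by move=> y; rewrite ltr_norml => /andP[_ h1]; apply/negP => /andP[]; clear -h1; lra.
  have gxa' : a < x by rewrite lt_neqAle eq_sym xa.
  have bx : b < x.
    by rewrite lt_neqAle eq_sym xb/= leNgt; apply/negP => xb'; move: axb; rewrite gxa' xb'.
  exists (x - b); first by rewrite subr_gt0.
  by move=> y; rewrite ltr_norml => /andP[h1 _]; apply/negP => /andP[]; clear -h1; lra.
exists (Num.min d h); first by rewrite lt_min d0 h0.
move=> y; rewrite lt_min => /andP[yd yh]; rewrite /pext (negbTE axb).
by rewrite (negbTE (hd _ yd)); apply: hg => //; exact: hd.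
Qed.

Notation incr := (incr be).
Notation pvharm := (pvharm be).

Lemma pvharmP (u : R -> R) (x : R) : pvharm u x <-> forall eta : R, 0 < eta ->
  exists2 d : R, 0 < d & forall e : R, 0 < e -> e < d -> `|incr (x - e) (x + e) u x| <= eta.
Proof.
split=> [H eta eta0|H].
  have /cvgrPdist_le /(_ _ eta0) [d /= d0 hd] := H.
  exists d => // e e0 ed; have := hd e; rewrite /ball_/= sub0r normrN gtr0_norm// => h.
  by have := h ed e0; rewrite sub0r normrN.
apply/cvgrPdist_le => /= eta eta0; have [d d0 hd] := H _ eta0.
exists d => //= e; rewrite /ball_/= sub0r normrN => ed e0.
by rewrite sub0r normrN; apply: hd => //; rewrite -(gtr0_norm e0).
Qed.

Lemma pvharmB (u v : R -> R) (x M : R) :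
  measurable_fun setT u -> measurable_fun setT v ->
  (forall w, `|u w| <= M) -> (forall w, `|v w| <= M) ->
  pvharm u x -> pvharm v x -> pvharm (fun y => u y - v y) x.
Proof.
move=> mu1 mv uM vM /pvharmP hu /pvharmP hv; apply/pvharmP => eta eta0.
have e20 : 0 < eta / 2 by lra.
have [d1 d10 h1] := hu _ e20; have [d2 d20 h2] := hv _ e20.
exists (Num.min d1 d2); first by rewrite lt_min d10 d20.
move=> e e0; rewrite lt_min => /andP[ed1 ed2].
have xe : x - e < x < x + e by rewrite ltrDl e0 ltrBlDr ltrDl e0.
have iu := integrable_incr be0 xe mu1 uM.
have iv := integrable_incr be0 xe mv vM.
have -> : incr (x - e) (x + e) (fun y => u y - v y) x = incr (x - e) (x + e) u x - incr (x - e) (x + e) v x.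
  rewrite /incr -RintegralB//; last exact: measurable_ext.
  by congr (Rintegral _ _ _); apply/funext => y; ring.
by apply: (le_trans (ler_normB _ _)); have := h1 _ e0 ed1; have := h2 _ e0 ed2; clear; lra.
Qed.

(** The density is homogeneous: a truncated integral is multiplied by |s|^(2
be). *)
Lemma pvharm_affine (u : R -> R) (s t x M : R) : s != 0 -> measurable_fun setT u ->
  (forall w, `|u w| <= M) ->
  pvharm u (s * x + t) -> pvharm (fun y => u (s * y + t)) x.
Proof.
move=> s0 mu1 uM /pvharmP hu; apply/pvharmP => eta eta0.
have S0 : 0 < `|s| by rewrite normr_gt0.
have S1 : 0 < `|s| `^ (2 * be) by exact: powR_gt0.
have [d d0 hd] := hu _ (divr_gt0 eta0 S1).
exists (d / `|s|); first exact: divr_gt0.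
move=> e e0 ed.
have se0 : 0 < `|s| * e by exact: mulr_gt0.
have sed : `|s| * e < d by rewrite mulrC -ltr_pdivlMr.
have h := hd _ se0 sed.
suff -> : incr (x - e) (x + e) (fun y => u (s * y + t)) x = incr (s * x + t - `|s| * e) (s * x + t + `|s| * e) u (s * x + t) * `|s| `^ (2 * be).
  by rewrite normrM (gtr0_norm S1) -(ler_pdivlMr _ _ S1).
have dE y : s * y + t - (s * x + t) = s * (y - x) by ring.
rewrite /incr (@Rintegral_affine R s t (ext (s * x + t - `|s| * e) (s * x + t + `|s| * e)) _ s0); last 2 first.
- exact: measurable_ext.
- apply: measurable_funTS; apply: measurable_funM; last exact: measurable_jump_sub.
  by apply: measurable_funB => //; exact: measurable_cst.
have -> : (fun y => s * y + t) @^-1` (ext (s * x + t - `|s| * e) (s * x + t + `|s| * e)) = ext (x - e) (x + e).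
  have E (z r w : R) : ext (z - r) (z + r) w <-> ~~ (`|w - z| <= r).
    rewrite /ext/= in_itv/= ler_norml.
    by split=> [h1|/negP h1]; [apply/negP => /andP[]|move=> /andP[] ? ?; apply: h1; apply/andP; split] => *; try (apply: h1; apply/andP; split); lra.
  apply/seteqP; split=> y /=; rewrite !E.
    by rewrite dE normrM (ler_pM2l S0).
  by rewrite dE normrM (ler_pM2l S0).
rewrite mulrAC; set K := `|s| * _.
have KE : K * `|s| `^ (- (1 + 2 * be)) = 1.
  rewrite /K -{1}(powRr1 (ltW S0)) -!powRD; try by rewrite (lt0r_neq0 S0) implybT.
  by rewrite subrr powRr0.
rewrite [X in _ = K * X](_ : _ = \int[mu]_(y in ext (x - e) (x + e)) (`|s| `^ (- (1 + 2 * be)) * ((u (s * y + t) - u (s * x + t)) * jump (y - x)))); last first.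
  congr (Rintegral _ _ _); apply/funext => y.
  rewrite dE /jump normrM powRM// invfM powRN; ring.
rewrite RintegralZl; last 2 first.
- exact: measurable_ext.
- have xe : x - e < x < x + e by rewrite ltrDl e0 ltrBlDr ltrDl e0.
  apply: (@integrable_incr _ _ be0 x _ _ M (fun y => u (s * y + t))) => //.
  apply: (measurableT_comp mu1); apply: measurable_funD; last exact: measurable_cst.
  by apply: measurable_funM => //; exact: measurable_cst.
by rewrite mulrA KE mul1r.
Qed.

Lemma Rint_subset_le (A B : set R) (f : R -> R) : measurable A -> measurable B -> A `<=` B ->
  mu.-integrable B (EFin \o f) -> (forall y, B y -> ~ A y -> 0 <= f y) ->
  \int[mu]_(y in A) f y <= \int[mu]_(y in B) f y.
Proof.
move=> mA mB AB fi f0; rewrite -[in leRHS](setDUK AB) Rintegral_setU//.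
- by rewrite lerDl; apply: Rintegral_ge0 => y [By nA]; exact: f0.
- exact: measurableD.
- by rewrite setDUK.
- by apply/disj_setPS => y [? []].
Qed.

Lemma integrable_cst_itv (s t k : R) : mu.-integrable `[s, t] (EFin \o (fun=> k)).
Proof.
apply/integrableP; split; first exact/measurable_EFinP/measurable_cst.
rewrite (eq_integral (cst `|k|%:E))// integral_cst//= lebesgue_measure_itv/= lte_fin.
by case: ifP => _; rewrite ?mule0 -?EFinD -?EFinM ltry.
Qed.

Lemma Rint_ge_bump (D : set R) (f : R -> R) (k s t : R) : measurable D ->
  mu.-integrable D (EFin \o f) -> (forall y, D y -> 0 <= f y) -> s <= t ->
  `[s, t] `<=` D -> (forall y, s <= y -> y <= t -> k <= f y) ->
  k * (t - s) <= \int[mu]_(y in D) f y.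
Proof.
move=> mD fi f0 st sD kf.
have mI : measurable (`[s, t]%classic : set R) by [].
apply: (@le_trans _ _ (\int[mu]_(y in `[s, t]) f y)); last first.
  by apply: Rint_subset_le => // y Dy _; exact: f0.
have kI := integrable_cst_itv s t k.
have fI : mu.-integrable `[s, t] (EFin \o f) by apply: integrableS fi.
apply: (@le_trans _ _ (\int[mu]_(y in `[s, t]) k)); last first.
  by apply: le_Rintegral => // y; rewrite /= in_itv/= => /andP[]; exact: kf.
rewrite Rintegral_cst//= lebesgue_measure_itv/= lte_fin.
case: ltP => h; first by rewrite -EFinD.
by have -> : t = s; [lra|rewrite subrr].
Qed.

Lemma continuous_measurableT (u : R -> R) : continuous u -> measurable_fun setT u.
Proof. by move=> cu; apply: continuous_measurable_fun. Qed.

Lemma exists_small (a b : R) : 0 < a -> 0 < b -> exists e : R, [/\ 0 < e, e < a & e < b].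
Proof.
move=> a0 b0; exists (Num.min a b / 2).
have m0 : 0 < Num.min a b by rewrite lt_min a0.
have ma : Num.min a b <= a by rewrite ge_min lexx.
have mb : Num.min a b <= b by rewrite ge_min lexx orbT.
by split; lra.
Qed.

Lemma jump_le_norm (y z : R) : y != 0 -> `|y| <= `|z| -> jump z <= jump y.
Proof.
move=> y0 yz; have ny : 0 < `|y| by rewrite normr_gt0.
rewrite lef_pV2 ?posrE ?powR_gt0//; last exact: lt_le_trans yz.
by apply: powR_le => //; rewrite addr_ge0// mulr_ge0// ltW.
Qed.

Lemma jump_le (y z : R) : 0 < y -> y <= z -> jump z <= jump y.
Proof. by move=> y0 yz; apply: jump_le_norm; [exact: lt0r_neq0|rewrite !gtr0_norm//; lra]. Qed.

(** At a negative minimum all increments are nonnegative, and those towards [q,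
q + 1], where w is nonnegative, keep the truncated integrals above a positive
constant. *)
Lemma min_principle (p q M : R) (w : R -> R) : continuous w -> (forall x, `|w x| <= M) ->
  (forall x, w x < 0 -> p < x < q /\ pvharm w x) -> forall x, 0 <= w x.
Proof.
move=> cw wM H x1; rewrite leNgt; apply/negP => wx1.
have [/andP[px1 x1q] _] := H _ wx1.
have pq : p <= q by lra.
have [x0 _ hx0] : exists2 x0 : R, x0 \in `[p, q] & forall t : R, t \in `[p, q] -> w x0 <= w t.
  by apply: EVT_min => //; exact: continuous_subspaceT.
have wx0 : w x0 < 0 by apply: le_lt_trans wx1; apply: hx0; rewrite in_itv/=; apply/andP; split; lra.
have [/andP[px0 x0q] hp] := H _ wx0.
have wmin y : w x0 <= w y.
  have [wy|wy] := ltP (w y) 0; last by lra.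
  by have [/andP[py yq] _] := H _ wy; apply: hx0; rewrite in_itv/=; apply/andP; split; lra.
have wq y : q <= y -> 0 <= w y.
  by move=> qy; rewrite leNgt; apply/negP => /H[] /andP[_ h _]; lra.
have mw := continuous_measurableT cw.
pose k := - w x0 * jump (q + 1 - x0).
have k0 : 0 < k by apply: mulr_gt0; [lra|apply: jump_gt0; apply: lt0r_neq0; lra].
have k20 : 0 < k / 2 by lra.
have /pvharmP /(_ _ k20) [d d0 hd] := hp.
have qx0 : 0 < q - x0 by lra.
have [e [e0 eq ed]] := exists_small qx0 d0.
have xe : x0 - e < x0 < x0 + e by apply/andP; split; lra.
have ii := integrable_incr be0 xe mw wM.
have : k * ((q + 1) - q) <= incr (x0 - e) (x0 + e) w x0.
  apply: Rint_ge_bump.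
  - exact: measurable_ext.
  - exact: ii.
  - by move=> y _; apply: mulr_ge0; [rewrite subr_ge0|exact: jump_ge0].
  - lra.
  - by move=> y; rewrite extE; [rewrite /= !in_itv/= andbT; lra|lra].
  - move=> y qy yq; apply: ler_pM; [lra|exact: jump_ge0|by have := wq _ qy; lra|].
    by apply: jump_le; lra.
have := hd _ e0 ed; rewrite ler_norml => /andP[_].
by lra.
Qed.

Definition right_ext (m p q : R) : set R := ext p q `\` `]-oo, m]%classic.

Lemma measurable_right_ext (m p q : R) : measurable (right_ext m p q).
Proof. by apply: measurableD; [exact: measurable_ext|exact: measurable_itv]. Qed.

Lemma right_extP (m x e y : R) : 0 < e -> right_ext m (x - e) (x + e) y <-> m < y /\ e < `|y - x|.
Proof.
move=> e0; rewrite /right_ext extE; last lra.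
rewrite /= !in_itv/= andbT ltr_normr; split=> [[h /negP]|[my h]].
  by rewrite -ltNge => my; split => //; apply/orP; case: h => h; [right|left]; lra.
split; last by apply/negP; rewrite -ltNge.
by case/orP: h => h; [right|left]; lra.
Qed.

Lemma integrable_reflected (m x M : R) (w : R -> R) : m < x -> measurable_fun setT w ->
  (forall y, `|w y| <= M) ->
  mu.-integrable `[m, +oo[ (EFin \o (fun z => (- w x - w z) * jump (z - (2 * m - x)))).
Proof.
move=> mx mw wM; have h : 2 * m - x - 1 < 2 * m - x < m - (x - m) / 2.
  by clear -mx; apply/andP; split; lra.
have m1 : measurable_fun setT (fun z => - w x - w z) by apply: measurable_funB => //; exact: measurable_cst.
have b1 z : `|- w x - w z| <= M + M by rewrite (le_trans (ler_normB _ _))// normrN lerD.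
apply: integrableS (integrable_jump_mul be0 h m1 b1) => //; first exact: measurable_ext.
move=> y; rewrite extE; last by clear -mx; lra.
by rewrite /= !in_itv/= !andbT => my; right; clear -my mx; lra.
Qed.

Lemma Rint_split_reflect (m x e : R) (f g : R -> R) : 0 < e -> e < x - m ->
  measurable_fun setT f -> mu.-integrable (ext (x - e) (x + e)) (EFin \o f) ->
  (forall z, f (2 * m - z) = g z) ->
  \int[mu]_(y in ext (x - e) (x + e)) f y =
    \int[mu]_(z in `[m, +oo[) g z + \int[mu]_(y in right_ext m (x - e) (x + e)) f y.
Proof.
move=> e0 exm mf fi fg.
have EE : ext (x - e) (x + e) = `]-oo, m]%classic `|` right_ext m (x - e) (x + e).
  rewrite /right_ext setDUK// => y; rewrite extE /= ?in_itv/=; last lra.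
  by clear -exm; lra.
have -> : \int[mu]_(z in `[m, +oo[) g z = \int[mu]_(y in `]-oo, m]) f y.
  rewrite (@Rintegral_affine R (-1) (2 * m) `]-oo, m]%classic) ?oppr_eq0 ?oner_neq0//; last exact: measurable_funTS.
  rewrite normrN1 mul1r.
  have -> : (fun x : R => -1 * x + 2 * m) @^-1` `]-oo, m]%classic = `[m, +oo[%classic.
    by apply/seteqP; split => y; rewrite /= !in_itv/= ?andbT; clear; lra.
  congr (Rintegral _ _ _); apply/funext => z.
  by rewrite -fg; congr (f _); ring.
rewrite [in LHS]EE; apply: Rintegral_setU.
- exact: measurable_itv.
- exact: measurable_right_ext.
- by rewrite -EE.
- by apply/disj_setPS => y [? []].
Qed.

(** Fold the integral at m. The point z is nearer to x than its mirror image;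
the increments towards both add up to at least - 2 w(x) times the density of the
longer jump. *)
Lemma antisym_incr_ge (m x q e M : R) (w : R -> R) : 0 < e -> e < x - m -> x + e < q ->
  measurable_fun setT w -> (forall y, `|w y| <= M) -> (forall y, w (2 * m - y) = - w y) ->
  (forall y, m <= y -> w x <= w y) -> w x < 0 -> (forall y, `|y - x| <= e -> w y <= 0) ->
  2 * - w x * jump (q + 1 - (2 * m - x)) <= incr (x - e) (x + e) w x.
Proof.
move=> e0 exm xeq mw wM wanti wmin wx0 wneg.
have xe : x - e < x < x + e by apply/andP; split; clear -e0; lra.
have mx : m < x by clear -e0 exm; lra.
have mR := measurable_right_ext m (x - e) (x + e).
have ig := integrable_reflected mx mw wM.
pose f (y : R) : R := (w y - w x) * jump (y - x).
pose g (z : R) : R := (- w x - w z) * jump (z - (2 * m - x)).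
have mf : measurable_fun setT f.
  apply: measurable_funM; last exact: measurable_jump_sub.
  by apply: measurable_funB => //; exact: measurable_cst.
have fi := integrable_incr be0 xe mw wM.
have fg z : f (2 * m - z) = g z.
  rewrite /f /g wanti -jumpN; congr (_ * _); first by ring.
  by congr (jump _); ring.
have -> : incr (x - e) (x + e) w x = \int[mu]_(y in ext (x - e) (x + e)) f y by [].
rewrite (Rint_split_reflect e0 exm mf fi fg).
have sub : right_ext m (x - e) (x + e) `<=` `[m, +oo[.
  by move=> y /(right_extP _ _ _ e0)[my _]; rewrite /= in_itv/= andbT ltW.
have igE : mu.-integrable (right_ext m (x - e) (x + e)) (EFin \o g) by exact: integrableS ig.
have ifE : mu.-integrable (right_ext m (x - e) (x + e)) (EFin \o f).
  apply: integrableS (integrable_incr be0 xe mw wM) => //; first exact: measurable_ext.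
  exact: subDsetl.
have step2 : \int[mu]_(z in right_ext m (x - e) (x + e)) g z <= \int[mu]_(z in `[m, +oo[) g z.
  apply: Rint_subset_le => // y; rewrite /= in_itv/= andbT => my nE.
  apply: mulr_ge0; last exact: jump_ge0.
  have [my'|my'] := eqVneq y m.
    have := wanti m; rewrite my' (_ : 2 * m - m = m); last by ring.
    by clear -wx0; lra.
  rewrite subr_ge0 (@le_trans _ _ 0)//; last by rewrite oppr_ge0 ltW.
  apply: wneg; rewrite leNgt; apply/negP => ey; apply: nE; apply/right_extP => //.
  by split => //; rewrite lt_neqAle eq_sym my'.
apply: (@le_trans _ _ (\int[mu]_(z in right_ext m (x - e) (x + e)) (g z + f z))); last first.
  by rewrite RintegralD// lerD2r.
have gf y : m < y -> e < `|y - x| -> 2 * - w x * jump (y - (2 * m - x)) <= g y + f y.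
  move=> my ye; have yx0 : y - x != 0 by rewrite -normr_gt0; exact: lt_trans ye.
  have jj : jump (y - (2 * m - x)) <= jump (y - x).
    apply: jump_le_norm => //; rewrite [leRHS]ger0_norm; last by clear -mx my; lra.
    by rewrite ler_norml; clear -mx my; apply/andP; split; lra.
  have -> : 2 * - w x * jump (y - (2 * m - x)) = g y + (w y - w x) * jump (y - (2 * m - x)).
    by rewrite /g; ring.
  by rewrite lerD2l /f; apply: ler_wpM2l => //; rewrite subr_ge0 wmin// ltW.
have w20 : 0 <= 2 * - w x by clear -wx0; lra.
rewrite [leLHS](_ : _ = 2 * - w x * jump (q + 1 - (2 * m - x)) * ((q + 1) - q)); last by ring.
apply: Rint_ge_bump => //; [exact: integrableD_fin| |by rewrite lerDl| |].
- move=> y /(right_extP _ _ _ e0)[my ye]; apply: le_trans (gf _ my ye).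
  by apply: mulr_ge0 => //; exact: jump_ge0.
- move=> y; rewrite /= in_itv/= => /andP[qy yq]; apply/right_extP => //.
  by clear -qy mx xeq e0; split; [lra|rewrite ltr_normr; apply/orP; left; lra].
- move=> y qy yq; have qx : x + e < y by exact: lt_le_trans qy.
  apply: (@le_trans _ _ (2 * - w x * jump (y - (2 * m - x)))).
    by apply: ler_wpM2l => //; apply: jump_le; clear -qy yq mx qx e0; lra.
  apply: gf; first by clear -qx mx e0; lra.
  by rewrite ltr_normr; apply/orP; left; clear -qx; lra.
Qed.

(** On the left of m the function may lie far below its minimum on the right;
the increments towards such values are compensated by those towards their mirror
images. *)
Lemma antisym_min_principle (m p q M : R) (w : R -> R) : m <= p ->
  continuous w -> (forall x, `|w x| <= M) -> (forall y, w (2 * m - y) = - w y) ->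
  (forall x, m < x -> w x < 0 -> p < x < q /\ pvharm w x) -> forall x, m <= x -> 0 <= w x.
Proof.
move=> mp cw wM wanti H x1 mx1; rewrite leNgt; apply/negP => wx1.
have wm : w m = 0 by have := wanti m; rewrite (_ : 2 * m - m = m); [clear; lra|ring].
have x1m : m < x1.
  by rewrite lt_neqAle mx1 andbT; apply/eqP => e1; move: wx1; rewrite -e1 wm ltxx.
have [/andP[px1 x1q] _] := H _ x1m wx1.
have pq : p <= q by clear -px1 x1q; lra.
have [x0 x0pq hx0] : exists2 x0 : R, x0 \in `[p, q] & forall t : R, t \in `[p, q] -> w x0 <= w t.
  by apply: EVT_min => //; exact: continuous_subspaceT.
have wx0 : w x0 < 0.
  by apply: le_lt_trans wx1; apply: hx0; rewrite in_itv/=; apply/andP; split; exact: ltW.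
have mx0 : m < x0.
  rewrite lt_neqAle; move: x0pq; rewrite in_itv/= => /andP[px0 _].
  by rewrite (le_trans mp)// andbT; apply/eqP => e1; move: wx0; rewrite -e1 wm ltxx.
have [/andP[px0 x0q] hp] := H _ mx0 wx0.
have wmin y : m <= y -> w x0 <= w y.
  rewrite le_eqVlt => /predU1P[<-|my]; first by rewrite wm ltW.
  have [wy|wy] := ltP (w y) 0; last by apply: le_trans wy; exact: ltW.
  by have [/andP[py yq] _] := H _ my wy; apply: hx0; rewrite in_itv/=; apply/andP; split; exact: ltW.
set k := 2 * - w x0 * jump (q + 1 - (2 * m - x0)).
have k0 : 0 < k.
  apply: mulr_gt0; first by clear -wx0; lra.
  by apply: jump_gt0; apply: lt0r_neq0; clear -mx0 x0q mp px0; lra.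
have k20 : 0 < k / 2 by clear -k0; lra.
have /pvharmP /(_ _ k20) [d d0 hd] := hp.
have N20 : 0 < - w x0 / 2 by clear -wx0; lra.
have /continuous_epsP /(_ _ N20) [d1 d10 hd1] := cw x0.
have qx0 : 0 < q - x0 by clear -x0q; lra.
have mx0' : 0 < x0 - m by clear -mx0; lra.
have [d2 [d20 d2q d2d]] := exists_small qx0 d0.
have [d3 [d30 d3q d3d]] := exists_small mx0' d10.
have [e [e0 ed2 ed3]] := exists_small d20 d30.
have h1 : e < x0 - m by exact: lt_trans d3q.
have h2 : x0 + e < q by clear -ed2 d2q; lra.
have h3 y : `|y - x0| <= e -> w y <= 0.
  move=> ye; have : `|y - x0| < d1 by clear -ye ed3 d3d; lra.
  by move=> /hd1; rewrite ler_norml => /andP[_]; clear -wx0; lra.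
(* w <= 0 on [x0 - e, x0 + e], so the part cut out by the truncation has the right sign *)
have := antisym_incr_ge e0 h1 h2 (continuous_measurableT cw) wM wanti wmin wx0 h3.
have := hd _ e0 (lt_trans ed2 d2d); rewrite ler_norml => /andP[_].
by rewrite -/k; clear -k0; lra.
Qed.

(** Both u - pext a b u and its opposite satisfy the minimum principle. *)
Lemma poisson_representation (a b x : R) (u : R -> R) : a < x < b -> continuous u ->
  (forall y, 0 <= u y <= 1) -> (forall y, a < y < b -> pvharm u y) -> u x = pint a b u x.
Proof.
move=> axb cu u01 hu; have ab : a < b by case/andP: axb => *; lra.
have mu1 := continuous_measurableT cu.
have u0 y : 0 <= u y by case/andP: (u01 y).
have cp : continuous (pext a b u).
  move=> y; apply: pext_continuous => // _ eta eta0.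
  by have /continuous_epsP /(_ _ eta0) [d d0 hd] := cu y; exists d => // z _; exact: hd.
have p01 y : 0 <= pext a b u y <= 1 by exact: pext_itv.
have uN y : `|u y| <= 1 by rewrite ger0_norm; case/andP: (u01 y).
have pN y : `|pext a b u y| <= 1 by rewrite ger0_norm; case/andP: (p01 y).
have mp := continuous_measurableT cp.
have bd (f g : R -> R) y : (forall z, `|f z| <= 1) -> (forall z, `|g z| <= 1) -> `|f y - g y| <= 1 + 1.
  by move=> f1 g1; rewrite (le_trans (ler_normB _ _))// lerD.
have hpe y : a < y < b -> pvharm (pext a b u) y by move=> ayb; exact: pvharm_pext.
have h1 : 0 <= u x - pext a b u x.
  apply: (@min_principle a b (1 + 1) (fun y => u y - pext a b u y)) => [y|y|y].
  - by apply: cvgB; [exact: cu|exact: cp].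
  - exact: bd.
  - move=> h; have ayb : a < y < b.
      by apply: contraLR h; rewrite -leNgt /pext => /negbTE ->; rewrite subrr.
    by split => //; apply: (@pvharmB _ _ _ 1) => //; [exact: hu|exact: hpe].
have h2 : 0 <= pext a b u x - u x.
  apply: (@min_principle a b (1 + 1) (fun y => pext a b u y - u y)) => [y|y|y].
  - by apply: cvgB; [exact: cp|exact: cu].
  - exact: bd.
  - move=> h; have ayb : a < y < b.
      by apply: contraLR h; rewrite -leNgt /pext => /negbTE ->; rewrite subrr.
    by split => //; apply: (@pvharmB _ _ _ 1) => //; [exact: hpe|exact: hu].
by move: h1 h2; rewrite /pext axb; lra.
Qed.

End boundary.

(** * The Dirichlet problem *)

Section dirichlet_problem.
Variable R : realType.
Notation mu := (@lebesgue_measure R).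
Variable be : R.
Hypotheses (be0 : 0 < be) (be1 : be < 1).
Notation pk := (pkernel be).
Notation c := (poisson_cst be).
Notation jump := (jump be).
Notation pint := (pint be).
Notation pext := (pext be).
Notation incr := (incr be).
Notation pvharm := (pvharm be).
Notation flux_kernel := (flux_kernel be).
Notation flux := (flux be).

Lemma cvg_itv01 (s : nat -> R) (t : R) : (forall n, 0 <= s n <= 1) -> s n @[n --> \oo] --> t -> 0 <= t <= 1.
Proof.
move=> s01 st; have c0 : (fun _ : nat => 0 : R) n @[n --> \oo] --> (0 : R) by exact: cvg_cst.
have c1 : (fun _ : nat => 1 : R) n @[n --> \oo] --> (1 : R) by exact: cvg_cst.
apply/andP; split.
  by apply: (ler_cvg_to c0 st); apply: nearW => n; case/andP: (s01 n).
by apply: (ler_cvg_to st c1); apply: nearW => n; case/andP: (s01 n).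
Qed.

Lemma pint_cvg (a b x : R) (f : nat -> R -> R) (g : R -> R) : a < x < b ->
  (forall n, measurable_fun setT (f n)) -> (forall n y, 0 <= f n y <= 1) ->
  (forall y, f n y @[n --> \oo] --> g y) -> pint a b (f n) x @[n --> \oo] --> pint a b g x.
Proof.
move=> axb mf f01 fg.
have mg : measurable_fun setT g by apply: measurable_fun_cvg => // y _; exact: fg.
have fN n y : `|f n y| <= 1 by rewrite ger0_norm; case/andP: (f01 n y).
have mY := measurable_ext a b.
have i1 := integrable_pkernel be0 be1 axb.
have mF (h : R -> R) : measurable_fun setT h -> measurable_fun (ext a b) (fun y => (pk a b x y * h y)%:E).
  by move=> mh; apply: measurable_fun_EFin; apply: measurable_funTS; apply: measurable_funM => //; exact: measurable_pkernel.
have cF y : (fun n => (pk a b x y * f n y)%:E) n @[n --> \oo] --> (pk a b x y * g y)%:E.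
  apply: cvg_EFin; first by apply: nearW.
  exact: cvgMr (fg y).
have bF y n : (`|(pk a b x y * f n y)%:E| <= (pk a b x y)%:E)%E.
  rewrite /= lee_fin normrM (ger0_norm (pkernel_ge0 be0 be1 _ _ _ _)).
  by apply: ler_piMr => //; exact: pkernel_ge0.
have [_ _ H] := @dominated_convergence _ _ R mu (ext a b) mY
  (fun n y => (pk a b x y * f n y)%:E) (fun y => (pk a b x y * g y)%:E) (EFin \o pk a b x)
  (fun n => mF _ (mf n)) (mF _ mg) (aeW mu (fun y _ => cF y)) i1 (aeW mu (fun y n _ => bF y n)).
have gN y : `|g y| <= 1.
  by rewrite ger0_norm; case/andP: (cvg_itv01 (fun n => f01 n y) (fg y)).
move: H; rewrite (pintE be0 be1 axb mg gN) => /fine_cvg.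
by apply: cvg_trans; apply: near_eq_cvg; apply: nearW.
Qed.

(** Evenness lets one Poisson integral on ]1, l[ serve both components of the
complement of [-1, 1]. *)
Definition sweep (l : R) (g : R -> R) (x : R) : R :=
  if `|x| <= 1 then 1 else if l <= `|x| then 0 else pint 1 l g `|x|.

Lemma measurable_sweep (l : R) (g : R -> R) : measurable_fun setT g -> (forall y, 0 <= g y) ->
  measurable_fun setT (sweep l g).
Proof.
move=> mg g0.
have -> : sweep l g = (fun t => if t <= 1 then 1 else if l <= t then 0 else pint 1 l g t) \o (fun x : R => `|x|) by [].
apply: measurableT_comp => //.
apply: measurable_fun_ifT; [exact: measurable_fun_ler|exact: measurable_cst|].
by apply: measurable_fun_ifT; [exact: measurable_fun_ler|exact: measurable_cst|exact: measurable_pint].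
Qed.

Lemma sweep_itv (l x : R) (g : R -> R) : measurable_fun setT g -> (forall y, 0 <= g y <= 1) ->
  0 <= sweep l g x <= 1.
Proof.
move=> mg g01; rewrite /sweep; case: ifPn => h1; first by rewrite ler01 lexx.
case: ifPn => h2; first by rewrite lexx ler01.
by apply: pint_itv => //; rewrite !ltNge h1 h2.
Qed.

Lemma sweep_le (l x : R) (f g : R -> R) : measurable_fun setT f -> measurable_fun setT g ->
  (forall y, 0 <= f y <= 1) -> (forall y, 0 <= g y <= 1) -> (forall y, f y <= g y) ->
  sweep l f x <= sweep l g x.
Proof.
move=> mf mg f01 g01 fg; rewrite /sweep; case: ifPn => // h1; case: ifPn => // h2.
apply: (@pint_le _ _ be0 be1 _ _ _ 1) => //; first by rewrite !ltNge h1 h2.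
  by move=> y; rewrite ger0_norm; case/andP: (f01 y).
by move=> y; rewrite ger0_norm; case/andP: (g01 y).
Qed.

Definition sweeps (l : R) (n : nat) : R -> R := iter n (sweep l) (fun=> 0).

Lemma sweeps_prop (l : R) (n : nat) :
  measurable_fun setT (sweeps l n) /\ (forall y, 0 <= sweeps l n y <= 1).
Proof.
elim: n => [|n [mn n01]]; first by split; [exact: measurable_cst|move=> y; rewrite lexx ler01].
split; last by move=> y; exact: sweep_itv.
by apply: measurable_sweep => // y; case/andP: (n01 y).
Qed.

Lemma sweeps_nondecreasing (l x : R) : {homo (fun n => sweeps l n x) : n m / (n <= m)%N >-> n <= m}.
Proof.
apply/nondecreasing_seqP => n; elim: n x => [|n IH] x.
  by have [_ h] := sweeps_prop l 1; case/andP: (h x).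
by have [m1 h1] := sweeps_prop l n; have [m2 h2] := sweeps_prop l n.+1; exact: sweep_le.
Qed.

Definition potential (l : R) (x : R) : R := limn (fun n => sweeps l n x).

Lemma sweeps_cvg (l x : R) : sweeps l n x @[n --> \oo] --> potential l x.
Proof.
apply: nondecreasing_is_cvgn; first exact: sweeps_nondecreasing.
by exists 1 => _ [n _ <-]; have [_ h] := sweeps_prop l n; case/andP: (h x).
Qed.

Lemma measurable_potential (l : R) : measurable_fun setT (potential l).
Proof.
apply: (measurable_fun_cvg (h := sweeps l)) => [n|x _]; first by have [] := sweeps_prop l n.
exact: sweeps_cvg.
Qed.

Lemma potential_itv (l x : R) : 0 <= potential l x <= 1.
Proof. by apply: (@cvg_itv01 (fun n => sweeps l n x)) (@sweeps_cvg l x) => n; have [_ h] := sweeps_prop l n; exact: h. Qed.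

Lemma potential_fix (l x : R) : potential l x = sweep l (potential l) x.
Proof.
have h : sweeps l n.+1 x @[n --> \oo] --> potential l x.
  by rewrite (cvg_shiftS (fun n => sweeps l n x)); exact: sweeps_cvg.
rewrite -[LHS](cvg_lim (@Rhausdorff R) h); apply: cvg_lim; first exact: Rhausdorff.
have -> : (fun n => sweeps l n.+1 x) = (fun n => sweep l (sweeps l n) x) by [].
rewrite /sweep; case: ifPn => h1; first exact: cvg_cst.
case: ifPn => h2; first exact: cvg_cst.
apply: pint_cvg; first by rewrite !ltNge h1 h2.
- by move=> n; have [] := sweeps_prop l n.
- by move=> n; have [] := sweeps_prop l n.
- by move=> y; exact: sweeps_cvg.
Qed.

Lemma potentialN (l x : R) : potential l (- x) = potential l x.
Proof. by rewrite !(potential_fix l) /sweep normrN. Qed.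

Lemma potential_pext (l x : R) : potential l x = pext 1 l (potential l) x.
Proof.
rewrite /pext; case: ifPn => // /andP[x1 xl].
rewrite potential_fix /sweep ger0_norm; last by lra.
by rewrite leNgt x1/= leNgt xl.
Qed.

Lemma potential_in (l x : R) : -1 <= x -> x <= 1 -> potential l x = 1.
Proof. by move=> x1 x2; rewrite potential_fix /sweep ler_norml x1 x2. Qed.

Lemma potential_out (l x : R) : 1 < l -> l <= `|x| -> potential l x = 0.
Proof.
move=> l1 lx; rewrite potential_fix /sweep lx.
by case: leP => // x1; move: lx; rewrite leNgt (le_lt_trans x1).
Qed.

(** At points x >= 0 continuity follows from the fixed point equation, and
evenness transfers it. *)
Lemma continuous_potential (l : R) : 1 < l -> continuous (potential l).
Proof.
move=> l1.
have pos (x : R) : 0 <= x -> {for x, continuous (potential l)}.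
  move=> x0; have -> : potential l = pext 1 l (potential l) by apply/funext => y; exact: potential_pext.
  apply: pext_continuous => //; [exact: measurable_potential|exact: potential_itv|].
  move=> nx eta eta0.
  have [x1|x1] := leP x 1.
    have l10 : 0 < l - 1 by lra.
    have [e [e0 e1 e2]] := exists_small l10 ltr01.
    exists e => // y ny; rewrite ltr_norml => /andP[h1 h2].
    have y1 : y <= 1.
      by rewrite leNgt; apply/negP => y1; move: ny; rewrite y1/= -leNgt => yl; clear -h2 e1 x1 yl; lra.
    rewrite !potential_in ?subrr ?normr0 ?(ltW eta0)//; first by clear -x0; lra.
    by clear -h1 x0 e2; lra.
  have lx : l <= x by move: nx; rewrite x1/= -leNgt.
  have l10 : 0 < l - 1 by lra.
  exists (l - 1) => // y ny; rewrite ltr_norml => /andP[h1 h2].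
  have y1 : 1 < y by clear -h1 lx; lra.
  have ly : l <= y by move: ny; rewrite y1/= -leNgt.
  by rewrite !potential_out ?subrr ?normr0 ?(ltW eta0)// ger0_norm//; lra.
move=> x; have -> : potential l = potential l \o (fun y : R => `|y|).
  by apply/funext => y /=; case: (ger0P y) => // _; rewrite potentialN.
apply: continuous_comp; first exact: norm_continuous.
by apply: pos.
Qed.

(** The Dirichlet part of the problem with D = ]p, q[ and K = ]a, b[. *)
Record dirichlet (p q a b : R) (u : R -> R) : Prop := Dirichlet {
  dirichlet_pa : p < a;
  dirichlet_ab : a < b;
  dirichlet_bq : b < q;
  dirichlet_cont : continuous u;
  dirichlet_itv : forall x, 0 <= u x <= 1;
  dirichlet_in : forall x, a <= x -> x <= b -> u x = 1;
  dirichlet_out : forall x, x <= p \/ q <= x -> u x = 0;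
  dirichlet_left : forall x, p < x -> x < a -> pvharm u x;
  dirichlet_right : forall x, b < x -> x < q -> pvharm u x }.

Lemma dirichlet_le1 p q a b u y : dirichlet p q a b u -> `|u y| <= 1.
Proof. by move=> S; have /andP[h1 h2] := dirichlet_itv S y; rewrite ger0_norm. Qed.

Lemma dirichlet_meas p q a b u : dirichlet p q a b u -> measurable_fun setT u.
Proof. by move=> S; exact: continuous_measurableT (dirichlet_cont S). Qed.

Lemma dirichlet_harmonic (p q a b : R) u x : dirichlet p q a b u -> p < x < q -> ~~ (a <= x <= b) -> pvharm u x.
Proof.
move=> S /andP[px xq]; rewrite negb_and -!ltNge => /orP[xa|bx].
  exact: dirichlet_left S _ _ _.
exact: dirichlet_right S _ _ _.
Qed.

Lemma pvharmD_cst (u : R -> R) (x k : R) : pvharm u x -> pvharm (fun y => u y + k) x.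
Proof.
move=> /pvharmP hu; apply/pvharmP => eta /hu [d d0 hd]; exists d => // e h1 h2.
rewrite (_ : incr _ _ _ _ = incr (x - e) (x + e) u x); first exact: hd.
by rewrite /incr; congr (Rintegral _ _ _); apply/funext => y; congr (_ * _); ring.
Qed.

(** With eta = 0 this is monotonicity in D and K. A positive eta, which has to
dominate u only outside the domain of v, gives stability under perturbation of
D. *)
Lemma dirichlet_compare (p q a b p' q' a' b' eta : R) (u v : R -> R) :
  dirichlet p q a b u -> dirichlet p' q' a' b' v -> 0 <= eta -> a' <= a -> b <= b' ->
  (forall x, x <= p' \/ q' <= x -> u x <= eta) -> forall x, u x <= v x + eta.
Proof.
move=> Su Sv eta0 aa bb H x; rewrite -subr_ge0.
have mu1 := dirichlet_meas Su; have mv := dirichlet_meas Sv.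
apply: (@min_principle _ _ be0 p q (1 + eta + (1 + eta)) (fun y => v y + eta - u y)).
- move=> y; apply: cvgB; last exact: dirichlet_cont Su y.
  by apply: cvgD; [exact: dirichlet_cont Sv y|exact: cvg_cst].
- move=> y; apply: (le_trans (ler_normB _ _)); have := dirichlet_le1 y Su; have := dirichlet_le1 y Sv.
  by have := ler_normD (v y) eta; rewrite (ger0_norm eta0); move: eta0; clear -u; lra.
move=> y wy.
have /andP[u0 u1] := dirichlet_itv Su y; have /andP[v0 v1] := dirichlet_itv Sv y.
have pyq : p < y < q.
  apply: contraLR wy; rewrite negb_and -!leNgt => /orP h.
  by rewrite (dirichlet_out Su h) subr0 addr_ge0.
have pyq' : p' < y < q'.
  apply: contraLR wy; rewrite negb_and -!leNgt => /orP h.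
  by have := H y h; rewrite (dirichlet_out Sv h) add0r subr_ge0.
have nab' : ~~ (a' <= y <= b').
  apply/negP => /andP[h1 h2]; move: wy; rewrite (dirichlet_in Sv h1 h2); move: eta0 u1; clear -u; lra.
have nab : ~~ (a <= y <= b).
  by apply: contra nab' => /andP[h1 h2]; rewrite (le_trans aa h1) (le_trans h2 bb).
split => //; apply: (@pvharmB _ _ be0 _ _ _ (1 + eta)) => //.
- by apply: measurable_funD => //; exact: measurable_cst.
- move=> z; apply: (le_trans (ler_normD _ _)); rewrite (ger0_norm eta0) lerD2r.
  exact: dirichlet_le1 Sv.
- by move=> z; rewrite (le_trans (dirichlet_le1 z Su))// lerDl.
- by apply: pvharmD_cst; exact: dirichlet_harmonic Sv _ _.
- exact: dirichlet_harmonic Su _ _.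
Qed.

Lemma dirichlet_mono (p q a b p' q' a' b' : R) (u v : R -> R) :
  dirichlet p q a b u -> dirichlet p' q' a' b' v -> p' <= p -> q <= q' -> a' <= a -> b <= b' ->
  forall x, u x <= v x.
Proof.
move=> Su Sv pp qq aa bb x; rewrite -[leRHS]addr0.
apply: (dirichlet_compare Su Sv) => // y [h|h]; rewrite (dirichlet_out Su)//.
  by left; exact: le_trans pp.
by right; exact: le_trans h.
Qed.

Lemma dirichlet_uniq (p q a b : R) (u v : R -> R) : dirichlet p q a b u -> dirichlet p q a b v -> u = v.
Proof.
move=> Su Sv; apply/funext => x; apply/eqP; rewrite eq_le.
by rewrite (dirichlet_mono Su Sv)// (dirichlet_mono Sv Su).
Qed.

Lemma dirichlet_affine (p q a b s t : R) (u : R -> R) : 0 < s -> dirichlet p q a b u ->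
  dirichlet ((p - t) / s) ((q - t) / s) ((a - t) / s) ((b - t) / s) (fun y => u (s * y + t)).
Proof.
move=> s0 S.
have lt1 x y : (x - t) / s < y -> x < s * y + t by rewrite ltr_pdivrMr// => h; rewrite mulrC -ltrBlDr.
have lt2 x y : y < (x - t) / s -> s * y + t < x by rewrite ltr_pdivlMr// => h; rewrite mulrC -ltrBrDr.
have le1 x y : (x - t) / s <= y -> x <= s * y + t by rewrite ler_pdivrMr// => h; rewrite mulrC -lerBlDr.
have le2 x y : y <= (x - t) / s -> s * y + t <= x by rewrite ler_pdivlMr// => h; rewrite mulrC -lerBrDr.
have mono x y : x < y -> (x - t) / s < (y - t) / s by move=> xy; rewrite ltr_pM2r ?invr_gt0// ltrD2r.
have mu1 := dirichlet_meas S; have uN y := dirichlet_le1 y S.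
have s1 := lt0r_neq0 s0.
split.
- exact: mono (dirichlet_pa S).
- exact: mono (dirichlet_ab S).
- exact: mono (dirichlet_bq S).
- move=> x; apply: (@continuous_comp _ _ _ (fun y : R => s * y + t) u); last exact: dirichlet_cont S _.
  by apply: cvgD; [apply: cvgMr; exact: cvg_id|exact: cvg_cst].
- by move=> x; exact: dirichlet_itv S _.
- by move=> x /le1 h1 /le2 h2; exact: dirichlet_in S _ h1 h2.
- by move=> x [/le2 h|/le1 h]; apply: (dirichlet_out S); [left|right].
- by move=> x /lt1 h1 /lt2 h2; apply: (pvharm_affine be0 s1 mu1 uN); exact: dirichlet_left S _ h1 h2.
- by move=> x /lt1 h1 /lt2 h2; apply: (pvharm_affine be0 s1 mu1 uN); exact: dirichlet_right S _ h1 h2.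
Qed.

Lemma dirichlet_opp (p q a b : R) (u : R -> R) : dirichlet p q a b u ->
  dirichlet (- q) (- p) (- b) (- a) (fun y => u (- y)).
Proof.
move=> S; have mu1 := dirichlet_meas S; have uN y := dirichlet_le1 y S.
have n1 : (-1 : R) != 0 by rewrite oppr_eq0 oner_neq0.
have uE : (fun y => u (- y)) = (fun y => u (-1 * y + 0)).
  by apply/funext => y; rewrite mulN1r addr0.
have harm x : pvharm u (- x) -> pvharm (fun y => u (- y)) x.
  by move=> h; rewrite uE; apply: (pvharm_affine be0 n1 mu1 uN); rewrite mulN1r addr0.
split.
- by rewrite ltrN2; exact: dirichlet_bq S.
- by rewrite ltrN2; exact: dirichlet_ab S.
- by rewrite ltrN2; exact: dirichlet_pa S.
- move=> x; apply: (@continuous_comp _ _ _ (fun y : R => - y) u); last exact: dirichlet_cont S _.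
  by apply: cvgN; exact: cvg_id.
- by move=> x; exact: dirichlet_itv S _.
- by move=> x h1 h2; apply: (dirichlet_in S); rewrite 1?lerNr// lerNl.
- by move=> x [h|h]; apply: (dirichlet_out S); [right; rewrite lerNr|left; rewrite lerNl].
- by move=> x h1 h2; apply: harm; apply: (dirichlet_right S); [rewrite ltrNr|rewrite ltrNl].
- by move=> x h1 h2; apply: harm; apply: (dirichlet_left S); [rewrite ltrNr|rewrite ltrNl].
Qed.

Lemma dirichlet_potential (l : R) : 1 < l -> dirichlet (- l) l (-1) 1 (potential l).
Proof.
move=> l1.
have harm x : 1 < x -> x < l -> pvharm (potential l) x.
  move=> x1 xl; have -> : potential l = pext 1 l (potential l) by apply/funext => y; exact: potential_pext.
  by apply: pvharm_pext => //; [rewrite x1|exact: measurable_potential|exact: potential_itv].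
have n1 : (-1 : R) != 0 by rewrite oppr_eq0 oner_neq0.
have pN y : `|potential l y| <= 1 by rewrite ger0_norm; case/andP: (potential_itv l y).
split => //.
- by rewrite ltrN2.
- exact: continuous_potential.
- exact: potential_itv.
- exact: potential_in.
- move=> x lx; apply: potential_out => //; rewrite ler_normr.
  by apply/orP; case: lx => h; [right; rewrite lerNr|left].
- move=> x h1 h2.
  have -> : potential l = (fun y => potential l (-1 * y + 0)).
    by apply/funext => y; rewrite mulN1r addr0 potentialN.
  apply: (pvharm_affine be0 n1 (measurable_potential l) pN); rewrite mulN1r addr0.
  by apply: harm; [rewrite ltrNr|rewrite ltrNl].
Qed.

(** It vanishes on K, so that it has a finite flux there. *)
Definition defect (u : R -> R) (y : R) : R := 1 - u y.

Lemma dirichlet_defect p q a b u : dirichlet p q a b u ->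
  [/\ measurable_fun setT (defect u), continuous (defect u) & forall y, 0 <= defect u y <= 1].
Proof.
move=> S; split.
- by apply: measurable_funB; [exact: measurable_cst|exact: dirichlet_meas S].
- by move=> y; apply: cvgB; [exact: cvg_cst|exact: dirichlet_cont S y].
- by move=> y; have := dirichlet_itv S y; rewrite /defect; clear -S; lra.
Qed.

Lemma dirichlet_repr p q a b u q' x : dirichlet p q a b u -> q' <= q -> b < x < q' -> u x = pint b q' u x.
Proof.
move=> S qq bxq; apply: (poisson_representation be0 be1) => //.
- exact: dirichlet_cont S.
- exact: dirichlet_itv S.
- by move=> y /andP[h1 h2]; apply: (dirichlet_right S) => //; exact: lt_le_trans qq.
Qed.

Lemma dirichlet_repr_defect p q a b u q' x : dirichlet p q a b u -> q' <= q -> b < x < q' ->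
  defect u x = pint b q' (defect u) x.
Proof.
move=> S qq bxq; have [mc _ c01] := dirichlet_defect S.
have uN y := dirichlet_le1 y S.
rewrite /defect (dirichlet_repr S qq bxq) -[in LHS](pint_cst be0 be1 1 bxq) /pint -RintegralB//.
- by congr (Rintegral _ _ _); apply/funext => y; ring.
- exact: measurable_ext.
- by apply: (@integrable_pint _ _ be0 be1 _ _ _ 1 (fun=> 1) bxq) => // y; rewrite normr1.
- exact: (integrable_pint be0 be1 bxq (dirichlet_meas S) uN).
Qed.

Lemma defect_vanish p q a b u q' h y : dirichlet p q a b u -> h <= b - a -> h <= q' - b ->
  ext b q' y -> `|y - b| < h -> defect u y = 0.
Proof.
move=> S ha hq; rewrite /ext/= in_itv/= ltr_norml => ny /andP[h1 h2].
rewrite /defect (dirichlet_in S) ?subrr//; first by clear -h1 ha; lra.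
rewrite leNgt; apply/negP => by'; apply: ny; apply/andP; split; first exact: ltW.
by clear -h2 hq; lra.
Qed.

(** The right end q' of the interval of representation is free; this makes
fluxes of solutions on different domains comparable. *)
Lemma dirichlet_flux p q a b u q' : dirichlet p q a b u -> b < q' -> q' <= q ->
  (u (b + t) - 1) / t `^ be @[t --> 0^'+] --> - flux b q' (defect u).
Proof.
move=> S bq qq; have [mc cc c01] := dirichlet_defect S; have ab := dirichlet_ab S.
have qb0 : 0 < q' - b by lra.
have ab0 : 0 < b - a by lra.
have [h [h0 ha hq]] := exists_small ab0 qb0.
set N := flux b q' (defect u).
set K := (2 / (q' - b) + 2 / h).
have N0 : 0 <= N.
  apply: Rintegral_ge0 => y _; apply: mulr_ge0; first exact: flux_kernel_ge0.
  by case/andP: (c01 y).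
have K0 : 0 <= K by apply: addr_ge0; apply: divr_ge0 => //; exact: ltW.
apply/cvgrPdist_le => /= eta eta0.
have D0 : 0 < eta / (K * N + 1) by apply: divr_gt0 => //; rewrite ltr_wpDl// mulr_ge0.
near=> t.
have t0 : 0 < t by near: t; exact: nbhs_right_gt.
have th : t < h / 2 by near: t; apply: nbhs_right_lt; lra.
have tD : t < eta / (K * N + 1) by near: t; apply: nbhs_right_lt.
have bxq : b < b + t < q' by clear -t0 th hq h0; apply/andP; split; lra.
have xh : b + t - b <= h / 2 by clear -th; lra.
have := pint_expansion be0 be1 h0 (ltW hq) mc c01
  (fun y => @defect_vanish _ _ _ _ _ _ _ y S (ltW ha) (ltW hq)) bxq xh.
rewrite -(dirichlet_repr_defect S qq bxq) -/N -/K (_ : b + t - b = t); last by ring.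
have T0 : 0 < t `^ be by exact: powR_gt0.
move=> H; have -> : - N - (u (b + t) - 1) / t `^ be = (defect u (b + t) - t `^ be * N) / t `^ be.
  by rewrite /defect; field; exact: lt0r_neq0.
rewrite normrM normfV (gtr0_norm T0) ler_pdivrMr//; apply: (le_trans H).
have -> : K * t * t `^ be * N = t * (K * N) * t `^ be by ring.
apply: ler_wpM2r; first exact: ltW.
apply: (@le_trans _ _ (t * (K * N + 1))); first by rewrite ler_wpM2l ?(ltW t0)// lerDl.
by rewrite -ler_pdivlMr; [exact: ltW|rewrite ltr_wpDl// mulr_ge0].
Unshelve. all: by end_near.
Qed.

End dirichlet_problem.

(** * The normal derivative as a function of the size of D *)

Section extremal_speed.
Variable R : realType.
Notation mu := (@lebesgue_measure R).
Variable be : R.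
Hypotheses (be0 : 0 < be) (be1 : be < 1).
Notation pk := (pkernel be).
Notation c := (poisson_cst be).
Notation jump := (jump be).
Notation pint := (pint be).
Notation pext := (pext be).
Notation incr := (incr be).
Notation pvharm := (pvharm be).
Notation flux_kernel := (flux_kernel be).
Notation flux := (flux be).
Notation potential := (potential be).
Notation dirichlet := (dirichlet be).

Definition speed (l : R) : R := flux 1 l (defect (potential l)).

Lemma speed_flux (l l0 : R) : 1 < l0 -> l0 <= l -> speed l = flux 1 l0 (defect (potential l)).
Proof.
move=> l01 l0l; have l1 : 1 < l by exact: lt_le_trans l0l.
have S := dirichlet_potential be0 be1 l1.
have h1 := dirichlet_flux be0 be1 S l1 (lexx l).
have h2 := dirichlet_flux be0 be1 S l01 l0l.
apply: oppr_inj; rewrite -/(speed l) in h1.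
exact: etrans (esym (cvg_lim (@Rhausdorff R) h1)) (cvg_lim (@Rhausdorff R) h2).
Qed.

(** Every defect vanishes near the end of K, where flux_kernel is not
integrable. *)
Definition cutoff (a h y : R) : R := if `|y - a| < h then 0 else 1.

Lemma measurable_cutoff (a h : R) : measurable_fun setT (cutoff a h).
Proof.
apply: measurable_fun_ifT; [|exact: measurable_cst|exact: measurable_cst].
apply: measurable_fun_ltr; last exact: measurable_cst.
by apply: measurableT_comp => //; apply: measurable_funB => //; exact: measurable_cst.
Qed.

Lemma flux_diff_le (a b h eta : R) (f g : R -> R) : a < b -> 0 < h ->
  measurable_fun setT f -> measurable_fun setT g ->
  (forall y, `|f y| <= 1) -> (forall y, `|g y| <= 1) ->
  (forall y, ext a b y -> `|y - a| < h -> f y = 0) ->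
  (forall y, ext a b y -> `|y - a| < h -> g y = 0) ->
  (forall y, `|f y - g y| <= eta) ->
  `|flux a b f - flux a b g| <= eta * flux a b (cutoff a h).
Proof.
move=> ab h0 mf mg f1 g1 f0 g0 fg.
have mY := measurable_ext a b.
have if_ := integrable_flux be0 be1 ab h0 mf f1 f0.
have ig := integrable_flux be0 be1 ab h0 mg g1 g0.
have ia : mu.-integrable (ext a b) (EFin \o (fun y => flux_kernel a b y * cutoff a h y)).
  apply: (integrable_flux be0 be1 ab h0 (measurable_cutoff a h)).
    by move=> y; rewrite /cutoff; case: ifP; rewrite ?normr0 ?normr1.
  by move=> y _; rewrite /cutoff => ->.
rewrite /flux -RintegralB// -RintegralZl//.
apply: Rint_norm_le => //; [exact: integrableB_fin|exact: integrableZ_fin|].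
move=> y yab; rewrite -mulrBr normrM (ger0_norm (flux_kernel_ge0 be0 be1 _ _ _)).
rewrite [leRHS]mulrCA; apply: ler_wpM2l; first exact: flux_kernel_ge0.
rewrite /cutoff; case: ifPn => ya; last by rewrite mulr1; exact: fg.
by rewrite f0// g0// subrr normr0 mulr0.
Qed.

Lemma flux_cutoff_ge0 (a b h : R) : 0 <= flux a b (cutoff a h).
Proof.
apply: Rintegral_ge0 => y _; apply: mulr_ge0; first exact: flux_kernel_ge0.
by rewrite /cutoff; case: ifP.
Qed.

Lemma potential_tail (l eta : R) : 1 < l -> 0 < eta -> exists d : R, [/\ 0 < d, d < l &
  forall y, l - d < `|y| -> potential l y <= eta].
Proof.
move=> l1 eta0; have l0 : 0 < l by lra.
have cl : {for l, continuous (potential l)} by exact: continuous_potential.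
have /continuous_epsP /(_ _ eta0) [d1 d10 hd] := cl.
have pl y : l <= `|y| -> potential l y = 0 by move=> ?; exact: potential_out.
have [d [d0 d1' d2]] := exists_small d10 l0.
exists d; split => // y yd; have [ly|ly] := leP l `|y|; first by rewrite pl// ltW.
have -> : potential l y = potential l `|y|.
  by case: (ger0P y) => // _; rewrite potentialN.
have : `| `|y| - l| < d1 by rewrite ltr0_norm; clear -yd ly d1'; lra.
move=> /hd; rewrite (pl l) ?subr0; last by rewrite gtr0_norm.
by apply: le_trans; exact: ler_norm.
Qed.

Lemma norm_sub_le (A B eta : R) : A <= B -> B <= A + eta -> `|B - A| <= eta.
Proof. by move=> AB BA; rewrite ger0_norm ?subr_ge0// lerBlDl. Qed.

(** Enlarging D raises the potential by at most its values near the end of D.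
These are small for the larger domain too, by comparison with a dilation of the
smaller one. *)
Lemma potential_close (l eta : R) : 1 < l -> 0 < eta -> exists d : R, [/\ 0 < d, d < l - 1 &
  forall l', `|l' - l| < d -> forall x, `|potential l' x - potential l x| <= eta].
Proof.
move=> l1 eta0; have l10 : 0 < l - 1 by lra.
have [d1 [d10 d1l hd]] := potential_tail l1 eta0.
have [d [d0 dd1 dl1]] := exists_small d10 l10.
exists d; split => // l'; rewrite ltr_norml => /andP[h1 h2] x.
have l'1 : 1 < l' by clear -h1 dl1; lra.
have S := dirichlet_potential be0 be1 l1; have S' := dirichlet_potential be0 be1 l'1.
have [ll|ll] := leP l' l.
  have m1 : potential l' x <= potential l x.
    by apply: (dirichlet_mono be0 S' S) => //; rewrite ?lerN2//.
  have m2 : potential l x <= potential l' x + eta.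
    apply: (dirichlet_compare be0 S S') => //; first exact: ltW.
    move=> y ly; apply: hd; apply: (@lt_le_trans _ _ l'); first by clear -h1 dd1; lra.
    by rewrite ler_normr; apply/orP; case: ly => ly; [right; rewrite lerNr|left].
  by rewrite distrC; exact: norm_sub_le.
have m1 : potential l x <= potential l' x.
  by apply: (dirichlet_mono be0 S S') => //; rewrite ?lerN2// ltW.
have l0 : 0 < l by clear -l1; lra.
have l'0 : 0 < l' by clear -l'1; lra.
have s0 : 0 < l / l' by exact: divr_gt0.
have s1 : l / l' < 1 by rewrite ltr_pdivrMr// mul1r.
have Sa := dirichlet_affine be0 0 s0 S; rewrite !subr0 in Sa.
have e1 : l / (l / l') = l' by field; rewrite !lt0r_neq0.
have m3 y : potential l' y <= potential l (l / l' * y + 0).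
  apply: (dirichlet_mono be0 S' Sa).
  - by rewrite mulNr e1.
  - by rewrite e1.
  - by rewrite mulNr lerN2 ler_pdivlMr// mul1r ltW.
  - by rewrite ler_pdivlMr// mul1r ltW.
have m2 : potential l' x <= potential l x + eta.
  apply: (dirichlet_compare be0 S' S) => //; first exact: ltW.
  move=> y ly; apply: (le_trans (m3 y)); apply: hd.
  rewrite addr0 normrM (gtr0_norm s0).
  have ly' : l <= `|y| by rewrite ler_normr; apply/orP; case: ly => ly; [right; rewrite lerNr|left].
  apply: (@lt_le_trans _ _ (l / l' * l)); last by rewrite ler_pM2l.
  have -> : l / l' * l = l * l / l' by ring.
  rewrite ltr_pdivlMr//; move: h1 h2 ll dd1 d1l l0; clear -l'0 => *; nra.
exact: norm_sub_le.
Qed.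

Lemma defectB (u v : R -> R) (z : R) : defect u z - defect v z = v z - u z.
Proof. by rewrite /defect; ring. Qed.

(** All lengths near l are compared on one interval of representation ]1, l0[
with l0 < l. *)
Lemma continuous_speed (l : R) : 1 < l -> {for l, continuous speed}.
Proof.
move=> l1; apply/continuous_epsP => eta eta0.
pose l0 := (1 + l) / 2.
have l01 : 1 < l0 by rewrite /l0; lra.
have l0l : l0 < l by rewrite /l0; lra.
have l010 : 0 < l0 - 1 by lra.
have [h [h0 ha hq]] := exists_small (ltr0Sn R 1) l010.
pose N : R := flux 1 l0 (cutoff 1 h).
have N0 : 0 <= N by exact: flux_cutoff_ge0.
have D0 : 0 < eta / (N + 1) by rewrite divr_gt0// ltr_wpDl.
have [d [d0 dl hd]] := potential_close l1 D0.
have l0l0 : 0 < l - l0 by lra.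
have [e [e0 ed el]] := exists_small d0 l0l0.
exists e => // y; rewrite ltr_norml => /andP[h1 h2].
have l0y : l0 < y by clear -h1 el; lra.
have y1 : 1 < y by exact: lt_trans l0y.
have S := dirichlet_potential be0 be1 l1; have Sy := dirichlet_potential be0 be1 y1.
have yd : `|y - l| < d by rewrite ltr_norml; clear -h1 h2 ed; apply/andP; split; lra.
rewrite (speed_flux l01 (ltW l0y)) (speed_flux l01 (ltW l0l)).
have [m1 _ c1] := dirichlet_defect S; have [m2 _ c2] := dirichlet_defect Sy.
have ha' : h <= 1 - -1 by rewrite opprK; exact: ltW.
have hq' := ltW hq.
apply: (@le_trans _ _ (eta / (N + 1) * N)).
  apply: (flux_diff_le l01 h0 m2 m1).
  - by move=> z; rewrite ger0_norm; case/andP: (c2 z).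
  - by move=> z; rewrite ger0_norm; case/andP: (c1 z).
  - by move=> z; exact: (defect_vanish Sy ha' hq').
  - by move=> z; exact: (defect_vanish S ha' hq').
  - by move=> z; rewrite defectB distrC; exact: hd.
rewrite mulrAC ler_pdivrMr; last by rewrite ltr_wpDl.
by apply: ler_wpM2l; [exact: ltW|rewrite lerDl].
Qed.

(** The modulus of the normal derivative after rescaling D to half-width 1. *)
Definition scaled_speed (l : R) : R := l `^ be * speed l.

Lemma continuous_scaled_speed (l : R) : 1 < l -> {for l, continuous scaled_speed}.
Proof.
move=> l1; apply: cvgM; last exact: continuous_speed.
by apply: continuous_powR; lra.
Qed.

Lemma flux_integrand_ge0 (l y : R) : 0 <= flux_kernel 1 l y * defect (potential l) y.
Proof.
apply: mulr_ge0; first exact: flux_kernel_ge0.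
by rewrite /defect subr_ge0; case/andP: (potential_itv be0 be1 l y).
Qed.

Lemma integrable_flux_integrand (l : R) : 1 < l ->
  mu.-integrable (ext 1 l) (EFin \o (fun y => flux_kernel 1 l y * defect (potential l) y)).
Proof.
move=> l1; have l10 : 0 < l - 1 by lra.
have [h [h0 ha hq]] := exists_small (ltr0Sn R 1) l10.
have S := dirichlet_potential be0 be1 l1.
have [m1 _ c1] := dirichlet_defect S.
have ha' : h <= 1 - -1 by rewrite opprK; exact: ltW.
apply: (integrable_flux be0 be1 l1 h0 m1).
  by move=> z; rewrite ger0_norm; case/andP: (c1 z).
by move=> z; exact: (defect_vanish S ha' (ltW hq)).
Qed.

Lemma defect_potential_out (l y : R) : 1 < l -> l <= `|y| -> defect (potential l) y = 1.
Proof. by move=> l1 ly; rewrite /defect (potential_out be0 be1 l1 ly) subr0. Qed.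

(** A part of the exterior of size comparable to l - 1, where kernels are easily
bounded below. *)
Lemma exterior_window (l y : R) : 1 < l -> (3 * l - 1) / 2 <= y -> y <= 2 * l - 1 ->
  [/\ ext 1 l y, l <= `|y|, 0 < (y - 1) * (y - l) & (y - 1) * (y - l) <= 2 * (l - 1) * (l - 1)].
Proof.
move=> l1 h1 h2; split.
- by rewrite extE; [right; rewrite /= in_itv/= andbT; lra|lra].
- by rewrite ler_normr; apply/orP; left; lra.
- by apply: mulr_gt0; lra.
- by apply: ler_pM; lra.
Qed.

Lemma cst_gt0 : 0 < c. Proof. exact: poisson_cst_gt0. Qed.

(** Beyond l the defect is 1, and this alone contributes an amount of order (l -
1)^(- be). *)
Lemma speed_ge_near (l : R) : 1 < l -> c / 4 * (2 * (l - 1)) `^ (- be) <= speed l.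
Proof.
move=> l1; have l10 : 0 < l - 1 by lra.
have P0 : 0 < 2 * (l - 1) by lra.
have -> : c / 4 * (2 * (l - 1)) `^ (- be) =
    c * (2 * (l - 1)) `^ (- be) / (2 * (l - 1)) * (2 * l - 1 - (3 * l - 1) / 2).
  by field; exact: lt0r_neq0.
apply: Rint_ge_bump.
- exact: measurable_ext.
- exact: integrable_flux_integrand.
- by move=> y _; exact: flux_integrand_ge0.
- lra.
- by move=> y; rewrite /= in_itv/= => /andP[h1 h2]; have [] := exterior_window l1 h1 h2.
move=> y h1 h2; have [_ h3 h4 h5] := exterior_window l1 h1 h2.
rewrite defect_potential_out// mulr1 /flux_kernel; apply: ler_pM.
- by apply: mulr_ge0; [exact: ltW cst_gt0|exact: powR_ge0].
- by rewrite invr_ge0; exact: ltW.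
- apply: ler_wpM2l; first exact: ltW cst_gt0.
  rewrite -powRV//; apply: powR_le; [exact: ltW|by rewrite invr_ge0 ltW|].
  rewrite ler_pdivlMr// ler_pdivrMl//.
- rewrite gtr0_norm; last by lra.
  by rewrite lef_pV2 ?posrE; lra.
Qed.

(** Exits from ]1, l[ through the window of [exterior_window]. *)
Lemma defect_ge (l x : R) : 1 < l -> 1 < x -> x <= (l + 1) / 2 ->
  c / 4 * ((x - 1) / (4 * (l - 1))) `^ be <= defect (potential l) x.
Proof.
move=> l1 x1 xl; have l10 : 0 < l - 1 by lra.
have P0 : 0 < 2 * (l - 1) by lra.
have S := dirichlet_potential be0 be1 l1.
have x1l : 1 < x < l by apply/andP; split; lra.
rewrite (dirichlet_repr_defect be0 be1 S (lexx l) x1l).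
have [m1 _ c1] := dirichlet_defect S.
have cN y : `|defect (potential l) y| <= 1 by rewrite ger0_norm; case/andP: (c1 y).
have -> : c / 4 * ((x - 1) / (4 * (l - 1))) `^ be =
    c * ((x - 1) / (4 * (l - 1))) `^ be / (2 * (l - 1)) * (2 * l - 1 - (3 * l - 1) / 2).
  by field; exact: lt0r_neq0.
apply: Rint_ge_bump.
- exact: measurable_ext.
- exact: (integrable_pint be0 be1 x1l m1 cN).
- move=> y _; apply: mulr_ge0; [exact: pkernel_ge0|by case/andP: (c1 y)].
- lra.
- by move=> y; rewrite /= in_itv/= => /andP[h1 h2]; have [] := exterior_window l1 h1 h2.
move=> y h1 h2; have [_ h3 h4 h5] := exterior_window l1 h1 h2.
rewrite defect_potential_out// mulr1 /pkernel; apply: ler_pM.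
- by apply: mulr_ge0; [exact: ltW cst_gt0|exact: powR_ge0].
- by rewrite invr_ge0; exact: ltW.
- apply: ler_wpM2l; first exact: ltW cst_gt0.
  apply: powR_le; [exact: ltW|by apply: divr_ge0; lra|].
  rewrite ler_pdivlMr//.
  apply: (@le_trans _ _ ((x - 1) / (4 * (l - 1)) * (2 * (l - 1) * (l - 1)))).
    by apply: ler_wpM2l => //; apply: divr_ge0; lra.
  have -> : (x - 1) / (4 * (l - 1)) * (2 * (l - 1) * (l - 1)) = (x - 1) * ((l - 1) / 2).
    by field; exact: lt0r_neq0.
  by apply: ler_wpM2l; lra.
- rewrite gtr0_norm; last by lra.
  by rewrite lef_pV2 ?posrE; lra.
Qed.

Lemma Rint_inv (t : R) : 2 < t -> \int[mu]_(y in `[- t, -2]) (1 - y)^-1 = ln (1 + t) - ln 3.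
Proof.
move=> t2; pose F (y : R) : R := - ln (1 - y).
have dF (y : R) : y < 1 -> is_derive y 1 F (1 - y)^-1.
  move=> y1; have y0 : 0 < 1 - y by lra.
  have d1 : is_derive y 1 (fun z : R => 1 - z) (-1).
    by have := is_deriveB (is_derive_cst (1 : R) y (1 : R)) (is_derive_id y (1 : R)); rewrite sub0r.
  have d2 := @is_derive1_comp R (@ln R) (fun z : R => 1 - z) y _ _ (is_derive1_ln y0) d1.
  have d3 := is_deriveN d2.
  by apply: (is_derive_eq d3); rewrite mulrN1 opprK.
have cF (y : R) : y < 1 -> {for y, continuous F}.
  by move=> y1; apply/differentiable_continuous/derivable1_diffP; case: (dF y y1).
have H := @continuous_FTC2 R (fun y => (1 - y)^-1) F (- t) (-2) _ _ _ _.
rewrite /Rintegral H; last 4 first.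
- lra.
- apply: continuous_in_subspaceT => y; rewrite inE/= in_itv/= => /andP[_ y2].
  by apply: cvgV; [apply: lt0r_neq0; lra|apply: cvgB; [exact: cvg_cst|exact: cvg_id]].
- split.
  + move=> y; rewrite in_itv/= => /andP[_ y2].
    have y1 : y < 1 by lra.
    by case: (dF y y1).
  + by apply: cvg_at_right_filter; apply: cF; lra.
  + by apply: cvg_at_left_filter; apply: cF; lra.
- move=> y; rewrite in_itv/= => /andP[_ y2].
  have y1 : y < 1 by lra.
  by rewrite derive1E; apply: derive_val; exact: dF.
rewrite /F -EFinB /= !opprK.
have -> : 1 + 2 = 3 :> R by ring.
by rewrite addrC.
Qed.

(** By evenness [defect_ge] applies on the far side of K as well: for - (l + 1)
/ 2 <= y <= -2 the flux integrand is at least of order l^(- be) / (1 - y), and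
the integral of 1 / (1 - y) is a logarithm. *)
Lemma scaled_speed_ge_far (l : R) : 4 < l ->
  c ^+ 2 / 4 * (24^-1) `^ be * (ln (1 + (l + 1) / 2) - ln 3) <= scaled_speed l.
Proof.
move=> l4; have l1 : 1 < l by lra.
set K := c ^+ 2 / 4 * (24^-1) `^ be.
have K0 : 0 <= K by apply: mulr_ge0; [apply: divr_ge0 => //; exact: sqr_ge0|exact: powR_ge0].
set t := (l + 1) / 2; have t2 : 2 < t by rewrite /t; lra.
have l0 : 0 < l by lra.
have L0 : 0 < l `^ be by exact: powR_gt0.
rewrite -Rint_inv// /scaled_speed [leRHS]mulrC -ler_pdivrMr//.
have mI : measurable (`[- t, -2]%classic : set R) by [].
have sub : `[- t, -2]%classic `<=` ext 1 l.
  by move=> y /=; rewrite in_itv/= extE; [move=> /andP[_ h]; left; rewrite /= in_itv/=; lra|lra].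
have iw := integrable_flux_integrand l1.
have mY := measurable_ext 1 l.
have iI : mu.-integrable `[- t, -2] (EFin \o (fun y => flux_kernel 1 l y * defect (potential l) y)).
  exact: integrableS iw.
apply: (@le_trans _ _ (\int[mu]_(y in `[- t, -2]) (flux_kernel 1 l y * defect (potential l) y))); last first.
  by apply: Rint_subset_le => // y _ _; exact: flux_integrand_ge0.
have S := dirichlet_potential be0 be1 l1.
have cI : mu.-integrable `[- t, -2] (EFin \o (fun y => (1 - y)^-1)).
  apply: continuous_compact_integrable; first exact: segment_compact.
  apply: continuous_in_subspaceT => y; rewrite inE/= in_itv/= => /andP[_ y2].
  by apply: cvgV; [apply: lt0r_neq0; lra|apply: cvgB; [exact: cvg_cst|exact: cvg_id]].
rewrite mulrAC -RintegralZl//.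
apply: le_Rintegral => //; first exact: integrableZ_fin.
move=> y; rewrite /= in_itv/= => /andP[ty y2].
have y1 : 1 < - y by lra.
have yt : - y <= (l + 1) / 2 by rewrite -/t; lra.
have := defect_ge l1 y1 yt.
have -> : defect (potential l) (- y) = defect (potential l) y by rewrite /defect potentialN.
move=> cy.
have w0 := flux_kernel_ge0 be0 be1 1 l y.
apply: le_trans (ler_wpM2l w0 cy).
have l10 : 0 < l - 1 by lra.
have D0 : 0 < (y - 1) * (y - l) by rewrite -mulrNN; apply: mulr_gt0; lra.
have -> : flux_kernel 1 l y = c * ((l - 1) / ((y - 1) * (y - l))) `^ be / (1 - y).
  by rewrite /flux_kernel ltr0_norm ?opprB; last lra.
have y10 : 0 < 1 - y by lra.
have -> : c * ((l - 1) / ((y - 1) * (y - l))) `^ be / (1 - y) * (c / 4 * ((- y - 1) / (4 * (l - 1))) `^ be)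
   = c ^+ 2 / 4 * (((l - 1) / ((y - 1) * (y - l))) `^ be * ((- y - 1) / (4 * (l - 1))) `^ be) / (1 - y).
  by field; exact: lt0r_neq0.
apply: ler_wpM2r; first by rewrite invr_ge0 ltW.
rewrite /K -(mulrA (c ^+ 2 / 4)); apply: ler_wpM2l; first by apply: divr_ge0 => //; exact: sqr_ge0.
rewrite -powRM; [|by apply: divr_ge0; lra|by apply: divr_ge0; lra].
have v24 : (0 : R) <= 24^-1 by rewrite invr_ge0.
rewrite -(powR_div be v24 l0).
apply: powR_le; [exact: ltW|by apply: divr_ge0 => //; exact: ltW|].
have -> : (l - 1) / ((y - 1) * (y - l)) * ((- y - 1) / (4 * (l - 1))) = (- y - 1) / (4 * ((1 - y) * (l - y))).
  have n1 := lt0r_neq0 l10; have n2 : y - 1 != 0 by apply: ltr0_neq0; lra.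
  have n3 : y - l != 0 by apply: ltr0_neq0; lra.
  have n4 : l - y != 0 by apply: lt0r_neq0; lra.
  have n5 := lt0r_neq0 y10.
  by field; rewrite n1 n2 n3 n4 n5.
have E0 : 0 < 4 * ((1 - y) * (l - y)) by apply: mulr_gt0 => //; apply: mulr_gt0; lra.
rewrite ler_pdivlMr// mulrAC ler_pdivrMr//.
have h1 : l - y <= 2 * l by move: yt; clear -l4; lra.
apply: (@le_trans _ _ (24^-1 * (4 * ((1 - y) * (2 * l))))).
  apply: ler_wpM2l; first by rewrite invr_ge0.
  by apply: ler_wpM2l => //; apply: ler_wpM2l => //; exact: ltW.
have -> : 24^-1 * (4 * ((1 - y) * (2 * l))) = (1 - y) / 3 * l by field.
by apply: ler_wpM2r; [exact: ltW|lra].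
Qed.

Lemma speed_gt0 (l : R) : 1 < l -> 0 < speed l.
Proof.
move=> l1; apply: lt_le_trans (speed_ge_near l1).
by apply: mulr_gt0; [apply: divr_gt0 => //; exact: cst_gt0|apply: powR_gt0; lra].
Qed.

Lemma scaled_speed_gt0 (l : R) : 1 < l -> 0 < scaled_speed l.
Proof. by move=> l1; apply: mulr_gt0; [apply: powR_gt0; lra|exact: speed_gt0]. Qed.

Lemma scaled_speed_near1 (m : R) : 0 < m -> exists2 d : R, 0 < d & forall l, 1 < l -> l < 1 + d -> m < scaled_speed l.
Proof.
move=> m0; have c4 : 0 < c / 4 by apply: divr_gt0 => //; exact: cst_gt0.
have m1 : 0 < m + 1 by lra.
have e0 : 0 < c / 4 / (m + 1) by exact: divr_gt0.
exists ((c / 4 / (m + 1)) `^ be^-1 / 2); first by apply: divr_gt0 => //; exact: powR_gt0.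
move=> l l1 ld.
have t0 : 0 < 2 * (l - 1) by lra.
have ts : (2 * (l - 1)) `^ be <= c / 4 / (m + 1) by apply: powR_small => //; [exact: ltW|lra].
apply: (@lt_le_trans _ _ (m + 1)); first by lra.
apply: (@le_trans _ _ (speed l)); last first.
  rewrite /scaled_speed ler_peMl//; first exact: ltW (speed_gt0 l1).
  by rewrite -(powRr0 l); apply: ler_powR; exact: ltW.
apply: le_trans (speed_ge_near l1).
rewrite powRN ler_pdivlMr; last exact: powR_gt0.
by rewrite mulrC -ler_pdivlMr.
Qed.

Lemma scaled_speed_far (m : R) : exists2 B : R, 4 < B & forall l, B < l -> m < scaled_speed l.
Proof.
set K : R := c ^+ 2 / 4 * 24^-1 `^ be.
have K0 : 0 < K.
  apply: mulr_gt0; first by apply: divr_gt0 => //; apply: exprn_gt0; exact: cst_gt0.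
  by apply: powR_gt0; rewrite invr_gt0.
pose E : R := expR (m / K + 1 + ln 3).
have E0 : 0 < E by exact: expR_gt0.
exists (5 + 2 * E); first by lra.
move=> l Bl; have l4 : 4 < l by lra.
apply: lt_le_trans (scaled_speed_ge_far l4); rewrite -/K.
have h : m / K + 1 + ln 3 <= ln (1 + (l + 1) / 2).
  rewrite -[leLHS]expRK -/E; rewrite ler_ln ?posrE; [lra|exact: E0|lra].
have -> : m = K * (m / K) by field; exact: lt0r_neq0.
by rewrite ltr_pM2l//; move: h; set q := m / K; set r := ln 3; clear -q; lra.
Qed.

Lemma within_continuous_scaled_speed (a b : R) : 1 < a -> {within `[a, b], continuous scaled_speed}.
Proof.
move=> a1; apply: continuous_in_subspaceT => y; rewrite inE/= in_itv/= => /andP[ay _].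
by apply: continuous_scaled_speed; exact: lt_le_trans ay.
Qed.

(** The function blows up at both ends of ]1, +oo[. *)
Lemma scaled_speed_min : exists2 l0 : R, 1 < l0 & forall l, 1 < l -> scaled_speed l0 <= scaled_speed l.
Proof.
have L2 : 0 < scaled_speed 2 by apply: scaled_speed_gt0; lra.
have [d d0 hd] := scaled_speed_near1 L2; have [B B4 hB] := scaled_speed_far (scaled_speed 2).
have [d' [d'0 d'd d'1]] := exists_small d0 ltr01.
have ab : 1 + d' <= B by lra.
have a1 : 1 < 1 + d' by lra.
have [l0 l0I hl0] := EVT_min ab (@within_continuous_scaled_speed _ B a1).
have l01 : 1 < l0 by move: l0I; rewrite in_itv/= => /andP[h _]; exact: lt_le_trans h.
have h2 : scaled_speed l0 <= scaled_speed 2 by apply: hl0; rewrite in_itv/=; apply/andP; split; lra.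
exists l0; first exact: l01.
move=> l l1; have [lb|lb] := leP l B; last by apply: (le_trans h2); apply: ltW; exact: hB.
have [la|la] := leP (1 + d') l; first by apply: hl0; rewrite in_itv/= la lb.
have ld : l < 1 + d by clear -la d'd; lra.
by apply: (le_trans h2); apply: ltW; apply: hd; [exact: l1|exact: ld].
Qed.

Lemma minmax_between (x y v : R) : x < v < y -> Num.min x y <= v <= Num.max x y.
Proof. by move=> /andP[h1 h2]; rewrite ge_min le_max (ltW h1) (ltW h2) orbT. Qed.

Lemma scaled_speed_two_values (l0 lam : R) : 1 < l0 -> scaled_speed l0 < lam -> exists l1 l2 : R,
  [/\ 1 < l1, l1 < l0, l0 < l2, scaled_speed l1 = lam & scaled_speed l2 = lam].
Proof.
move=> l01 lam0; have lamp : 0 < lam by apply: lt_trans lam0; exact: scaled_speed_gt0.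
have [d d0 hd] := scaled_speed_near1 lamp; have [B B4 hB] := scaled_speed_far lam.
have l010 : 0 < l0 - 1 by lra.
have [d' [d'0 d'd d'1]] := exists_small d0 l010.
have a1 : 1 < 1 + d' by lra.
have al : 1 + d' <= l0 by lra.
have La : lam < scaled_speed (1 + d') by apply: hd; clear -d'd d'0; lra.
pose b := l0 + B.
have lb : l0 <= b by rewrite /b; clear -B4; lra.
have Lb : lam < scaled_speed b by apply: hB; rewrite /b; clear -l01; lra.
have [l1 l1I L1] : exists2 l1, l1 \in `[1 + d', l0] & scaled_speed l1 = lam.
  apply: IVT => //; first exact: within_continuous_scaled_speed.
  by rewrite minC maxC; apply: minmax_between; apply/andP; split; [exact: lam0|exact: La].
have [l2 l2I L2] : exists2 l2, l2 \in `[l0, b] & scaled_speed l2 = lam.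
  apply: IVT => //; first exact: within_continuous_scaled_speed.
  by apply: minmax_between; apply/andP; split; [exact: lam0|exact: Lb].
move: l1I l2I; rewrite !in_itv/= => /andP[h1 h2] /andP[h3 h4].
exists l1, l2; split; [| | |exact: L1|exact: L2].
- exact: lt_le_trans h1.
- by rewrite lt_neqAle h2 andbT; apply/eqP => e; move: lam0; rewrite -L1 e ltxx.
- by rewrite lt_neqAle h3 andbT; apply/eqP => e; move: lam0; rewrite -L2 e ltxx.
Qed.

End extremal_speed.

(** * Symmetry of K *)

Section symmetry.
Variable R : realType.
Notation mu := (@lebesgue_measure R).
Variable be : R.
Hypotheses (be0 : 0 < be) (be1 : be < 1).
Notation pk := (pkernel be).
Notation c := (poisson_cst be).
Notation jump := (jump be).
Notation pint := (pint be).
Notation pext := (pext be).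
Notation incr := (incr be).
Notation pvharm := (pvharm be).
Notation flux_kernel := (flux_kernel be).
Notation flux := (flux be).
Notation potential := (potential be).
Notation dirichlet := (dirichlet be).

Lemma dirichlet_gt0 (p q a b x : R) (u : R -> R) : dirichlet p q a b u -> b < x -> x < q -> 0 < u x.
Proof.
move=> S bx xq; have ab := dirichlet_ab S; have bxq : b < x < q by rewrite bx.
rewrite (dirichlet_repr be0 be1 S (lexx q) bxq).
set X := (x - b) * (q - x); set Y := (b - a) * (q - a).
have X0 : 0 < X by apply: mulr_gt0; lra.
have Y0 : 0 < Y by apply: mulr_gt0; lra.
have qa : 0 < q - a by lra.
have c0 := poisson_cst_gt0 be0 be1.
set k := c * (X / Y) `^ be / (q - a).
have k0 : 0 < k.
  apply: divr_gt0 => //; apply: mulr_gt0 => //; apply: powR_gt0; exact: divr_gt0.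
have ba2 : 0 < (a + b) / 2 - a by lra.
apply: (@lt_le_trans _ _ (k * ((a + b) / 2 - a))); first exact: mulr_gt0.
apply: Rint_ge_bump.
- exact: measurable_ext.
- exact: (integrable_pint be0 be1 bxq (dirichlet_meas S) (fun y => dirichlet_le1 y S)).
- move=> y _; apply: mulr_ge0; [exact: pkernel_ge0|by case/andP: (dirichlet_itv S y)].
- lra.
- by move=> y; rewrite /= in_itv/= extE; [move=> /andP[_ h]; left; rewrite /= in_itv/=; lra|lra].
move=> y h1 h2; rewrite (dirichlet_in S) ?mulr1//; last by lra.
have y1 : 0 < b - y by lra.
have y2 : 0 < q - y by lra.
have D0 : 0 < (y - b) * (y - q) by rewrite -mulrNN; apply: mulr_gt0; lra.
apply: ler_pM.
- by apply: mulr_ge0; [exact: ltW|exact: powR_ge0].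
- by rewrite invr_ge0 ltW.
- apply: ler_wpM2l; first exact: ltW.
  apply: powR_le; [exact: ltW|by apply: divr_ge0; exact: ltW|].
  apply: ler_wpM2l; first exact: ltW.
  rewrite lef_pV2 ?posrE// -mulrNN; apply: ler_pM; lra.
- by rewrite ltr0_norm; [rewrite lef_pV2 ?posrE; lra|lra].
Qed.

Lemma flux_kernel_jump (b s y : R) : 0 < s -> 0 < (y - b) * (y - (b + s)) ->
  flux_kernel b (b + s) y = c * s `^ be * (((y - b) * (y - (b + s))) `^ (- be) / `|y - b|).
Proof.
move=> s0 D0; rewrite /flux_kernel (_ : b + s - b = s); last by ring.
by rewrite (powR_div be (ltW s0) D0) powRN; ring.
Qed.

Lemma flux_kernel_ge_jump (b s y : R) : 0 < s -> b + s < y -> c * s `^ be * jump (y - b) <= flux_kernel b (b + s) y.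
Proof.
move=> s0 bsy; have D0 : 0 < (y - b) * (y - (b + s)) by apply: mulr_gt0; lra.
rewrite flux_kernel_jump// jumpE; last by apply: lt0r_neq0; lra.
apply: ler_wpM2l.
  by apply: mulr_ge0; [exact: ltW (poisson_cst_gt0 be0 be1)|exact: powR_ge0].
apply: ler_wpM2r; first by rewrite invr_ge0.
apply: powRN_le; [exact: ltW|by []|].
by rewrite expr2; apply: ler_wpM2l; lra.
Qed.

Lemma flux_kernel_le_jump (b s y : R) : 0 < s -> y < b -> flux_kernel b (b + s) y <= c * s `^ be * jump (y - b).
Proof.
move=> s0 yb; have D0 : 0 < (y - b) * (y - (b + s)) by rewrite -mulrNN; apply: mulr_gt0; lra.
rewrite flux_kernel_jump// jumpE; last by apply: ltr0_neq0; lra.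
apply: ler_wpM2l.
  by apply: mulr_ge0; [exact: ltW (poisson_cst_gt0 be0 be1)|exact: powR_ge0].
apply: ler_wpM2r; first by rewrite invr_ge0.
apply: powRN_le; [exact: ltW|by rewrite exprn_even_gt0//= subr_eq0; apply/eqP; lra|].
by rewrite expr2 -(mulrNN (y - b) (y - (b + s))) -mulrNN; apply: ler_wpM2l; lra.
Qed.

Lemma Rint_ge_cst (s t k : R) (f : R -> R) : s <= t -> mu.-integrable `[s, t] (EFin \o f) ->
  (forall y, s <= y -> y <= t -> k <= f y) -> k * (t - s) <= \int[mu]_(y in `[s, t]) f y.
Proof.
move=> st fi kf; have kI := integrable_cst_itv s t k.
apply: (@le_trans _ _ (\int[mu]_(y in `[s, t]) k)); last first.
  by apply: le_Rintegral => // y; rewrite /= in_itv/= => /andP[]; exact: kf.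
rewrite Rintegral_cst//= lebesgue_measure_itv/= lte_fin.
case: ltP => h; first by rewrite -EFinD.
by have -> : t = s; [lra|rewrite subrr].
Qed.

Lemma Rint_split3 (m b s : R) (g : R -> R) : m <= b -> 0 < s -> mu.-integrable `[m, +oo[ (EFin \o g) ->
  (forall y, m <= y -> y < b -> g y = 0) ->
  \int[mu]_(y in `[m, +oo[) g y = \int[mu]_(y in `[b, b + s]) g y + \int[mu]_(y in `]b + s, +oo[) g y.
Proof.
move=> mb s0 gi g0.
have E1 : `[m, +oo[%classic = `[m, b[%classic `|` `[b, +oo[%classic :> set R.
  by apply/seteqP; split => y /=; rewrite !in_itv/= !andbT; lra.
have E2 : `[b, +oo[%classic = `[b, b + s]%classic `|` `]b + s, +oo[%classic :> set R.
  by apply/seteqP; split => y /=; rewrite !in_itv/= !andbT; lra.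
have gb : mu.-integrable `[b, +oo[ (EFin \o g).
  by apply: integrableS gi => //; rewrite E1; exact: subsetUr.
rewrite {1}E1 Rintegral_setU//; last 2 first.
- by rewrite -E1.
- by apply/disj_setPS => y /=; rewrite !in_itv/= andbT; lra.
rewrite E2 Rintegral_setU//; last 2 first.
- by rewrite -E2.
- by apply/disj_setPS => y /=; rewrite !in_itv/= andbT; lra.
rewrite [X in X + _ = _](_ : _ = 0) ?add0r// /Rintegral.
rewrite (eq_integral (cst 0%E)) ?integral0// => y; rewrite inE/= in_itv/= => /andP[h1 h2].
by rewrite g0.
Qed.

(** Fold the vanishing integral at m. Up to the factor c s^be, the points beyond
b + s and their mirror images contribute at least eta ka h, and the mirror
images of [b, b + s] at least - jump (b - a) s. *)
Lemma hopf_balance (m a b q s h eta ka : R) (w : R -> R) :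
  2 * m = a + b -> a < b -> 0 < s -> b + s < q -> 0 < h -> 0 <= eta -> 0 <= ka ->
  measurable_fun setT w -> (forall y, `|w y| <= 1) -> (forall y, w (2 * m - y) = - w y) ->
  (forall y, m <= y -> 0 <= w y) -> (forall y, a <= y -> y <= b -> w y = 0) ->
  (forall y, q <= y -> y <= q + h -> eta <= w y) ->
  (forall y, q <= y -> y <= q + h -> ka <= jump (y - b) - jump (y - a)) ->
  flux b (b + s) w = 0 -> eta * ka * h <= jump (b - a) * s.
Proof.
move=> mab ab s0 bsq h0 eta0 ka0 mw w1 wanti wpos w0 weta hka nd0.
have am : a < m by lra.
have mb : m < b by lra.
pose C := c * s `^ be.
have C0 : 0 < C by apply: mulr_gt0; [exact: poisson_cst_gt0|exact: powR_gt0].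
pose f (y : R) : R := flux_kernel b (b + s) y * w y.
pose g (z : R) : R := f (2 * m - z).
have mf : measurable_fun setT f by apply: measurable_funM => //; exact: measurable_flux_kernel.
have bs : b < b + s by rewrite ltrDl.
have ab0 : 0 < b - a by rewrite subr_gt0.
have [r [r0 rs rb]] := exists_small s0 ab0.
have fi : mu.-integrable (ext b (b + s)) (EFin \o f).
  apply: (integrable_flux be0 be1 bs r0 mw w1) => y; rewrite /ext/= in_itv/= ltr_norml => ny /andP[h1 h2].
  apply: w0; first by clear -h1 rb; lra.
  rewrite leNgt; apply/negP => yb; apply: ny; apply/andP; split; first exact: ltW.
  by clear -h2 rs; lra.
have e0 : 0 < s / 2 by lra.
have em : s / 2 < b + s / 2 - m by clear -mb; lra.
have be_ : b + s / 2 - s / 2 = b by ring.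
have bs_ : b + s / 2 + s / 2 = b + s by field.
have := @Rint_split_reflect R m (b + s / 2) (s / 2) f g e0 em mf; rewrite be_ bs_.
have := right_extP m (b + s / 2) _ e0; rewrite be_ bs_ => rP.
move=> /(_ fi (fun=> erefl)).
have -> : \int[mu]_(y in ext b (b + s)) f y = 0 by exact: nd0.
have gle z : b <= z -> - (C * jump (z - a) * w z) <= g z.
  move=> bz; rewrite /g /f wanti mulrN lerN2; apply: ler_wpM2r; first by apply: wpos; clear -bz mb; lra.
  have z1 : 2 * m - z < b by clear -mab ab bz; lra.
  apply: (le_trans (flux_kernel_le_jump s0 z1)); rewrite -/C.
  rewrite (_ : 2 * m - z - b = - (z - a)); last by move: mab; clear -ab; lra.
  by rewrite jumpN.
have mg : measurable_fun setT g.
  by apply: (measurableT_comp mf); apply: measurable_funB => //; exact: measurable_cst.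
have ig : mu.-integrable `[m, +oo[ (EFin \o g).
  have hI : a - 1 < a < (a + m) / 2 by clear -am; apply/andP; split; lra.
  have iJ : mu.-integrable (ext (a - 1) ((a + m) / 2)) (EFin \o (fun z => C * jump (z - a))).
    by apply: integrableZ_fin; [exact: measurable_ext|exact: integrable_jump].
  have subI : `[m, +oo[%classic `<=` ext (a - 1) ((a + m) / 2).
    move=> y; rewrite extE; last by clear -am; lra.
    by rewrite /= !in_itv/= !andbT => my; right; clear -my am; lra.
  have mI : measurable (`[m, +oo[%classic : set R) by [].
  have iJ' : mu.-integrable `[m, +oo[ (EFin \o (fun z => C * jump (z - a))).
    by apply: integrableS iJ => //; exact: measurable_ext.
  apply: (le_integrable _ _ _ iJ'); first exact: mI.
    by apply: measurable_fun_EFin; exact: measurable_funTS.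
  move=> y /=; rewrite in_itv/= andbT => my; rewrite lee_fin.
  rewrite [leRHS]ger0_norm; last by apply: mulr_ge0; [exact: ltW|exact: jump_ge0].
  rewrite /g /f normrM (ger0_norm (flux_kernel_ge0 be0 be1 _ _ _)).
  have z1 : 2 * m - y < b by clear -mb my; lra.
  rewrite -[leRHS]mulr1; apply: ler_pM => //; first exact: flux_kernel_ge0.
  apply: (le_trans (flux_kernel_le_jump s0 z1)); rewrite -/C.
  rewrite (_ : 2 * m - y - b = - (y - a)); last by move: mab; clear -ab; lra.
  by rewrite jumpN.
have g0 y : m <= y -> y < b -> g y = 0.
  by move=> my yb; rewrite /g /f wanti (w0 y) ?oppr0 ?mulr0//; clear -my am yb; lra.
rewrite (Rint_split3 (ltW mb) s0 ig g0).
have mI : measurable (`]b + s, +oo[%classic : set R) by [].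
have sub1 : `]b + s, +oo[%classic `<=` right_ext m b (b + s).
  move=> y; rewrite /= in_itv/= andbT => yb; apply/rP; split; first by clear -yb mb s0; lra.
  by rewrite ltr_normr; apply/orP; left; clear -yb; lra.
have mR := measurable_right_ext m b (b + s).
have ifR : mu.-integrable (right_ext m b (b + s)) (EFin \o f).
  by apply: integrableS fi => //; [exact: measurable_ext|exact: subDsetl].
have ifI : mu.-integrable `]b + s, +oo[ (EFin \o f) by exact: integrableS ifR.
have igI : mu.-integrable `]b + s, +oo[ (EFin \o g).
  by apply: integrableS ig => // y; rewrite /= !in_itv/= !andbT; clear -mb s0; lra.
have igB : mu.-integrable `[b, b + s] (EFin \o g).
  by apply: integrableS ig => // y; rewrite /= !in_itv/= !andbT; clear -mb s0; lra.
have st1 : \int[mu]_(y in `]b + s, +oo[) f y <= \int[mu]_(y in right_ext m b (b + s)) f y.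
  apply: Rint_subset_le => // y /rP[my _] _.
  by apply: mulr_ge0; [exact: flux_kernel_ge0|apply: wpos; exact: ltW].
have st2 : - (C * jump (b - a)) * (b + s - b) <= \int[mu]_(y in `[b, b + s]) g y.
  apply: Rint_ge_cst => //; first exact: ltW.
  move=> y h1 h2; apply: le_trans (gle _ h1); rewrite lerN2 -[leRHS]mulr1; apply: ler_pM.
  - by apply: mulr_ge0; [exact: ltW|exact: jump_ge0].
  - by apply: wpos; clear -h1 mb; lra.
  - by apply: ler_wpM2l; [exact: ltW|apply: jump_le => //; clear -h1; lra].
  - by apply: le_trans (w1 y); exact: ler_norm.
have fg (y : R) : b + s < y -> C * (jump (y - b) - jump (y - a)) * w y <= f y + g y.
  move=> yb; have by_ : b <= y by clear -yb s0; lra.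
  have wy : 0 <= w y by apply: wpos; clear -by_ mb; lra.
  rewrite mulrBr mulrBl; apply: lerD; last exact: gle.
  by apply: ler_wpM2r => //; exact: flux_kernel_ge_jump.
have st3 : C * ka * eta * (q + h - q) <= \int[mu]_(y in `]b + s, +oo[) (f y + g y).
  apply: Rint_ge_bump => //.
  - exact: integrableD_fin.
  - move=> y; rewrite /= in_itv/= andbT => yb; apply: le_trans (fg y yb).
    apply: mulr_ge0; last by apply: wpos; clear -yb mb s0; lra.
    apply: mulr_ge0; first exact: ltW.
    by rewrite subr_ge0; apply: (jump_le be0); clear -yb s0 ab; lra.
  - by rewrite lerDl ltW.
  - by move=> y; rewrite /= !in_itv/= => /andP[h1 _]; rewrite andbT; exact: lt_le_trans h1.
  - move=> y h1 h2; apply: le_trans (fg y (lt_le_trans bsq h1)).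
    apply: ler_pM => //; first by apply: mulr_ge0 => //; exact: ltW.
      by apply: ler_wpM2l; [exact: ltW|exact: hka].
    exact: weta.
rewrite RintegralD// in st3.
move: st1 st2 st3.
move: (\int[mu]_(y in _) f y) (\int[mu]_(y in _) f y) (\int[mu]_(y in _) g y) (\int[mu]_(y in _) g y) => I1 I2 I3 I4.
move=> st1 st2 st3 E.
rewrite -(ler_pM2l C0); move: st1 st2 st3 E; move: (jump (b - a)) => j.
have -> : q + h - q = h by ring.
have -> : b + s - b = s by ring.
have -> : - (C * j) * s = - (C * (j * s)) by ring.
have -> : C * ka * eta * h = C * (eta * ka * h) by ring.
by move: (C * (j * s)) (C * (eta * ka * h)) => A B; clear -I1; lra.
Qed.

Lemma dirichlet_reflect (p q a b t : R) (u : R -> R) : dirichlet p q a b u ->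
  dirichlet (t - q) (t - p) (t - b) (t - a) (fun y => u (t - y)).
Proof.
move=> S; have := dirichlet_affine be0 (- t) (ltr01 : 0 < (1 : R)) (dirichlet_opp be0 S).
rewrite !divr1 !opprK.
have -> : (fun y => u (- (1 * y - t))) = (fun y => u (t - y)).
  by apply/funext => y; congr u; ring.
by rewrite ![- _ + t]addrC.
Qed.

(** Here w = u(2m - .) - u, where m is the centre of K. It is nonnegative on the
right of m and positive at q, and its flux into ]b, b + s[ vanishes because the
two normal derivatives agree; [hopf_balance] fails for small s. *)
Lemma no_shift (p q a b lam : R) (u : R -> R) : dirichlet p q a b u ->
  (u (b + t) - 1) / t `^ be @[t --> 0^'+] --> - lam ->
  (u (a - t) - 1) / t `^ be @[t --> 0^'+] --> - lam -> ~ p + q < a + b.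
Proof.
move=> S Hr Hl pq.
have pa := dirichlet_pa S; have ab := dirichlet_ab S; have bq := dirichlet_bq S.
pose m := (a + b) / 2.
have mab : 2 * m = a + b by rewrite /m; field.
have am : a < m by rewrite /m; lra.
have mb : m < b by rewrite /m; lra.
pose v (y : R) : R := u (2 * m - y).
have Sv : dirichlet (2 * m - q) (2 * m - p) a b v.
  have := dirichlet_reflect (2 * m) S; rewrite -/v.
  have -> : 2 * m - b = a by rewrite mab; ring.
  by have -> : 2 * m - a = b by rewrite mab; ring.
pose w (y : R) : R := v y - u y.
have mu1 := dirichlet_meas S; have mv := dirichlet_meas Sv.
have u1 y := dirichlet_le1 y S; have v1 y := dirichlet_le1 y Sv.
have w1 y : `|w y| <= 1.
  rewrite /w; have := dirichlet_itv S y; have := dirichlet_itv Sv y.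
  by move: (v y) (u y) => V U; rewrite ler_norml; clear -m; lra.
have wanti y : w (2 * m - y) = - w y.
  by rewrite /w /v subKr opprB.
have cw : continuous w by move=> y; apply: cvgB; [exact: dirichlet_cont Sv y|exact: dirichlet_cont S y].
have mw := continuous_measurableT cw.
have w0 y : a <= y -> y <= b -> w y = 0.
  by move=> h1 h2; rewrite /w (dirichlet_in S h1 h2) (dirichlet_in Sv h1 h2) subrr.
have q2 : q < 2 * m - p by rewrite mab; lra.
have wpos y : m <= y -> 0 <= w y.
  apply: (@antisym_min_principle _ _ be0 m b q 1 w (ltW mb) cw w1 wanti).
  move=> {}y my wy.
  have by_ : b < y.
    by rewrite ltNge; apply/negP => yb; move: wy; rewrite w0 ?ltxx//; exact: ltW (lt_trans am my).
  have yq : y < q.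
    rewrite ltNge; apply/negP => qy; move: wy; rewrite /w.
    rewrite (dirichlet_out S (or_intror qy)) subr0 ltNge.
    by case/andP: (dirichlet_itv Sv y) => ->.
  split; first by rewrite by_ yq.
  apply: (@pvharmB _ _ be0 _ _ _ 1) => //.
    exact (dirichlet_right Sv by_ (lt_trans yq q2)).
  exact (dirichlet_right S by_ yq).
have wq : 0 < w q.
  rewrite /w (dirichlet_out S (or_intror (lexx q))) subr0.
  exact: dirichlet_gt0 Sv bq q2.
have wq2 : 0 < w q / 2 by lra.
have /continuous_epsP /(_ _ wq2) [h' h'0 hh'] := cw q.
pose h := h' / 2.
have h0 : 0 < h by rewrite /h; lra.
have weta y : q <= y -> y <= q + h -> w q / 2 <= w y.
  move=> h1 h2; have : `|y - q| < h' by rewrite ger0_norm; move: h2; rewrite /h; clear -h1 h'0; lra.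
  by move=> /hh'; rewrite ler_norml => /andP[+ _]; move: (w y) (w q) => A B; clear -q; lra.
pose D (y : R) : R := jump (y - b) - jump (y - a).
have cD (y : R) : b < y -> {for y, continuous D}.
  move=> by_; have cj (z : R) : z < y -> {for y, continuous (fun y => jump (y - z))}.
    move=> zy; apply: (@continuous_comp _ _ _ (fun y : R => y - z) jump).
      by apply: cvgB; [exact: cvg_id|exact: cvg_cst].
    by apply: continuous_jump => //; rewrite subr_eq0; apply/eqP; lra.
  by apply: cvgB; apply: cj => //; exact: lt_trans by_.
have [y0 y0I hy0] : exists2 y0 : R, y0 \in `[q, q + h] & forall y, y \in `[q, q + h] -> D y0 <= D y.
  apply: EVT_min; first by rewrite lerDl ltW.
  apply: continuous_in_subspaceT => y; rewrite inE/= in_itv/= => /andP[qy _].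
  by apply: cD; exact: lt_le_trans qy.
have by0 : b < y0 by move: y0I; rewrite in_itv/= => /andP[qy _]; exact: lt_le_trans qy.
have D0 : 0 < D y0.
  rewrite /D subr_gt0 ltf_pV2 ?posrE ?powR_gt0 ?normr_gt0 ?subr_eq0//; try by apply/eqP; lra.
  rewrite !gtr0_norm ?subr_gt0//; last by lra.
  by have b0 := be0; apply: gt0_ltr_powR; rewrite ?nnegrE; clear -by0 ab b0; lra.
pose j := jump (b - a).
have j0 : 0 < j by apply: jump_gt0; apply: lt0r_neq0; lra.
have E0 : 0 < w q / 2 * D y0 * h by apply: mulr_gt0 => //; exact: mulr_gt0.
have bq0 : 0 < q - b by lra.
have [s [s0 sq sE]] := exists_small bq0 (divr_gt0 E0 j0).
have bsq : b + s < q by lra.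
have bs : b < b + s by lra.
have n1 : flux b (b + s) (defect u) = lam.
  apply: oppr_inj.
  exact: etrans (esym (cvg_lim (@Rhausdorff R) (dirichlet_flux be0 be1 S bs (ltW bsq)))) (cvg_lim (@Rhausdorff R) Hr).
have n2 : flux b (b + s) (defect v) = lam.
  apply: oppr_inj.
  have Hl' : (v (b + t) - 1) / t `^ be @[t --> 0^'+] --> - lam.
    have -> // : (fun t => (v (b + t) - 1) / t `^ be) = (fun t => (u (a - t) - 1) / t `^ be).
    by apply/funext => t; congr ((u _ - 1) / _); rewrite mab; ring.
  exact: etrans (esym (cvg_lim (@Rhausdorff R) (dirichlet_flux be0 be1 Sv bs (ltW (lt_trans bsq q2))))) (cvg_lim (@Rhausdorff R) Hl').
have nd0 : flux b (b + s) w = 0.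
  rewrite -(subrr lam) -{1}n1 -n2 /flux.
  have ab0 : 0 < b - a by lra.
  have [r [r0 rs rb]] := exists_small s0 ab0.
  have rbs : r <= b + s - b by rewrite addrAC subrr add0r ltW.
  have [m1 _ c1] := dirichlet_defect S; have [m2 _ c2] := dirichlet_defect Sv.
  have cN (f : R -> R) : (forall y, 0 <= f y <= 1) -> forall y, `|f y| <= 1.
    by move=> f01 y; rewrite ger0_norm; case/andP: (f01 y).
  have i1 := integrable_flux be0 be1 bs r0 m1 (cN _ c1) (fun y => @defect_vanish _ _ _ _ _ _ _ _ _ y S (ltW rb) rbs).
  have i2 := integrable_flux be0 be1 bs r0 m2 (cN _ c2) (fun y => @defect_vanish _ _ _ _ _ _ _ _ _ y Sv (ltW rb) rbs).
  rewrite -RintegralB//; last exact: measurable_ext.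
  by congr (Rintegral _ _ _); apply/funext => y; rewrite -mulrBr defectB.
have := @hopf_balance m a b q s h (w q / 2) (D y0) w mab ab s0 bsq h0 (ltW wq2) (ltW D0) mw w1 wanti wpos w0 weta _ nd0.
have hD y : q <= y -> y <= q + h -> D y0 <= jump (y - b) - jump (y - a).
  by move=> h1 h2; apply: hy0; rewrite in_itv/= h1 h2.
move=> /(_ hD); rewrite -/j [j * s]mulrC leNgt => /negP; apply.
by rewrite -ltr_pdivlMr.
Qed.

Lemma dirichlet_symmetric (p q a b lam : R) (u : R -> R) : dirichlet p q a b u ->
  (u (b + t) - 1) / t `^ be @[t --> 0^'+] --> - lam ->
  (u (a - t) - 1) / t `^ be @[t --> 0^'+] --> - lam -> a + b = p + q.
Proof.
move=> S Hr Hl; apply/eqP; rewrite eq_le !leNgt; apply/andP; split; apply/negP.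
  exact: no_shift S Hr Hl.
move=> h; apply: (no_shift (lam := lam) (dirichlet_opp be0 S)); last by lra.
  have -> // : (fun t => (u (- (- a + t)) - 1) / t `^ be) = (fun t => (u (a - t) - 1) / t `^ be).
  by apply/funext => t; rewrite opprD opprK.
have -> // : (fun t => (u (- (- b - t)) - 1) / t `^ be) = (fun t => (u (b + t) - 1) / t `^ be).
by apply/funext => t; rewrite opprB opprK [t + b]addrC.
Qed.

End symmetry.

(** * Bernoulli solutions *)

Section fractional_laplacian.
Variable R : realType.
Notation mu := (@lebesgue_measure R).

Lemma expR_cube_ge (t : R) : 0 <= t -> (1 + t) ^+ 3 <= 27 * expR t.
Proof.
move=> t0; have -> : t = 3%:R * (t / 3) by field.
rewrite [in leRHS]expRM_natl; set x := t / 3.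
have x0 : 0 <= x by rewrite /x; lra.
have h : 1 + x <= expR x by exact: expR_ge1Dx.
have -> : 27 * expR x ^+ 3 = (3 * expR x) ^+ 3 by ring.
by rewrite lerXn2r ?nnegrE; lra.
Qed.

(** Domination by the derivative of the bounded function (t / (1 + t))^s, since
exp t >= (1 + t)^3 / 27. *)
Lemma Gamma_integrable (s : R) : 0 < s -> s <= 3 / 2 ->
  mu.-integrable `]0, +oo[ (EFin \o (fun t : R => t `^ (s - 1) * expR (- t))).
Proof.
move=> s0 s32.
have p1 (x : R) : 0 < x -> 0 < 1 + x by move=> x0; lra.
pose F (t : R) : R := t `^ s * (1 + t) `^ (- s).
pose F' (t : R) : R := s * t `^ (s - 1) * (1 + t) `^ (- s - 1).
have dF (x : R) : 0 < x -> is_derive x 1 F (F' x).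
  move=> x0.
  have d1 := is_derive_powR s x0.
  have d2 := is_derive_powR (- s) (p1 x x0).
  have d3 : is_derive x 1 (fun t : R => 1 + t) 1.
    by move: (is_deriveD (is_derive_cst (1 : R) x 1) (is_derive_id x (1 : R))); rewrite add0r.
  have d4 := @is_derive1_comp R (fun t : R => t `^ (- s)) (fun t : R => 1 + t) x _ _ d2 d3.
  have d5 := is_deriveM d1 d4.
  apply: (is_derive_eq d5); rewrite /F' /GRing.scale/=.
  have e1 : x `^ s = x `^ (s - 1) * x.
    by rewrite -[in X in _ * X](powRr1 (ltW x0)) -powRD ?(lt0r_neq0 x0) ?implybT// subrK.
  have e2 : (1 + x) `^ (- s) = (1 + x) `^ (- s - 1) * (1 + x).
    by rewrite -[in X in _ * X](powRr1 (ltW (p1 x x0))) -powRD ?(lt0r_neq0 (p1 x x0)) ?implybT// subrK.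
  by rewrite e1 e2; ring.
have F'0 (x : R) : 0 < x -> 0 < F' x.
  by move=> x0; apply: mulr_gt0; [apply: mulr_gt0 => //; exact: powR_gt0|apply: powR_gt0; exact: p1].
have cF' (x : R) : 0 < x -> {for x, continuous F'}.
  move=> x0; apply: cvgM; first by apply: cvgMr; exact: continuous_powR.
  apply: (@continuous_comp _ _ _ (fun t : R => 1 + t) (fun t : R => t `^ (- s - 1))).
    by apply: cvgD; [exact: cvg_cst|exact: cvg_id].
  by apply: continuous_powR; exact: p1.
have FJ (x : R) : 0 < x -> -1 < F x < 2.
  move=> x0; have e : F x = (x / (1 + x)) `^ s.
    by rewrite (powR_div s (ltW x0) (p1 x x0)) /F powRN.
  have h0 : 0 <= (x / (1 + x)) `^ s by exact: powR_ge0.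
  have h1 : (x / (1 + x)) `^ s <= 1.
    have q0 : 0 <= x / (1 + x) by apply: divr_ge0; lra.
    have q1 : x / (1 + x) <= 1 by rewrite ler_pdivrMr; lra.
    by have := powR_le (ltW s0) q0 q1; rewrite powR1.
  by rewrite e; apply/andP; split; lra.
have I1 := integral_derive_le dF F'0 cF' FJ.
have mF' : measurable_fun `]0 : R, +oo[ F' by exact: measurable_itvoy_continuous.
have iF' : mu.-integrable `]0, +oo[ (EFin \o (fun t => 27 / s * F' t)).
  apply: integrableZ_fin => //; apply: ge0_integrable => //.
    by move=> x; rewrite /= in_itv/= andbT => x0; rewrite ltW ?F'0.
  by apply: (le_lt_trans I1); rewrite ltry.
apply: (le_integrable _ _ _ iF') => //.
  apply: measurable_fun_EFin; apply: measurable_itvoy_continuous => x x0.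
  apply: cvgM; first exact: continuous_powR.
  apply: (@continuous_comp _ _ _ (fun t : R => - t) (@expR R)); last exact: continuous_expR.
  by apply: cvgN; exact: cvg_id.
move=> t; rewrite /= in_itv/= andbT => t0; rewrite lee_fin.
have q0 := p1 t t0.
rewrite ger0_norm; last by apply: mulr_ge0; [exact: powR_ge0|exact: expR_ge0].
rewrite ger0_norm; last by apply: mulr_ge0; [apply: divr_ge0 => //; exact: ltW|rewrite ltW ?F'0].
have -> : 27 / s * F' t = t `^ (s - 1) * (27 * (1 + t) `^ (- s - 1)).
  by rewrite /F'; field; exact: lt0r_neq0.
apply: ler_wpM2l; first exact: powR_ge0.
apply: (@le_trans _ _ (27 * (1 + t) `^ (- 3%:R))); last first.
  by apply: ler_wpM2l => //; apply: ler_powR; lra.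
rewrite powRN powR_mulrn; last exact: ltW.
rewrite expRN ler_pdivlMr; last exact: exprn_gt0.
rewrite mulrC ler_pdivrMr; last exact: expR_gt0.
by apply: expR_cube_ge; exact: ltW.
Qed.

Lemma Gamma_gt0 (s : R) : 0 < s -> s <= 3 / 2 -> 0 < Gamma s.
Proof.
move=> s0 s32.
have k0 : 0 < 2^-1 * expR (- 2) :> R by apply: mulr_gt0; [rewrite invr_gt0|exact: expR_gt0].
apply: (@lt_le_trans _ _ (2^-1 * expR (- 2) * (2 - 1))); first by apply: mulr_gt0 => //; lra.
apply: Rint_ge_bump.
- exact: measurable_itv.
- exact: Gamma_integrable.
- by move=> y _; apply: mulr_ge0; [exact: powR_ge0|exact: expR_ge0].
- lra.
- by move=> y; rewrite /= !in_itv/= andbT => /andP[h _]; lra.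
move=> y h1 h2; apply: ler_pM; [by rewrite invr_ge0|exact: expR_ge0| |by rewrite ler_expR lerN2].
have y0 : 0 < y by lra.
apply: (@le_trans _ _ (y `^ (-1))).
  by rewrite powR_inv1 ?(ltW y0)// lef_pV2 ?posrE.
by apply: ler_powR => //; lra.
Qed.

Lemma frac_laplacian_cst_gt0 (alpha : R) : 0 < alpha < 2 -> 0 < frac_laplacian_cst alpha.
Proof.
move=> /andP[a0 a2]; rewrite /frac_laplacian_cst; apply: divr_gt0.
  apply: mulr_gt0; last by apply: Gamma_gt0; lra.
  by apply: mulr_gt0 => //; exact: powR_gt0.
apply: mulr_gt0; last by apply: Gamma_gt0; lra.
by apply: powR_gt0; exact: pi_gt0.
Qed.

Lemma truncated_incr (be e x M : R) (u : R -> R) : 0 < be -> 0 < e -> measurable_fun setT u -> (forall y, `|u y| <= M) ->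
  \int[mu]_(z in [set z : R | e < `|z|]) ((u (x + z) - u x) / `|z| `^ (1 + 2 * be)) =
  incr be (x - e) (x + e) u x.
Proof.
move=> be0 e0 mu1 uM.
rewrite /incr (@Rintegral_affine R 1 x (ext (x - e) (x + e))) ?oner_neq0//; last 2 first.
- exact: measurable_ext.
- apply: measurable_funTS; apply: measurable_funM; last exact: measurable_jump_sub.
  by apply: measurable_funB => //; exact: measurable_cst.
rewrite normr1 mul1r.
have -> : (fun y : R => 1 * y + x) @^-1` ext (x - e) (x + e) = [set z : R | e < `|z|].
  rewrite extE; last lra.
  apply/seteqP; split => z; rewrite /= ?in_itv/= ?andbT ltr_normr.
    by case=> h; apply/orP; [right|left]; lra.
  by move=> /orP[h|h]; [right|left]; lra.
congr (Rintegral _ _ _); apply/funext => z.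
by rewrite mul1r addrK [z + x]addrC /jump.
Qed.

(** The normalizing constant is positive. *)
Lemma frac_laplacian0 (alpha x M : R) (u : R -> R) : 0 < alpha < 2 -> measurable_fun setT u ->
  (forall y, `|u y| <= M) -> is_frac_laplacian alpha u x 0 <-> pvharm (alpha / 2) u x.
Proof.
move=> a02 mu1 uM; have k0 := frac_laplacian_cst_gt0 a02; case/andP: (a02) => a0 _.
have be0 : 0 < alpha / 2 by rewrite divr_gt0.
set k := frac_laplacian_cst alpha in k0.
have kn : k != 0 by exact: lt0r_neq0.
have E (e : R) : 0 < e -> \int[mu]_(z in [set z : R | e < `|z|]) ((u (x + z) - u x) / `|z| `^ (1 + alpha)) =
  incr (alpha / 2) (x - e) (x + e) u x.
  by move=> e0; rewrite -(truncated_incr x be0 e0 mu1 uM) mulrC divfK.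
rewrite pvharmP /is_frac_laplacian -/k; split=> H.
  move=> eta eta0; have ke0 : 0 < k * eta by exact: mulr_gt0.
  have /cvgrPdist_le /(_ _ ke0) [d /= d0 hd] := H.
  exists d => // e e0 ed; have := hd e; rewrite /ball_/= sub0r normrN gtr0_norm// => /(_ ed e0).
  by rewrite sub0r normrN E// normrM (gtr0_norm k0) ler_pM2l.
apply/cvgrPdist_le => /= eta eta0.
have [d d0 hd] := H _ (divr_gt0 eta0 k0).
exists d => //= e; rewrite /ball_/= sub0r normrN => ed e0.
rewrite sub0r normrN E// normrM (gtr0_norm k0) mulrC -ler_pdivlMr//.
by apply: hd => //; rewrite -(gtr0_norm e0).
Qed.

Lemma closure_itvoo (a b : R) : a < b -> closure `]a, b[%classic = `[a, b]%classic :> set R.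
Proof.
move=> ab; apply/seteqP; split; first exact: itv_closure.
have ne (x : R) : x \in `[a, b] -> forall e : R, 0 < e -> exists y, a < y < b /\ `|y - x| < e.
  rewrite in_itv/= => /andP[ax xb] e e0.
  have [xm|xm] := leP x ((a + b) / 2).
    have h0 : 0 < b - x by lra.
    have [d [d0 de db]] := exists_small e0 h0.
    exists (x + d); split; first by apply/andP; split; lra.
    by rewrite addrAC subrr add0r gtr0_norm.
  have h0 : 0 < x - a by lra.
  have [d [d0 de db]] := exists_small e0 h0.
  exists (x - d); split; first by apply/andP; split; lra.
  by rewrite addrAC subrr add0r normrN gtr0_norm.
move=> x xI B /nbhs_ballP[e /= e0 eB]; have [y [yab yx]] := ne x xI e e0.
exists y; split; first by rewrite /= in_itv/=.
by apply: eB; rewrite /ball/= distrC.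
Qed.

Lemma boundary_itvoo (a b : R) : a < b -> boundary `]a, b[%classic = [set a; b].
Proof.
move=> ab; rewrite /boundary closure_itvoo//.
have -> : `]a, b[%classic° = `]a, b[%classic :> set R by apply/esym; symmetry; apply: (interior_id _).1; exact: interval_open.
apply/seteqP; split => x /=; rewrite !in_itv/=.
  move=> [/andP[h1 h2] /negP]; rewrite negb_and -!leNgt => /orP[h|h].
    by left; apply/eqP; rewrite eq_le h h1.
  by right; apply/eqP; rewrite eq_le h h2.
by case=> ->; split; rewrite ?lexx ?ltxx ?andbF// ltW.
Qed.

Lemma domain_itvoo (p q : R) (K : set R) : domain K -> K `<=` `]p, q[ ->
  exists a b, [/\ p <= a, a < b, b <= q & K = `]a, b[%classic].
Proof.
move=> [[x0 Kx0] oK cK] sub; have iK : is_interval K by apply/connected_intervalP.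
have Kp x : K x -> p < x by move=> /sub; rewrite /= in_itv/= => /andP[].
have Kq x : K x -> x < q by move=> /sub; rewrite /= in_itv/= => /andP[].
have K0 : K !=set0 by exists x0.
have lbK : has_lbound K by exists p => x /Kp /ltW.
have ubK : has_ubound K by exists q => x /Kq /ltW.
have near x : K x -> exists2 e : R, 0 < e & K (x - e) /\ K (x + e).
  move=> Kx; have /nbhs_ballP[e /= e0 eK] : nbhs x K by exact: open_nbhs_nbhs.
  exists (e / 2); first by rewrite divr_gt0.
  split; apply: eK; rewrite /ball/=.
    by rewrite opprB addrCA subrr addr0 gtr0_norm; lra.
  by rewrite opprD addrA subrr sub0r normrN gtr0_norm; lra.
have Ka x : K x -> inf K < x.
  move=> /near[e e0 [Ke _]]; apply: (@le_lt_trans _ _ (x - e)); first exact: ge_inf.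
  by rewrite ltrBlDr ltrDl.
have Kb x : K x -> x < sup K.
  move=> /near[e e0 [_ Ke]]; apply: (@lt_le_trans _ _ (x + e)); first by rewrite ltrDl.
  exact: ub_le_sup.
exists (inf K), (sup K); split.
- by apply: lb_le_inf => // x /Kp /ltW.
- exact: lt_trans (Ka _ Kx0) (Kb _ Kx0).
- by apply: ge_sup => // x /Kq /ltW.
apply/seteqP; split => x /=; rewrite in_itv/=; first by move=> Kx; rewrite Ka// Kb.
move=> /andP[ax xb].
have a0 : 0 < x - inf K by rewrite subr_gt0.
have b0 : 0 < sup K - x by rewrite subr_gt0.
have [y Ky yx] := inf_adherent a0 (conj K0 lbK).
have [z Kz xz] := sup_adherent b0 (conj K0 ubK).
apply: (iK y z) => //; apply/andP; split; first by move: yx; rewrite addrCA subrr addr0 => /ltW.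
by move: xz; rewrite subKr => /ltW.
Qed.

Lemma lim_scale (g : R -> R) (l k : R) : 0 < k -> g t @[t --> 0^'+] --> l ->
  g (k * t) @[t --> 0^'+] --> l.
Proof.
move=> k0 H; apply/cvgrPdist_le => /= eta eta0.
have /cvgrPdist_le /(_ _ eta0) [d /= d0 hd] := H.
exists (d / k) => /=; first by rewrite divr_gt0.
move=> t; rewrite /ball_/= sub0r normrN => td t0; apply: hd; last by rewrite mulr_gt0.
by rewrite /ball_/= sub0r normrN normrM (gtr0_norm k0) mulrC -ltr_pdivlMr.
Qed.

Definition interval_solution (be p q a b lam : R) (u : R -> R) : Prop :=
  [/\ dirichlet be p q a b u,
      (u (b + t) - 1) / t `^ be @[t --> 0^'+] --> - lam &
      (u (a - t) - 1) / t `^ be @[t --> 0^'+] --> - lam].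

(** K is compactly contained in D: u is 1 at the ends of K and 0 at those of D.
*)
Lemma bernoulli_interval (alpha p q lam : R) (u : R -> R) (K : set R) : 0 < alpha < 2 ->
  bernoulli_solution alpha [set` `]p, q[] lam u K -> exists a b,
  K = `]a, b[%classic /\ interval_solution (alpha / 2) p q a b lam u.
Proof.
move=> a02 [u01 cu dK sK harm inn out nor].
have [a [b [pa ab bq KE]]] := domain_itvoo dK sK.
exists a, b; split => //; subst K.
rewrite closure_itvoo// in harm inn; rewrite boundary_itvoo// in nor.
have ua : u a = 1 by apply: inn; rewrite /= in_itv/= lexx ltW.
have ub : u b = 1 by apply: inn; rewrite /= in_itv/= lexx ltW.
have pa' : p < a.
  rewrite lt_neqAle pa andbT; apply/eqP => e; have : u p = 0.
    by apply: out; rewrite /= in_itv/= ltxx.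
  by rewrite e ua => /eqP; rewrite oner_eq0.
have bq' : b < q.
  rewrite lt_neqAle bq andbT; apply/eqP => e; have : u q = 0.
    by apply: out; rewrite /= in_itv/= ltxx andbF.
  by rewrite -e ub => /eqP; rewrite oner_eq0.
have mu1 := continuous_measurableT cu.
have uN y : `|u y| <= 1 by rewrite ger0_norm; case/andP: (u01 y).
have supK : sup `]a, b[%classic = b by rewrite sup_itv// bnd_simp.
split; first split => //.
- by move=> x h1 h2; apply: inn; rewrite /= in_itv/= h1 h2.
- move=> x h; apply: out; rewrite /= in_itv/=; apply/negP; rewrite negb_and -!leNgt.
  by apply/orP.
- move=> x h1 h2; apply/(frac_laplacian0 x a02 mu1 uN); apply: harm; rewrite /= !in_itv/=; split.
    by rewrite h1 (lt_trans h2)// (lt_trans ab).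
  by rewrite leNgt h2.
- move=> x h1 h2; apply/(frac_laplacian0 x a02 mu1 uN); apply: harm; rewrite /= !in_itv/=; split.
    by rewrite h2 (lt_trans _ h1)// (lt_trans pa').
  by rewrite [x <= b]leNgt h1 andbF.
- have := nor b (or_intror erefl); rewrite /is_normal_derivative /outward_normal supK eqxx ub.
  by under eq_fun do rewrite mulr1.
- have := nor a (or_introl erefl); rewrite /is_normal_derivative /outward_normal supK ua.
  rewrite (lt_eqF ab).
  by under eq_fun do rewrite mulrN1.
Qed.

Lemma interval_bernoulli (alpha p q a b lam : R) (u : R -> R) : 0 < alpha < 2 ->
  interval_solution (alpha / 2) p q a b lam u ->
  bernoulli_solution alpha [set` `]p, q[] lam u `]a, b[%classic.
Proof.
move=> a02 [S Hr Hl]; have pa := dirichlet_pa S; have ab := dirichlet_ab S; have bq := dirichlet_bq S.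
have mu1 := dirichlet_meas S; have uN y := dirichlet_le1 y S.
have supK : sup `]a, b[%classic = b by rewrite sup_itv// bnd_simp.
split.
- exact: dirichlet_itv S.
- exact: dirichlet_cont S.
- split; first by exists ((a + b) / 2); rewrite /= in_itv/=; apply/andP; split; lra.
    exact: interval_open.
  by apply/connected_intervalP; exact: interval_is_interval.
- by move=> x; rewrite /= !in_itv/= => /andP[h1 h2]; rewrite (lt_trans pa h1) (lt_trans h2 bq).
- move=> x; rewrite closure_itvoo//= !in_itv/= => -[/andP[px xq] /negP].
  rewrite negb_and -!ltNge => /orP[h|h]; apply/(frac_laplacian0 x a02 mu1 uN).
    exact (dirichlet_left S px h).
  exact (dirichlet_right S h xq).
- by move=> x; rewrite closure_itvoo//= in_itv/= => /andP[h1 h2]; exact (dirichlet_in S h1 h2).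
- move=> x; rewrite /= in_itv/= => /negP; rewrite negb_and -!leNgt => /orP h.
  exact (dirichlet_out S h).
- move=> x; rewrite boundary_itvoo// => -[->|->]; rewrite /is_normal_derivative /outward_normal supK.
    rewrite (lt_eqF ab) (dirichlet_in S (lexx a) (ltW ab)).
    by under eq_fun do rewrite mulrN1.
  rewrite eqxx (dirichlet_in S (ltW ab) (lexx b)).
  by under eq_fun do rewrite mulr1.
Qed.

Lemma interval_solution_centered (be x0 r a b lam : R) (u : R -> R) : 0 < be -> be < 1 ->
  interval_solution be (x0 - r) (x0 + r) a b lam u -> a + b = 2 * x0.
Proof.
move=> be0 be1 [S Hr Hl]; rewrite (dirichlet_symmetric be0 be1 S Hr Hl); ring.
Qed.

(** By symmetry K is concentric with D, and uniqueness identifies the rescaled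
solution with a potential. *)
Lemma interval_solution_speed (be x0 r a b lam : R) (u : R -> R) : 0 < be -> be < 1 -> 0 < r ->
  interval_solution be (x0 - r) (x0 + r) a b lam u -> exists2 l : R, 1 < l & lam = r `^ (- be) * scaled_speed be l.
Proof.
move=> be0 be1 r0 F; have sym := interval_solution_centered be0 be1 F; case: F => S Hr _.
have pa := dirichlet_pa S; have ab := dirichlet_ab S; have bq := dirichlet_bq S.
pose k : R := b - x0; have k0 : 0 < k by rewrite /k; lra.
have kr : k < r by rewrite /k; lra.
have l1 : 1 < r / k by rewrite ltr_pdivlMr// mul1r.
exists (r / k) => //.
have := dirichlet_affine be0 x0 k0 S.
have -> : (x0 - r - x0) / k = - (r / k) by rewrite addrAC subrr sub0r mulNr.
have -> : (x0 + r - x0) / k = r / k by rewrite addrAC subrr add0r.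
have -> : (a - x0) / k = -1.
  have -> : a - x0 = - k by rewrite /k; lra.
  by rewrite mulNr divff// lt0r_neq0.
have -> : (b - x0) / k = 1 by rewrite divff// lt0r_neq0.
move=> Sv; have vE := dirichlet_uniq be0 Sv (dirichlet_potential be0 be1 l1).
have h1 := dirichlet_flux be0 be1 (dirichlet_potential be0 be1 l1) l1 (lexx _).
have K0 : 0 < k `^ be by exact: powR_gt0.
have h2 : (potential be (r / k) (1 + t) - 1) / t `^ be @[t --> 0^'+] --> - lam * k `^ be.
  have h : (u (b + k * t) - 1) / (k * t) `^ be * k `^ be @[t --> 0^'+] --> - lam * k `^ be.
    by apply: cvgMl; exact: (lim_scale k0 Hr).
  apply: cvg_trans h; apply: near_eq_cvg; near=> t.
  have t0 : 0 < t by near: t; exact: nbhs_right_gt.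
  have T0 : 0 < t `^ be by exact: powR_gt0.
  rewrite -vE (powRM be (ltW k0) (ltW t0)).
  have -> : k * (1 + t) + x0 = b + k * t by rewrite /k; ring.
  by move: (u _) => U; field; rewrite !lt0r_neq0.
have e : speed be (r / k) = lam * k `^ be.
  apply: oppr_inj; rewrite -mulNr.
  exact: etrans (esym (cvg_lim (@Rhausdorff R) h1)) (cvg_lim (@Rhausdorff R) h2).
rewrite /scaled_speed e (powR_div be (ltW r0) k0) powRN.
have R0 : 0 < r `^ be by exact: powR_gt0.
by move: R0 K0; move: (r `^ be) (k `^ be) => A B A0 B0; field; rewrite !lt0r_neq0.
Unshelve. all: by end_near.
Qed.

Lemma speed_interval_solution (be x0 r l : R) : 0 < be -> be < 1 -> 0 < r -> 1 < l ->
  exists u, interval_solution be (x0 - r) (x0 + r) (x0 - r / l) (x0 + r / l) (r `^ (- be) * scaled_speed be l) u.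
Proof.
move=> be0 be1 r0 l1; have l0 : 0 < l by lra.
pose k : R := r / l; have k0 : 0 < k by exact: divr_gt0.
have K0 : 0 < k `^ be by exact: powR_gt0.
have S := dirichlet_potential be0 be1 l1.
have s0 : 0 < k^-1 by rewrite invr_gt0.
pose P := potential be l; pose u (y : R) : R := P (k^-1 * y + - (x0 / k)).
have Hb : (P (1 + t) - 1) / t `^ be @[t --> 0^'+] --> - speed be l by exact: (dirichlet_flux be0 be1 S l1 (lexx _)).
have lamE : - (r `^ (- be) * scaled_speed be l) = - speed be l * k^-1 `^ be.
  rewrite /scaled_speed (powRV be k0) !powRN /k (powR_div be (ltW r0) l0).
  have R0 : 0 < r `^ be by exact: powR_gt0.
  have L0 : 0 < l `^ be by exact: powR_gt0.
  by move: (r `^ be) (l `^ be) (speed be l) R0 L0 => A B E A0 B0; field; rewrite !lt0r_neq0.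
have H : (P (1 + k^-1 * t) - 1) / t `^ be @[t --> 0^'+] --> - (r `^ (- be) * scaled_speed be l).
  rewrite lamE; have h : (P (1 + k^-1 * t) - 1) / (k^-1 * t) `^ be * k^-1 `^ be @[t --> 0^'+] --> - speed be l * k^-1 `^ be.
    by apply: cvgMl; exact: (lim_scale s0 Hb).
  apply: cvg_trans h; apply: near_eq_cvg; near=> t.
  have t0 : 0 < t by near: t; exact: nbhs_right_gt.
  have T0 : 0 < t `^ be by exact: powR_gt0.
  have S0 : 0 < k^-1 `^ be by exact: powR_gt0.
  rewrite (powRM be (ltW s0) (ltW t0)).
  by move: (P _) (t `^ be) (k^-1 `^ be) T0 S0 => U A B A0 B0; field; rewrite !lt0r_neq0.
exists u; split.
- have := dirichlet_affine be0 (- (x0 / k)) s0 S; rewrite -/P -/u.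
  have kn := lt0r_neq0 k0; have ln := lt0r_neq0 l0; have rn := lt0r_neq0 r0.
  have -> : (- l - - (x0 / k)) / k^-1 = x0 - r by rewrite /k; field; rewrite ln rn.
  have -> : (l - - (x0 / k)) / k^-1 = x0 + r by rewrite /k; field; rewrite ln rn.
  have -> : (-1 - - (x0 / k)) / k^-1 = x0 - r / l by rewrite /k; field; rewrite ln rn.
  by have -> : (1 - - (x0 / k)) / k^-1 = x0 + r / l by rewrite /k; field; rewrite ln rn.
- have -> // : (fun t => (u (x0 + r / l + t) - 1) / t `^ be) = (fun t => (P (1 + k^-1 * t) - 1) / t `^ be).
  apply/funext => t; rewrite /u -/k.
  have -> // : k^-1 * (x0 + k + t) - x0 / k = 1 + k^-1 * t by field; exact: lt0r_neq0.
- have -> // : (fun t => (u (x0 - r / l - t) - 1) / t `^ be) = (fun t => (P (1 + k^-1 * t) - 1) / t `^ be).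
  apply/funext => t; rewrite /u -/k.
  have -> : k^-1 * (x0 - k - t) - x0 / k = - (1 + k^-1 * t) by field; exact: lt0r_neq0.
  by rewrite /P potentialN.
Unshelve. all: by end_near.
Qed.

Definition admissible (alpha : R) (D : set R) : set R :=
  [set lam | 0 < lam /\ exists u K, bernoulli_solution alpha D lam u K].

Lemma admissibleE (alpha x0 r : R) : 0 < alpha < 2 -> 0 < r ->
  admissible alpha [set` `]x0 - r, x0 + r[] =
  [set r `^ (- (alpha / 2)) * scaled_speed (alpha / 2) l | l in [set l | 1 < l]].
Proof.
move=> a02 r0; case/andP: (a02) => a0 a2.
have be0 : 0 < alpha / 2 by rewrite divr_gt0.
have be1 : alpha / 2 < 1 by lra.
apply/seteqP; split => lam /=.
  move=> [_ [u [K /(bernoulli_interval a02)[a [b [_ F]]]]]].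
  by have [l l1 ->] := interval_solution_speed be0 be1 r0 F; exists l.
move=> [l l1 <-]; split; first by apply: mulr_gt0; [exact: powR_gt0|exact: scaled_speed_gt0].
have [u F] := speed_interval_solution x0 be0 be1 r0 l1.
by exists u; eexists; exact: (interval_bernoulli a02 F).
Qed.

Lemma inf_admissible (alpha x0 r l0 : R) : 0 < alpha < 2 -> 0 < r -> 1 < l0 ->
  (forall l, 1 < l -> scaled_speed (alpha / 2) l0 <= scaled_speed (alpha / 2) l) ->
  inf (admissible alpha [set` `]x0 - r, x0 + r[]) = r `^ (- (alpha / 2)) * scaled_speed (alpha / 2) l0.
Proof.
move=> a02 r0 l01 hl0; rewrite admissibleE//.
set E := [set _ | _ in _]; set v := _ * _.
have Ev : E v by exists l0.
have lb : lbound E v.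
  by move=> _ [l l1 <-]; apply: ler_wpM2l; [exact: powR_ge0|exact: hl0].
apply/eqP; rewrite eq_le; apply/andP; split.
  by apply: ge_inf => //; exists v.
by apply: lb_le_inf => //; exists v.
Qed.

Lemma itvoo_neq (x0 r l1 l2 : R) : 0 < r -> 1 < l1 -> l1 < l2 ->
  `](x0 - r / l1), (x0 + r / l1)[%classic <> `](x0 - r / l2), (x0 + r / l2)[%classic :> set R.
Proof.
move=> r0 l11 l12 KE.
have ll : r / l2 < r / l1 by rewrite ltr_pM2l// ltf_pV2 ?posrE; lra.
have l2p : 0 < r / l2 by apply: divr_gt0 => //; lra.
have : `](x0 - r / l1), (x0 + r / l1)[%classic (x0 + r / l2).
  by rewrite /= in_itv/=; apply/andP; split; lra.
by rewrite KE /= in_itv/= ltxx andbF.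
Qed.

End fractional_laplacian.

Unset Implicit Arguments.

Theorem theorem1p1 (R : realType) :
  exists lambda : R -> set R -> R,
  forall (alpha x0 r : R), 0 < alpha < 2 -> 0 < r ->
  let D := [set` `]x0 - r, x0 + r[] in
  0 < lambda alpha D /\
  (forall lam : R, 0 < lam -> lambda alpha D < lam ->
     exists (u1 u2 : R -> R) (K1 K2 : set R),
       [/\ (u1, K1) <> (u2, K2),
           bernoulli_solution alpha D lam u1 K1 &
           bernoulli_solution alpha D lam u2 K2]) /\
  (exists (u : R -> R) (K : set R),
     bernoulli_solution alpha D (lambda alpha D) u K) /\
  (forall lam : R, 0 < lam -> lam < lambda alpha D ->
     ~ exists (u : R -> R) (K : set R), bernoulli_solution alpha D lam u K) /\
  (forall (lam : R) (u : R -> R) (K : set R), 0 < lam ->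
     bernoulli_solution alpha D lam u K -> symmetric_about x0 K) /\
  lambda alpha D = r `^ (- (alpha / 2)) * lambda alpha [set` `]-1, 1[].
Proof.
exists (fun alpha D => inf (admissible alpha D)) => alpha x0 r a02 r0 D.
case/andP: (a02) => a0 a2.
have be0 : 0 < alpha / 2 by rewrite divr_gt0.
have be1 : alpha / 2 < 1 by lra.
have [l0 l01 hl0] := scaled_speed_min be0 be1.
have iE := inf_admissible x0 a02 r0 l01 hl0; rewrite -/D in iE.
have rb0 : 0 < r `^ (- (alpha / 2)) by exact: powR_gt0.
have L0 := scaled_speed_gt0 be0 be1 l01.
split; first by rewrite iE; exact: mulr_gt0.
split.
  move=> lam lam0; rewrite iE mulrC -ltr_pdivlMr// => lamL.
  have [l1 [l2 [l11 l10 l02 L1 L2]]] := scaled_speed_two_values be0 be1 l01 lamL.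
  have l21 : 1 < l2 by exact: lt_trans l02.
  have [u1 F1] := speed_interval_solution x0 be0 be1 r0 l11.
  have [u2 F2] := speed_interval_solution x0 be0 be1 r0 l21.
  have lE (l : R) : scaled_speed (alpha / 2) l = lam / r `^ (- (alpha / 2)) -> r `^ (- (alpha / 2)) * scaled_speed (alpha / 2) l = lam.
    by move=> ->; rewrite mulrC divfK// lt0r_neq0.
  rewrite (lE _ L1) in F1; rewrite (lE _ L2) in F2.
  exists u1, u2; do 2 eexists; split; [|exact: (interval_bernoulli a02 F1)|exact: (interval_bernoulli a02 F2)].
  by move=> [_ KE]; exact: (itvoo_neq r0 l11 (lt_trans l10 l02) KE).
split.
  have [u F] := speed_interval_solution x0 be0 be1 r0 l01.
  by exists u; eexists; rewrite iE; exact: (interval_bernoulli a02 F).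
split.
  move=> lam lam0 lamL ex; move: lamL; rewrite ltNge => /negP; apply.
  apply: ge_inf; last by split.
  by exists 0 => z [z0 _]; exact: ltW.
split.
  move=> lam u K _ /(bernoulli_interval a02)[a [b [-> F]]] x.
  have sym := interval_solution_centered be0 be1 F.
  by rewrite /= !in_itv/=; split => /andP[h1 h2]; apply/andP; split; lra.
have := inf_admissible 0 a02 (ltr01 : 0 < (1 : R)) l01 hl0.
by rewrite sub0r add0r iE => ->; rewrite powR1 mul1r.
Qed.
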